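(* Let $\mathcal G$ be a connected noncompact metric graph with exactly one halfline and no terminal point, and consider the critical energy ($p=6$). Then $\mu_{\mathcal G}=\mu_{\mathbb R^+}$; $-\infty<\mathcal E_{\mathcal G}(\mu)<0$ for every $\mu\in(\mu_{\mathbb R^+},\mu_{\mathbb R}]$; and $\mathcal E_{\mathcal G}(\mu)$ is attained if and only if $\mu\in(\mu_{\mathbb R^+},\mu_{\mathbb R}]$.
   Context: Metric graphs have finitely many edges and vertices, bounded edges identified with $[0,\ell_e]$ and halflines with $[0,\infty)$ (far endpoints: vertices at infinity). A terminal point is a vertex of degree one that is not a vertex at infinity. $H^1_\mu(\mathcal G)$: continuous functions, $H^1$ on each edge, $\|u\|_2^2=\mu$. $E(u,\mathcal G)=\frac12\int|u'|^2-\frac16\int|u|^6$, $\mathcal E_{\mathcal G}(\mu)=\inf_{H^1_\mu(\mathcal G)}E(\cdot,\mathcal G)$, defined for $\mu>0$. For a graph $X$, $K_X=\sup_{u\in H^1(X),u\ne0}\frac{\|u\|_6^6}{\|u\|_2^4\|u'\|_2^2}$ and $\mu_X=\sqrt{3/K_X}$; $\mu_{\mathbb R}=\pi\sqrt3/2$, $\mu_{\mathbb R^+}=\pi\sqrt3/4$. *)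

(* Defs.v *)
From HB Require Import structures.
From mathcomp Require Import all_boot all_order all_algebra.
From mathcomp Require Import all_classical all_reals all_analysis.
Set Implicit Arguments. Unset Strict Implicit. Unset Printing Implicit Defensive.
Import Order.TTheory GRing.Theory Num.Theory.
Import numFieldNormedType.Exports.
Local Open Scope classical_set_scope.
Local Open Scope ring_scope.

(* A metric graph with finitely many edges:
   - V  : the (finite) vertices (not at infinity),
   - BE : bounded edges e, identified with [0, blen e], 0 ~ bsrc e, blen e ~ btgt e,
   - HL : halflines h, identified with [0, +oo), 0 ~ hsrc h (the far endpoint
          is a vertex at infinity, not an element of V).
   Self-loops and multiple edges are allowed. *)
Record metric_graph (R : realType) := MetricGraph {
  V : finType;
  BE : finType;
  HL : finType;
  bsrc : BE -> V;
  btgt : BE -> V;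
  blen : BE -> R;
  blen_gt0 : forall e, 0 < blen e;
  hsrc : HL -> V }.

Section Graphs.
Variable R : realType.
Variable G : metric_graph R.

(* degree of a (finite) vertex; a self-loop counts twice *)
Definition deg (v : V G) : nat :=
  #|[set e | bsrc e == v]| + #|[set e | btgt e == v]| + #|[set h | hsrc h == v]|.

Definition terminal_point (v : V G) : Prop := deg v = 1%N.

Definition adj : rel (V G) := fun v w =>
  [exists e, ((bsrc e == v) && (btgt e == w)) || ((bsrc e == w) && (btgt e == v))].

(* the metric graph is connected (halflines are attached to a vertex, so
   this is connectivity of the vertices through bounded edges) *)
Definition connected_graph : Prop := forall v w : V G, connect adj v w.

End Graphs.

Section Sobolev.
Variable R : realType.
Local Notation leb := (@lebesgue_measure R).

(* u in H^1(0,l) with (weak) derivative g : g in L^2(0,l) and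
   u x = u 0 + int_0^x g for all x in [0,l] *)
Definition H1_seg (l : R) (u g : R -> R) : Prop :=
  [/\ measurable_fun `[0%R, l] g,
      (\int[leb]_(x in `[0%R, l]) ((g x) ^+ 2)%:E < +oo)%E &
      forall x, 0 <= x <= l -> u x = u 0 + Rintegral leb `[0%R, x] g].

Definition H1_hl (u g : R -> R) : Prop :=
  [/\ measurable_fun `[(0:R)%R, +oo[ g,
      (\int[leb]_(x in `[(0:R)%R, +oo[) ((g x) ^+ 2)%:E < +oo)%E,
      (\int[leb]_(x in `[(0:R)%R, +oo[) ((u x) ^+ 2)%:E < +oo)%E &
      forall x, 0 <= x -> u x = u 0 + Rintegral leb `[0%R, x] g].

Variable G : metric_graph R.

(* a (real-valued) function on G, edge by edge, together with a choice
   of its edgewise derivative *)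
Record gfun := GFun {
  ub : BE G -> R -> R;
  gb : BE G -> R -> R;
  uh : HL G -> R -> R;
  gh : HL G -> R -> R }.

Definition H1 (f : gfun) : Prop :=
  (exists phi : V G -> R,
     (forall e, ub f e 0 = phi (bsrc e) /\ ub f e (blen e) = phi (btgt e)) /\
     (forall h, uh f h 0 = phi (hsrc h))) /\
  (forall e, H1_seg (blen e) (ub f e) (gb f e)) /\
  (forall h, H1_hl (uh f h) (gh f h)).

Definition gint (F : R -> R) (u : BE G -> R -> R) (w : HL G -> R -> R) : \bar R :=
  (\sum_(e : BE G) \int[leb]_(x in `[0%R, blen e]) (F (u e x))%:E +
   \sum_(h : HL G) \int[leb]_(x in `[(0:R)%R, +oo[) (F (w h x))%:E)%E.

Definition mass (f : gfun) : \bar R := gint (fun y => y ^+ 2) (ub f) (uh f).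
Definition dnorm (f : gfun) : \bar R := gint (fun y => y ^+ 2) (gb f) (gh f).
Definition p6 (f : gfun) : \bar R := gint (fun y => `|y| ^+ 6) (ub f) (uh f).

Definition energy (f : gfun) : \bar R :=
  ((2^-1)%:E * dnorm f - (6^-1)%:E * p6 f)%E.

Definition H1_mu (m : R) (f : gfun) : Prop := H1 f /\ mass f = m%:E.

Definition Elev (m : R) : \bar R := ereal_inf [set energy f | f in H1_mu m].

Definition KG : \bar R :=
  ereal_sup [set (fine (p6 f) / (fine (mass f) ^+ 2 * fine (dnorm f)))%:E
            | f in [set f | H1 f /\ mass f <> 0%E]].

Definition muG : R := Num.sqrt (3 / fine KG).

End Sobolev.

Definition mu_line (R : realType) : R := pi * Num.sqrt 3 / 2.
Definition mu_halfline (R : realType) : R := pi * Num.sqrt 3 / 4.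

(* Main.v *)
(* Let u be a function on the graph and A >= max |u|.  The energy density plus A^4 u^2 / 6
   equals (u'^2 + (A^4 u^2 - u^6) / 3) / 2, which by AM-GM dominates |(Psi_A o u)'|, where
   Psi_A is a primitive of sqrt ((A^4 u^2 - u^6) / 3).  Hence the variation of Psi_A o u along
   disjoint paths bounds E(u) + A^4 m / 6 from below, and no rearrangement is needed.

   One path from a maximum point of u to infinity is worth Psi_A(A) = A^4 mu_(R^+) / 6; as the
   path avoids a set of positive mass, E(u) > 0 when m <= mu_(R^+), which by scaling is the
   Gagliardo-Nirenberg inequality with the constant of the halfline.  In the absence of terminal
   points there are two disjoint ways to leave the maximum point; each carries Psi_A(A) up to an
   error O(m / max |u|^2), so for m <= mu_R functions of energy below a negative level are
   bounded.  Minimising families then converge along an ultrafilter, locally uniformly and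
   weakly in H^1; the energy of the tail lost at infinity is nonnegative in the limit, and a loss
   of mass is repaired by scaling, which lowers a negative energy.

   The competitors are constant on the compact core and equal to a truncated soliton
   A sech^(1/2)(k x - T) on the halfline: T = 0 gives the optimal constant and the negative
   energies for m > mu_(R^+), and T large gives energies tending to -oo for m > mu_R. *)
Require Import Defs.
From HB Require Import structures.
From mathcomp Require Import all_boot all_order all_algebra.
From mathcomp Require Import all_classical all_reals all_analysis.
From mathcomp Require Import measurable_realfun.
From mathcomp Require Import ring lra.
Set Implicit Arguments. Unset Strict Implicit. Unset Printing Implicit Defensive.
Import Order.TTheory GRing.Theory Num.Theory.
Import numFieldNormedType.Exports.
Local Open Scope classical_set_scope.
Local Open Scope ring_scope.

(** At the critical masses the terms of order [A ^+ 4] cancel exactly, so the lower-order terms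
    decide. With [A] equal to the maximum [a], mass mu_(R^+) only gives E >= 0. Strictness, which
    excludes minimisers there, comes from a height slightly above [a]: the mass [mS] off the path is
    still charged at the rate of [a]. For [A ^+ 4 = a ^+ 4 * (1 + c ^+ 2)] this saves a term of
    order c^2, whereas the shortfall of [Psi A a] is of order c^3 only, so no equality case has to
    be analysed. At mass mu_R the error of the two escapes must vanish as the maximum grows; a
    merely bounded error would say nothing about negative levels close to 0. An escape need not
    reach infinity: on a bounded segment a function of given mass either dips almost to zero or pays
    for its potential. Comparing dips in three consecutive thirds of length l improves the crude
    error a^2 m / l twice, each time by a factor of order 1 / (a l)^2. The ultrafilter makes all
    bounded quantities converge at once, so no subsequences are extracted, and convexity in L^2
    takes the place of the weak topology for the derivatives. *)

Lemma norm_le_sqr (R : realType) (a b : R) : `|a| <= b -> a ^+ 2 <= b ^+ 2.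
Proof.
move=> ab; rewrite -(real_normK (num_real a)) lerXn2r// nnegrE.
exact: le_trans ab.
Qed.

(** * Integrals of real functions over intervals *)

Section Integrals.
Variable R : realType.
Local Notation mu := (@lebesgue_measure R).
Local Notation igr D f := (mu.-integrable D (EFin \o f)).
Local Notation itg D f := (Rintegral mu D f).
Implicit Types (D : set R) (f g u : R -> R).

Lemma igrD D f g : measurable D -> igr D f -> igr D g -> igr D (fun x => f x + g x).
Proof. by move=> mD fi gi; apply: (eq_integrable _ _ _ _ (integrableD _ fi gi)). Qed.

Lemma igrZ D c f : measurable D -> igr D f -> igr D (fun x => c * f x).
Proof. by move=> mD fi; apply: (eq_integrable _ _ _ _ (integrableZl _ c fi)). Qed.

Lemma igrB D f g : measurable D -> igr D f -> igr D g -> igr D (fun x => f x - g x).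
Proof. by move=> mD fi gi; apply: (eq_integrable _ _ _ _ (integrableB _ fi gi)). Qed.

Lemma igr_meas D f : igr D f -> measurable_fun D f.
Proof. by move=> fi; apply/measurable_EFinP; exact: measurable_int fi. Qed.

Lemma igr_le D f g : measurable D -> measurable_fun D f ->
  (forall x, D x -> `|f x| <= g x) -> igr D g -> igr D f.
Proof.
move=> mD mf fg; apply: le_integrable => //; first exact/measurable_EFinP.
by move=> x Dx /=; rewrite lee_fin (le_trans (fg x Dx))// ler_norm.
Qed.

Lemma igr_ge0 D f : measurable D -> measurable_fun D f -> (forall x, D x -> 0 <= f x) ->
  (\int[mu]_(x in D) (f x)%:E < +oo)%E -> igr D f.
Proof.
move=> mD mf f0 fy; apply/integrableP; split; first exact/measurable_EFinP.
apply: le_lt_trans fy; rewrite le_eqVlt; apply/orP; left; apply/eqP; apply: eq_integral => x; rewrite inE => Dx /=.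
by rewrite ger0_norm ?f0.
Qed.

Lemma itgE D f : measurable D -> igr D f -> (\int[mu]_(x in D) (f x)%:E = (itg D f)%:E)%E.
Proof. by move=> mD fi; rewrite /Rintegral fineK//; exact: integrable_fin_num fi. Qed.

Lemma igr_cst (s t c : R) : igr `[s, t] (fun=> c).
Proof.
by apply: continuous_compact_integrable; [exact: segment_compact|exact: cst_continuous].
Qed.

Lemma itg_cst (s t c : R) : s <= t -> itg `[s, t] (fun=> c) = c * (t - s).
Proof.
move=> st; rewrite Rintegral_cst//; congr (_ * _).
transitivity (fine (t - s)%:E); last by [].
congr fine; rewrite [LHS](lebesgue_measure_itv `[s, t])/= lte_fin.
by move: st; rewrite le_eqVlt => /predU1P[->|->//]; rewrite ltxx subrr.
Qed.

Lemma itg_split (s r t : R) f : s <= r -> r <= t -> igr `[s, t] f ->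
  itg `[s, t] f = itg `[s, r] f + itg `[r, t] f.
Proof.
move=> sr rt fi.
have E : [set` `[s, t]] = [set` `[s, r]] `|` [set` `]r, t]].
  by rewrite -itv_bndbnd_setU ?bnd_simp.
rewrite E Rintegral_setU//=.
- rewrite Rintegral_itv_obnd_cbnd//; apply: integrableS fi => //.
  by apply: subset_itvr; rewrite bnd_simp.
- by rewrite -E.
- apply/disj_setPS => x [] /=; rewrite !in_itv/= => /andP[_ xr] /andP[rx _].
  by have := le_lt_trans xr rx; rewrite ltxx.
Qed.

Lemma itg_splity (s r : R) f : s <= r -> igr `[s, +oo[ f ->
  itg `[s, +oo[ f = itg `[s, r] f + itg `[r, +oo[ f.
Proof.
move=> sr fi.
have E : [set` `[s, +oo[] = [set` `[s, r]] `|` [set` `]r, +oo[].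
  by rewrite -itv_bndbnd_setU ?bnd_simp.
rewrite E Rintegral_setU//=.
- rewrite Rintegral_itv_obnd_cbnd//; apply: integrableS fi => //.
  by apply: subset_itvr; rewrite bnd_simp.
- by rewrite -E.
- apply/disj_setPS => x [] /=; rewrite !in_itv/= => /andP[_ xr] /andP[rx _].
  by have := le_lt_trans xr rx; rewrite ltxx.
Qed.

Lemma itg_sub D D' f : measurable D -> measurable D' -> D' `<=` D ->
  (forall x, D x -> 0 <= f x) -> igr D f -> itg D' f <= itg D f.
Proof.
move=> mD mD' DD f0 fi.
have fi' : igr D' f by apply: integrableS fi.
rewrite -lee_fin -!itgE//; apply: ge0_subset_integral => //.
by apply/measurable_EFinP; exact: igr_meas fi.
Qed.

Lemma itg_pt (s : R) f : itg `[s, s] f = 0.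
Proof. by rewrite set_itv1 Rintegral_set1. Qed.

End Integrals.

(** * Functions of class H^1 on an interval starting at 0 *)

Definition segdom (R : realType) (D : set R) := [/\ measurable D, D 0 &
  (forall x, D x -> 0 <= x) /\ (forall x y, D y -> 0 <= x <= y -> D x)].

(** One format for bounded edges and halflines, so that each estimate on an edge is proved once. *)
Definition H1on (R : realType) (D : set R) (u g : R -> R) :=
  [/\ measurable_fun D g,
    (@lebesgue_measure R).-integrable D (EFin \o (fun x => g x ^+ 2)),
    (@lebesgue_measure R).-integrable D (EFin \o (fun x => u x ^+ 2)) &
    forall x, D x -> u x = u 0 + Rintegral (@lebesgue_measure R) `[0, x] g].

Section H1on_theory.
Variable R : realType.
Local Notation mu := (@lebesgue_measure R).
Local Notation igr D f := (mu.-integrable D (EFin \o f)).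
Local Notation itg D f := (Rintegral mu D f).
Implicit Types (D : set R) (f g u : R -> R).

Lemma segdom_bnd (l : R) : 0 <= l -> segdom `[0, l].
Proof.
move=> l0; split => //=; first by rewrite in_itv/= lexx l0.
split=> [x|x y]; rewrite /= !in_itv/=; first by case/andP.
by move=> /andP[_ yl] /andP[-> xy]; rewrite (le_trans xy yl).
Qed.

Lemma segdom_y : segdom `[(0:R), +oo[.
Proof.
split => //=; first by rewrite in_itv/= lexx.
split=> [x|x y]; rewrite /= !in_itv/= ?andbT//.
by move=> _ /andP[].
Qed.

Lemma segdom_sub D s t : segdom D -> 0 <= s -> D t -> `[s, t] `<=` D.
Proof.
move=> [mD D0 [Dp Dc]] s0 Dt x /=; rewrite in_itv/= => /andP[sx xt].
by apply: Dc Dt _; rewrite xt (le_trans s0 sx).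
Qed.

(* |g| <= g^2 + 1 *)
Lemma igr_sq (s t : R) g : measurable_fun `[s, t] g ->
  igr `[s, t] (fun x => g x ^+ 2) -> igr `[s, t] g.
Proof.
move=> mg g2; apply: (@igr_le _ _ _ (fun x => g x ^+ 2 + 1)) => //.
  move=> x _; rewrite -(real_normK (num_real (g x))).
  by have := sqr_ge0 (`|g x| - 1); have := normr_ge0 (g x); nra.
by apply: igrD => //; exact: igr_cst.
Qed.

Section pair.
Variables (D : set R) (u g : R -> R).
Hypotheses (sD : segdom D) (H : H1on D u g).
Let mD : measurable D. Proof. by case: sD. Qed.

Lemma H1on_igr_g2 s t : 0 <= s -> D t -> igr `[s, t] (fun x => g x ^+ 2).
Proof. by move=> s0 Dt; case: H => _ gi _ _; apply: integrableS gi => //; exact: segdom_sub. Qed.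

Lemma H1on_igr_g s t : 0 <= s -> D t -> igr `[s, t] g.
Proof.
move=> s0 Dt; apply: igr_sq; last exact: H1on_igr_g2.
by case: H => mg _ _ _; apply: measurable_funS mg => //; exact: segdom_sub.
Qed.

Lemma H1on_FTC s t : 0 <= s <= t -> D t -> u t - u s = itg `[s, t] g.
Proof.
case: H => _ _ _ Hu /andP[s0 st] Dt.
have Ds : D s by apply: (segdom_sub sD s0 Dt); rewrite /= in_itv/= lexx st.
rewrite (Hu t Dt) (Hu s Ds) (@itg_split _ 0 s t)//; first by ring.
exact: H1on_igr_g.
Qed.

(** Cauchy-Schwarz in the form of Young's inequality; the free weight [tau] avoids square roots of
    integrals. *)
Lemma H1on_osc s t (tau : R) : 0 <= s <= t -> D t -> 0 < tau ->
  `|u t - u s| <= 2^-1 * (tau * itg `[s, t] (fun x => g x ^+ 2) + (t - s) / tau).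
Proof.
move=> /andP[s0 st] Dt tau0; rewrite H1on_FTC ?s0//.
have gi : igr `[s, t] g by exact: H1on_igr_g.
have g2i : igr `[s, t] (fun x => g x ^+ 2) by exact: H1on_igr_g2.
apply: le_trans (le_normr_Rintegral _ gi) _ => //.
have -> : 2^-1 * (tau * itg `[s, t] (fun x => g x ^+ 2) + (t - s) / tau) =
  itg `[s, t] (fun x => 2^-1 * (tau * g x ^+ 2) + 2^-1 / tau).
  rewrite RintegralD//; last exact: igr_cst.
    rewrite RintegralZl//; last exact: igrZ.
    by rewrite RintegralZl// itg_cst//; field; rewrite gt_eqF.
  by do 2 apply: igrZ => //.
apply: le_Rintegral => //.
- exact: (integrable_norm gi).
- by apply: igrD => //; [do 2 apply: igrZ => //|exact: igr_cst].
move=> x _; rewrite -mulrDr mulrC ler_pdivlMr// -[X in _ <= X]mulr1.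
rewrite -(real_normK (num_real (g x))); set y := `|g x|.
have -> : tau * y ^+ 2 + tau^-1 = tau^-1 * ((tau * y) ^+ 2 + 1) by field; rewrite gt_eqF.
rewrite mulr1 mulrC ler_pdivlMl//; have := sqr_ge0 (tau * y - 1); nra.
Qed.

Lemma H1on_osc_le s t (tau C : R) : D s -> D t -> 0 < tau -> itg D (fun x => g x ^+ 2) <= C ->
  `|u t - u s| <= 2^-1 * (tau * C + `|t - s| / tau).
Proof.
move=> Ds Dt tau0 HC.
have D0 x : D x -> 0 <= x by case: sD => _ _ [D0 _]; exact: D0.
have key a b : D a -> D b -> a <= b -> `|u b - u a| <= 2^-1 * (tau * C + `|b - a| / tau).
  move=> Da Db ab; apply: le_trans (H1on_osc _ Db tau0) _; first by rewrite D0.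
  rewrite ler_pM2l ?invr_gt0// ger0_norm ?subr_ge0// lerD2r ler_pM2l//.
  apply: le_trans HC; apply: itg_sub => //.
  - by apply: segdom_sub => //; exact: D0.
  - by move=> x _; exact: sqr_ge0.
  - by case: H.
have [st|/ltW ts] := leP s t; first exact: key.
by rewrite distrC (distrC t); exact: key.
Qed.

(** The weight [eta / C] makes each of the two terms at most [eta / 2]. The admissible distance
    depends on the bound [C] alone, hence serves a whole family at once. *)
Lemma H1on_equicont (C eta s t : R) : 0 < C -> 0 < eta -> itg D (fun x => g x ^+ 2) <= C ->
  D s -> D t -> `|t - s| <= eta ^+ 2 / C -> `|u t - u s| <= eta.
Proof.
move=> C0 e0 gC Ds Dt ts; have t0 : 0 < eta / C by rewrite divr_gt0.
apply: le_trans (H1on_osc_le Ds Dt t0 gC) _; rewrite divfK ?gt_eqF//.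
suff : `|t - s| / (eta / C) <= eta by lra.
by rewrite ler_pdivrMr// mulrA -expr2.
Qed.

Lemma H1on_continuous : {within D, continuous u}.
Proof.
apply/subspace_continuousP => x Dx; apply/cvgrPdist_le => e e0.
set C := itg D (fun x => g x ^+ 2) + 1.
have C0 : 0 < C.
  by rewrite ltr_wpDl//; apply: Rintegral_ge0 => y _; exact: sqr_ge0.
rewrite near_withinE; near=> y => Dy.
apply: (@H1on_equicont C) => //; first by rewrite /C lerDl ler01.
near: y; apply: (@cvgr_dist_le _ _ _ _ _ id) => //.
by rewrite divr_gt0// exprn_gt0.
Unshelve. all: by end_near. Qed.

Lemma H1on_meas : measurable_fun D u.
Proof. by apply: subspace_continuous_measurable_fun => //; exact: H1on_continuous. Qed.

Lemma H1on_cont_seg s t : 0 <= s -> D t -> {within `[s, t], continuous u}.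
Proof.
move=> s0 Dt; apply: continuous_subspaceW H1on_continuous; exact: segdom_sub.
Qed.

Lemma H1on_igr_pow (A : R) n : (forall x, D x -> `|u x| <= A) ->
  igr D (fun x => u x ^+ n.+2).
Proof.
move=> uA; have u2 : igr D (fun x => u x ^+ 2) by case: H.
apply: (@igr_le _ _ _ (fun x => A ^+ n * u x ^+ 2)) => //.
- by apply: measurable_funX; exact: H1on_meas.
- move=> x Dx; rewrite -addn2 exprD normrM normrX (ger0_norm (sqr_ge0 _)).
  by rewrite ler_wpM2r ?sqr_ge0// lerXn2r ?nnegrE// ?uA// (le_trans _ (uA x Dx)).
- exact: igrZ.
Qed.

End pair.
End H1on_theory.

(** * Calibration *)

Section Calibration.
Variable R : realType.
Local Notation mu := (@lebesgue_measure R).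
Local Notation igr D f := (mu.-integrable D (EFin \o f)).
Local Notation itg D f := (Rintegral mu D f).

(** The derivative of [asin] blows up at the ends, and the end 1 corresponds to the maximum [u = A];
    continuity there comes from inverting [sin] on a segment. *)
Lemma within_continuous_asin : {within `[-1, 1], continuous (@asin R)}.
Proof.
have pi0 := pi_ge0 R.
have := @segment_can_le_continuous R (- (pi / 2)) (pi / 2) sin asin.
rewrite sinN sin_pihalf; apply; first by lra.
- by apply: continuous_subspaceT; exact: continuous_sin.
- by move=> x xi; rewrite sinK.
Qed.

(** The primitive of 2 sqrt(1 - y^2) that vanishes at 0. *)
Definition psi0 (y : R) := y * Num.sqrt (1 - y ^+ 2) + asin y.

(** The substitution y = u^2 / A^2 turns u sqrt(A^4 - u^4) du into (A^4 / 2) sqrt(1 - y^2) dy. The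
    result is even in u, so that changes of sign of u need no attention. *)
Definition Psi (A u : R) := A ^+ 4 / (4 * Num.sqrt 3) * psi0 (u ^+ 2 / A ^+ 2).

Lemma is_derive_psi0 (y : R) : -1 < y < 1 ->
  is_derive y 1 psi0 (2 * Num.sqrt (1 - y ^+ 2)).
Proof.
move=> yI; have p0 : 0 < 1 - y ^+ 2 by nra.
have ds : is_derive y 1 (fun z : R => Num.sqrt (1 - z ^+ 2))
   ((2 * Num.sqrt (1 - y ^+ 2))^-1 * (- (2 * y))).
  apply: (@is_derive1_comp _ Num.sqrt (fun z : R => 1 - z ^+ 2)).
    exact: is_derive1_sqrt.
  by apply: is_derive_eq; rewrite /GRing.scale/=; ring.
have da := is_derive1_asin yI.
rewrite /psi0; apply: is_derive_eq.
rewrite /GRing.scale/= mulr1; set s := Num.sqrt _.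
have s0 : 0 < s by rewrite sqrtr_gt0.
have s2 : s ^+ 2 = 1 - y ^+ 2 by rewrite sqr_sqrtr// ltW.
have y2 : y ^+ 2 = 1 - s ^+ 2 by rewrite s2; ring.
have -> : y * ((2 * s)^-1 * - (2 * y)) = - y ^+ 2 / s by field; rewrite gt_eqF.
by rewrite y2; field; rewrite gt_eqF.
Qed.

Lemma within_continuous_psi0 : {within `[-1, 1], continuous psi0}.
Proof.
apply/subspace_continuousP => x xI; apply: cvgD; last first.
  by have /subspace_continuousP := within_continuous_asin; exact.
apply: cvg_within_filter; apply: cvgM; first exact: cvg_id.
apply: (@continuous_comp _ _ _ (fun y : R => 1 - y ^+ 2) Num.sqrt); last exact: sqrt_continuous.
by apply: cvgB; [exact: cvg_cst|exact: exprn_continuous].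
Qed.

Section A.
Variable A : R.
Hypothesis A0 : 0 < A.

Lemma sqr_ratio_itv (u : R) : `|u| <= A -> 0 <= u ^+ 2 / A ^+ 2 <= 1.
Proof.
move=> uA; rewrite divr_ge0 ?sqr_ge0//= ler_pdivrMr ?exprn_gt0// mul1r.
by rewrite -(real_normK (num_real u)) lerXn2r// nnegrE ltW.
Qed.

Lemma is_derive_Psi (u : R) : `|u| < A ->
  is_derive u 1 (Psi A) (A ^+ 2 / Num.sqrt 3 * u * Num.sqrt (1 - (u ^+ 2 / A ^+ 2) ^+ 2)).
Proof.
move=> uA.
have yI : -1 < u ^+ 2 / A ^+ 2 < 1.
  rewrite ltr_pdivrMr ?exprn_gt0// mul1r -(real_normK (num_real u)) ltrXn2r// andbT.
  by rewrite (lt_le_trans (ltrN10 _))// divr_ge0// sqr_ge0.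
have dy : is_derive u 1 (fun v : R => v ^+ 2 / A ^+ 2) (2 * u / A ^+ 2).
  by apply: is_derive_eq; rewrite /GRing.scale/=; ring.
have d0 := is_derive_psi0 yI.
have dc := @is_derive1_comp _ psi0 (fun v : R => v ^+ 2 / A ^+ 2) u _ _ d0 dy.
rewrite /Psi; apply: is_derive_eq.
rewrite /GRing.scale/=; set s := Num.sqrt (1 - _).
have s3 : Num.sqrt 3 != 0 :> R by rewrite gt_eqF// sqrtr_gt0.
by field; rewrite s3 gt_eqF.
Qed.

Lemma within_continuous_Psi : {within `[- A, A], continuous (Psi A)}.
Proof.
apply/subspace_continuousP => x xA.
rewrite /Psi; apply: cvgM; first exact: cvg_cst.
have /subspace_continuousP cp := within_continuous_psi0.
have inI z : `[- A, A]%classic z -> `[-1, 1]%classic (z ^+ 2 / A ^+ 2).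
  rewrite /= !in_itv/= => zA; have /sqr_ratio_itv : `|z| <= A by rewrite ler_norml.
  by move=> /andP[h ->]; rewrite (le_trans _ h)// lerN10.
apply/cvgrPdist_le => e e0.
have /cvgrPdist_le/(_ e e0) := cp _ (inI _ xA); rewrite near_withinE => H.
have cy : (fun v : R => v ^+ 2 / A ^+ 2) v @[v --> x] --> x ^+ 2 / A ^+ 2.
  by apply: cvgM; [exact: exprn_continuous|exact: cvg_cst].
rewrite near_withinE.
have := cy _ H; rewrite /nbhs/= => H'; near=> z => zA.
have h : `[-1, 1]%classic (z ^+ 2 / A ^+ 2) ->
    `|psi0 (x ^+ 2 / A ^+ 2) - psi0 (z ^+ 2 / A ^+ 2)| <= e by near: z.
by apply: h; exact: inI.
Unshelve. all: by end_near.
Qed.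

Lemma Psi0 : Psi A 0 = 0.
Proof.
rewrite /Psi /psi0 expr0n/= mul0r mul0r add0r.
have := @sinK R 0; rewrite sin0 => ->; first by rewrite mulr0.
by have := pi_ge0 R; rewrite in_itv/=; lra.
Qed.

Lemma Psi_abs (u : R) : Psi A `|u| = Psi A u.
Proof. by rewrite /Psi real_normK// num_real. Qed.

Lemma Psi_max : Psi A A = A ^+ 4 / 6 * mu_halfline R.
Proof.
rewrite /Psi divff ?expf_neq0 ?gt_eqF// /psi0 expr1n subrr sqrtr0 mulr0 add0r.
have -> : asin 1 = pi / 2 :> R.
  rewrite -[X in asin X](@sin_pihalf R) sinK//.
  by have p0 := pi_ge0 R; rewrite in_itv/=; lra.
rewrite /mu_halfline; have s3 : Num.sqrt 3 ^+ 2 = 3 :> R by rewrite sqr_sqrtr.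
have n3 : Num.sqrt 3 != 0 :> R by rewrite gt_eqF// sqrtr_gt0.
by field: s3.
Qed.

Definition pot (u : R) := (A ^+ 4 * u ^+ 2 - u ^+ 6) / 3.

Lemma pot_ge0 (u : R) : `|u| <= A -> 0 <= pot u.
Proof.
move=> uA; rewrite /pot divr_ge0//.
have -> : A ^+ 4 * u ^+ 2 - u ^+ 6 = u ^+ 2 * (A ^+ 4 - `|u| ^+ 4).
  have -> : `|u| ^+ 4 = u ^+ 4 by rewrite -normrX ger0_norm// (exprM u 2 2) sqr_ge0.
  by ring.
by rewrite mulr_ge0 ?sqr_ge0// subr_ge0 lerXn2r// nnegrE ltW.
Qed.

Lemma pot_lip (u v : R) : `|u| <= A -> `|v| <= A ->
  `|pot u - pot v| <= 4 * A ^+ 5 * `|u - v|.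
Proof.
move=> uA vA.
have -> : pot u - pot v = (u - v) * ((A ^+ 4 * (u + v) -
  (u^+5 + u^+4 * v + u^+3 * v^+2 + u^+2 * v^+3 + u * v^+4 + v^+5)) / 3).
  by rewrite /pot; field.
rewrite normrM mulrC ler_wpM2r// normrM normfV (@ger0_norm _ 3)// ler_pdivrMr//.
have b (i j : nat) : (i + j = 5)%N -> `|u ^+ i * v ^+ j| <= A ^+ 5.
  by move=> <-; rewrite normrM !normrX exprD ler_pM ?exprn_ge0// lerXn2r ?nnegrE// ltW.
have b1 : `|A ^+ 4 * (u + v)| <= 2 * A ^+ 5.
  rewrite normrM (ger0_norm (exprn_ge0 _ (ltW A0))).
  have -> : 2 * A ^+ 5 = A ^+ 4 * (A + A) by ring.
  apply: ler_wpM2l; first by rewrite exprn_ge0// ltW.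
  by rewrite (le_trans (ler_normD _ _))// lerD.
have := b 5%N 0%N erefl; have := b 4%N 1%N erefl; have := b 3%N 2%N erefl.
have := b 2%N 3%N erefl; have := b 1%N 4%N erefl; have := b 0%N 5%N erefl.
rewrite !expr0 !expr1 !mul1r !mulr1 !ler_norml => *; move: b1; rewrite ler_norml => *.
by apply/andP; split; lra.
Qed.

(** The last clause says that [xi] lies between [a] and [b], in the form in which it is used: every
    ball containing both points contains [xi], be it centred at 0 or at another value of u. *)
Lemma Psi_MVT (a b : R) : `|a| <= A -> `|b| <= A -> exists xi : R,
  [/\ `|xi| <= A, `|Psi A b - Psi A a| <= Num.sqrt (pot xi) * `|b - a| &
     forall z eta : R, `|a - z| <= eta -> `|b - z| <= eta -> `|xi - z| <= eta].
Proof.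
wlog ab : a b / a <= b.
  move=> H aA bA; have [ab|/ltW ba] := leP a b; first exact: H.
  have [xi [h1 h2 h3]] := H b a ba bA aA; exists xi; split => //.
    by rewrite distrC (distrC b).
  by move=> *; exact: h3.
move=> aA bA.
move: (aA) (bA); rewrite !ler_norml => /andP[a1 a2] /andP[b1 b2].
have [] := @MVT_segment R (Psi A)
  (fun u => A ^+ 2 / Num.sqrt 3 * u * Num.sqrt (1 - (u ^+ 2 / A ^+ 2) ^+ 2)) a b ab.
- move=> x; rewrite in_itv/= => /andP[ax xb]; apply: is_derive_Psi.
  by rewrite ltr_norml; apply/andP; split; lra.
- apply: continuous_subspaceW within_continuous_Psi => x /=; rewrite !in_itv/= => /andP[ax xb].
  by apply/andP; split; lra.
move=> xi; rewrite in_itv/= => /andP[axi xib] E; exists xi.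
have xiA : `|xi| <= A by rewrite ler_norml; apply/andP; split; lra.
split => //; last first.
  by move=> z eta; rewrite !ler_norml => /andP[? ?] /andP[? ?]; apply/andP; split; lra.
rewrite E normrM ler_wpM2r//.
rewrite -(ler_pXn2r (n:=2)) ?nnegrE ?sqrtr_ge0//.
rewrite (sqr_sqrtr (pot_ge0 xiA)) real_normK ?num_real// !exprMn exprVn !sqr_sqrtr//; last first.
  by have /andP[? ?] := sqr_ratio_itv xiA; nra.
by rewrite le_eqVlt; apply/orP; left; apply/eqP; rewrite /pot; field; rewrite gt_eqF.
Qed.

(** The slope at [xi] is at most A^2 |xi|. Being quadratic at 0, [Psi] is negligible wherever u is
    small, at infinity as well as at a dip. *)
Lemma Psi_le (u : R) : `|u| <= A -> Psi A u <= A ^+ 2 * u ^+ 2.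
Proof.
move=> uA; have [|xi [xiA + h]] := @Psi_MVT 0 u _ uA; first by rewrite normr0 ltW.
rewrite Psi0 !subr0 => /(le_trans (ler_norm _)) /le_trans; apply.
have xu : `|xi| <= `|u| by have := h 0 `|u|; rewrite !subr0 normr0 normr_ge0 lexx; exact.
have -> : A ^+ 2 * u ^+ 2 = A ^+ 2 * `|u| * `|u| by rewrite -mulrA -expr2 real_normK ?num_real.
rewrite ler_wpM2r//.
rewrite -(ler_pXn2r (n:=2)) ?nnegrE ?sqrtr_ge0//; last by rewrite mulr_ge0// exprn_ge0// ltW.
rewrite (sqr_sqrtr (pot_ge0 xiA)) exprMn real_normK ?num_real// /pot -exprM.
have x2 : xi ^+ 2 <= u ^+ 2.
  by rewrite -(real_normK (num_real u)) -(real_normK (num_real xi)) lerXn2r ?nnegrE.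
have x6 : 0 <= xi ^+ 6 by rewrite (exprM xi 2 3) exprn_ge0// sqr_ge0.
have A4 : 0 < A ^+ 4 by rewrite exprn_gt0.
have := sqr_ge0 xi; nra.
Qed.

End A.

(** A substitute for the chain rule along an absolutely continuous function: a local estimate with
    an error proportional to the length adds up over a uniform partition. *)
Lemma le_incr_integral (F k : R -> R) (s t : R) : s <= t -> igr `[s, t] k ->
  (forall e : R, 0 < e -> exists2 d : R, 0 < d & forall a b : R, s <= a -> a <= b -> b <= t ->
     b - a <= d -> `|F b - F a| <= itg `[a, b] k + e * (b - a)) ->
  `|F t - F s| <= itg `[s, t] k.
Proof.
move=> st ki H; apply/ler_addgt0Pr => e e0.
(* The summand 1 covers the case [s = t]. *)
have e'0 : 0 < e / (t - s + 1) by rewrite divr_gt0//; lra.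
have [d d0 Hd] := H _ e'0.
pose n := (Num.truncn ((t - s) / d)).+1.
have n0 : 0 < n%:R :> R by rewrite ltr0n.
pose h := (t - s) / n%:R.
have h0 : 0 <= h by rewrite divr_ge0 ?subr_ge0// ltW.
have hd : h <= d.
  by rewrite /h ler_pdivrMr// mulrC -ler_pdivrMr// ltW// /n truncnS_gt.
have nh : n%:R * h = t - s by rewrite /h mulrC divfK ?gt_eqF.
have key i : (i <= n)%N -> `|F (s + i%:R * h) - F s| <= itg `[s, s + i%:R * h] k
    + e / (t - s + 1) * (i%:R * h).
  elim: i => [_|i IH iN].
    by rewrite mul0r addr0 mulr0 addr0 subrr normr0 itg_pt.
  have iN' : i.+1%:R * h <= t - s by rewrite -nh ler_wpM2r// ler_nat.
  have ih0 : 0 <= i%:R * h by rewrite mulr_ge0.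
  have E : i.+1%:R * h = i%:R * h + h by rewrite -natr1 mulrDl mul1r.
  have sp : itg `[s, s + i.+1%:R * h] k =
    itg `[s, s + i%:R * h] k + itg `[s + i%:R * h, s + i.+1%:R * h] k.
    apply: itg_split; [lra|lra|].
    by apply: integrableS ki => //; apply: subset_itvl; rewrite bnd_simp; lra.
  have := IH (ltnW iN); have := Hd (s + i%:R * h) (s + i.+1%:R * h).
  move=> /(_ ltac:(lra) ltac:(lra) ltac:(lra) ltac:(lra)).
  have := ler_distD (F (s + i%:R * h)) (F (s + i.+1%:R * h)) (F s).
  by rewrite sp E; lra.
have := key n (leqnn _); rewrite nh.
have -> : s + (t - s) = t by ring.
move=> /le_trans; apply.
by rewrite lerD2l mulrAC ler_pdivrMr; nra.
Qed.

Definition dens (A : R) (u g : R -> R) (x : R) := 2^-1 * (g x ^+ 2 + pot A (u x)).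

Section AMGM.
Variables (D : set R) (u g : R -> R).
Hypotheses (sD : segdom D) (H : H1on D u g).

Variable A : R.
Hypothesis A0 : 0 < A.

Lemma igr_pot D' : measurable D' -> D' `<=` D -> (forall x, D' x -> `|u x| <= A) ->
  igr D' (fun x => pot A (u x)).
Proof.
move=> mD' DD uA; have mD : measurable D by case: sD.
case: (H) => mg g2 u2 _.
have u2' : igr D' (fun x => u x ^+ 2) by exact: integrableS u2.
apply: (@igr_le _ _ _ (fun x => A ^+ 4 * u x ^+ 2)) => //; last exact: igrZ.
  have mu' : measurable_fun D' u by apply: measurable_funS (H1on_meas sD H).
  rewrite /pot; apply: measurable_funM; last exact: measurable_cst.
  apply: measurable_funB; last exact: measurable_funX.
  by apply: measurable_funM; [exact: measurable_cst|exact: measurable_funX].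
move=> x Dx; rewrite ger0_norm ?pot_ge0 ?uA// /pot.
have : 0 <= u x ^+ 6 by rewrite (exprM (u x) 2 3) exprn_ge0// sqr_ge0.
have : 0 <= A ^+ 4 * u x ^+ 2 by rewrite mulr_ge0 ?sqr_ge0// exprn_ge0// ltW.
by lra.
Qed.

Lemma igr_dens D' : measurable D' -> D' `<=` D -> (forall x, D' x -> `|u x| <= A) ->
  igr D' (dens A u g).
Proof.
move=> mD' DD uA; have mD : measurable D by case: sD.
apply: igrZ => //; apply: igrD => //; last exact: igr_pot.
by case: H => _ g2 _ _; exact: integrableS g2.
Qed.

Lemma dens_ge0 x : `|u x| <= A -> 0 <= dens A u g x.
Proof. by move=> uA; rewrite mulr_ge0// addr_ge0 ?sqr_ge0// pot_ge0. Qed.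

(** On a short interval the slope of [Psi A] is frozen at a single point [xi]; AM-GM splits slope
    times |g|, and the Lipschitz bound on [pot] returns from [xi] to the values of u. *)
Lemma Psi_incr_le s t : 0 <= s <= t -> D t -> (forall x, s <= x <= t -> `|u x| <= A) ->
  `|Psi A (u t) - Psi A (u s)| <= itg `[s, t] (dens A u g).
Proof.
move=> /andP[s0 st] Dt uA; have mD : measurable D by case: sD.
have sub : `[s, t] `<=` D by exact: segdom_sub.
apply: (@le_incr_integral (fun x => Psi A (u x))) => //.
  by apply: igr_dens => // x; rewrite /= in_itv/=; exact: uA.
move=> e e0; set C := itg D (fun x => g x ^+ 2) + 1.
have C0 : 0 < C.
  by rewrite ltr_wpDl//; apply: Rintegral_ge0 => y _; exact: sqr_ge0.
have A5 : 0 < A ^+ 5 by rewrite exprn_gt0.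
(* By [pot_lip], an oscillation [eta] of u changes [pot] by at most [e]. *)
pose eta := e / (4 * A ^+ 5).
have eta0 : 0 < eta by rewrite divr_gt0// mulr_gt0.
exists (eta ^+ 2 / C); first by rewrite divr_gt0// exprn_gt0.
move=> a b sa ab bt bad.
have inab x : a <= x <= b -> D x.
  by move=> /andP[ax xb]; apply: sub; rewrite /= in_itv/=; apply/andP; split; lra.
have uAx x : a <= x <= b -> `|u x| <= A.
  by move=> /andP[ax xb]; apply: uA; apply/andP; split; lra.
have osc x y : a <= x <= b -> a <= y <= b -> `|u x - u y| <= eta.
  move=> xab yab; apply: (@H1on_equicont _ _ _ _ sD H C) => //; try exact: inab.
    by rewrite /C lerDl ler01.
  apply: le_trans bad; move: xab yab => /andP[? ?] /andP[? ?].
  by rewrite ler_norml; apply/andP; split; lra.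
have aab : a <= a <= b by rewrite lexx.
have bab : a <= b <= b by rewrite lexx ab.
have [xi [xiA h1 h2]] := @Psi_MVT A A0 (u a) (u b) (uAx _ aab) (uAx _ bab).
apply: (le_trans h1).
have Db := inab _ bab.
have a0 : 0 <= a by lra.
have suba : `[a, b] `<=` D by exact: segdom_sub.
have gi : igr `[a, b] g by exact: (H1on_igr_g sD H).
have g2i : igr `[a, b] (fun x => g x ^+ 2) by exact: (H1on_igr_g2 sD H).
have di : igr `[a, b] (dens A u g).
  by apply: igr_dens => // x; rewrite /= in_itv/=; exact: uAx.
have gn : igr `[a, b] (fun x => `|g x|) by exact: (integrable_norm gi).
rewrite (H1on_FTC sD H) ?a0//.
set c := Num.sqrt (pot A xi).
have c0 : 0 <= c by exact: sqrtr_ge0.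
apply: (@le_trans _ _ (itg `[a, b] (fun x => c * `|g x|))).
  by rewrite RintegralZl// ler_wpM2l//; exact: le_normr_Rintegral.
rewrite -(itg_cst e ab) -RintegralD//; last exact: igr_cst.
apply: le_Rintegral => //; first exact: igrZ.
  by apply: igrD => //; exact: igr_cst.
move=> x; rewrite /= in_itv/= => xab.
have := pot_lip A0 xiA (uAx x xab); rewrite ler_norml => /andP[_ hp].
have : 4 * A ^+ 5 * `|xi - u x| <= e.
  rewrite mulrC -ler_pdivlMr ?mulr_gt0//; apply: h2; exact: osc.
have c2 : c ^+ 2 = pot A xi by rewrite sqr_sqrtr// pot_ge0.
rewrite /dens -(real_normK (num_real (g x))).
have := sqr_ge0 (c - `|g x|); nra.
Qed.

End AMGM.
End Calibration.

(** * Energy on a single edge *)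

Section Pieces.
Variable R : realType.
Local Notation mu := (@lebesgue_measure R).
Local Notation igr D f := (mu.-integrable D (EFin \o f)).
Local Notation itg D f := (Rintegral mu D f).

Lemma itg_tail (f : R -> R) : igr `[0, +oo[ f -> (forall x, 0 <= x -> 0 <= f x) ->
  forall e : R, 0 < e -> exists2 X : R, 0 <= X & forall Y, X <= Y -> itg `[Y, +oo[ f <= e.
Proof.
move=> fi f0 e e0.
have fm := igr_meas fi.
pose F (n : nat) := [set` `[0, n%:R : R]].
have := @ge0_nondecreasing_set_cvg_integral _ (measurableTypeR R) R F (EFin \o f) mu.
have FU : \bigcup_n F n = [set` `[(0:R), +oo[].
  rewrite eqEsubset; split=> [x [n _]|x]; rewrite /F/= !in_itv/= ?andbT; first by case/andP.
  move=> x0; exists (Num.truncn x).+1 => //=; rewrite in_itv/= x0/=.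
  by rewrite ltW// truncnS_gt.
have Fs n : F n `<=` `[0, +oo[.
  by move=> x; rewrite /F/= !in_itv/= andbT => /andP[].
have ndF : {homo F : n m / (n <= m)%N >-> (n <= m)%O}.
  move=> n m nm; apply/subsetPset => x; rewrite /F/= !in_itv/= => /andP[-> xn]/=.
  by rewrite (le_trans xn)// ler_nat.
move=> /(_ ndF) H.
have {H} : (\int[mu]_(x in F i) (f x)%:E)%E @[i --> \oo] -->
    (\int[mu]_(x in \bigcup_i F i) (f x)%:E)%E.
  apply: H => //.
  - by move=> i; exact: measurable_itv.
  - by move=> i; apply: measurable_funS (measurable_int _ fi).
  - by move=> i x /Fs; rewrite /= in_itv/= andbT lee_fin; exact: f0.
rewrite FU.
have -> : (fun i => (\int[mu]_(x in F i) (f x)%:E)%E) = EFin \o (fun i => itg (F i) f).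
  apply/funext => i /=; rewrite -itgE//; first exact: measurable_itv.
  by apply: integrableS fi => //; exact: measurable_itv.
rewrite (itgE _ fi)//.
move/fine_cvgP => [_]; rewrite /= => /cvgrPdist_le/(_ e e0) [n _ /(_ n (leqnn n)) /= Hn].
exists n%:R => // Y nY.
have s1 : itg `[0, +oo[ f = itg (F n) f + itg `[n%:R, +oo[ f by exact: itg_splity.
have fin : igr `[n%:R, +oo[ f.
  by apply: integrableS fi => // x; rewrite /= !in_itv/= !andbT; exact: le_trans.
have : itg `[Y, +oo[ f <= itg `[n%:R, +oo[ f.
  apply: itg_sub => // x; rewrite /= !in_itv/= !andbT; first exact: le_trans.
  by move=> nx; apply: f0; exact: le_trans nx.
move: Hn; rewrite s1 addrC addKr => /(le_trans (ler_norm _)); lra.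
Qed.

Section halfline.
Variables (u g : R -> R).
Hypothesis H : H1on `[0, +oo[ u g.
Let sD := segdom_y R.

(** If |u| exceeds [e] at a point, it stays above [e / 2] on an interval whose length [d] does not
    depend on the point, and this interval carries more mass than a far tail contains. *)
Lemma H1on_cvg0 (e : R) : 0 < e -> exists2 X : R, 0 <= X & forall x, X <= x -> `|u x| <= e.
Proof.
move=> e0; case: (H) => mg g2 u2 _.
set C := itg `[0, +oo[ (fun x => g x ^+ 2) + 1.
have C0 : 0 < C.
  by rewrite ltr_wpDl//; apply: Rintegral_ge0 => y _; exact: sqr_ge0.
pose d := (e / 2) ^+ 2 / C.
have d0 : 0 < d by rewrite divr_gt0// exprn_gt0// divr_gt0.
have t0 : 0 < d * (e / 2) ^+ 2 / 2 by rewrite divr_gt0// mulr_gt0// exprn_gt0// divr_gt0.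
have [|X X0 HX] := itg_tail u2 _ t0; first by move=> x _; exact: sqr_ge0.
exists X => // x Xx; rewrite leNgt; apply/negP => ex.
have x0 : 0 <= x by exact: le_trans Xx.
have ui : igr `[x, x + d] (fun x => u x ^+ 2).
  apply: integrableS u2 => // y; rewrite /= !in_itv/= andbT => /andP[xy _]; exact: le_trans xy.
have : itg `[x, x + d] (fun x => u x ^+ 2) <= itg `[x, +oo[ (fun x => u x ^+ 2).
  apply: itg_sub => //.
  - by move=> y; rewrite /= !in_itv/= andbT => /andP[].
  - by move=> y _; exact: sqr_ge0.
  - by apply: integrableS u2 => // y; rewrite /= !in_itv/= !andbT; exact: le_trans.
have : itg `[x, x + d] (fun=> (e / 2) ^+ 2) <= itg `[x, x + d] (fun x => u x ^+ 2).
  apply: le_Rintegral => //; first exact: igr_cst.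
  move=> y; rewrite /= in_itv/= => /andP[xy yd].
  have : `|u y - u x| <= e / 2.
    apply: (@H1on_equicont _ _ _ _ sD H C) => //; rewrite ?divr_gt0//.
    - by rewrite /C lerDl ler01.
    - by rewrite /= in_itv/= x0.
    - by rewrite /= in_itv/= (le_trans x0 xy).
    - by rewrite ger0_norm ?subr_ge0// -/d; lra.
  rewrite distrC => h; have := le_trans (lerB_dist (u x) (u y)) h => h2.
  rewrite -(real_normK (num_real (u y))) lerXn2r ?nnegrE ?divr_ge0 ?ltW//; lra.
rewrite itg_cst; last by lra.
have := HX x Xx; nra.
Qed.

Lemma within_cont_norm (a b : R) : 0 <= a -> {within `[a, b], continuous (fun x => `|u x|)}.
Proof.
move=> a0; have [ab|ba] := leP a b; last first.
  by rewrite set_itv_ge ?bnd_simp -?ltNge//; exact: continuous_subspace0.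
have b0 : 0 <= b by exact: le_trans ab.
have /subspace_continuousP cu : {within `[a, b], continuous u}.
  by apply: (H1on_cont_seg sD H) => //; rewrite /= in_itv/= b0.
by apply/subspace_continuousP => x xab; apply: cvg_norm; exact: cu.
Qed.

Lemma H1on_max_y (N : R) : 0 <= N -> exists2 y, N <= y & forall x, N <= x -> `|u x| <= `|u y|.
Proof.
move=> N0; have [h|] := pselect (forall x, N <= x -> u x = 0).
  by exists N => // x Nx; rewrite !h.
move/existsNP => [x0 /not_implyP[Nx0 /eqP ux0]].
have e0 : 0 < `|u x0| by rewrite normr_gt0.
have [X X0 HX] := H1on_cvg0 e0.
pose M := Num.max X x0.
have NM : N <= M by rewrite le_max Nx0 orbT.
have [|y] := @EVT_max R (fun x => `|u x|) N M NM; first exact: within_cont_norm.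
rewrite in_itv/= => /andP[Ny yM] Hy; exists y => // x Nx.
have [xM|Mx] := leP x M; first by apply: Hy; rewrite in_itv/= Nx.
apply: (@le_trans _ _ `|u x0|); last by apply: Hy; rewrite in_itv/= Nx0 le_max lexx orbT.
by apply: HX; apply: le_trans (ltW Mx); rewrite le_max lexx.
Qed.

Lemma Psi_le_tail (A s : R) : 0 < A -> 0 <= s -> (forall x, s <= x -> `|u x| <= A) ->
  Psi A (u s) <= itg `[s, +oo[ (dens A u g).
Proof.
move=> A0 s0 uA; apply/ler_addgt0Pr => e e0.
(* Makes the quadratic bound A^2 u^2 on [Psi] equal to [e]. *)
pose e' := Num.sqrt e / A.
have e'0 : 0 < e' by rewrite divr_gt0// sqrtr_gt0.
have [X X0 HX] := H1on_cvg0 e'0.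
pose t := Num.max X s.
have st : s <= t by rewrite le_max lexx orbT.
have Xt : X <= t by rewrite le_max lexx.
have t0 : 0 <= t by exact: le_trans st.
have Dt : `[(0:R), +oo[%classic t by rewrite /= in_itv/= t0.
have := @Psi_incr_le R _ _ _ sD H A A0 s t; rewrite s0 st => /(_ isT Dt).
move=> /(_ (fun x xi => uA x (andP xi).1)).
rewrite distrC => /(le_trans (ler_norm _)).
have di : igr `[s, +oo[ (dens A u g).
  apply: (igr_dens sD H) => // x; rewrite /= !in_itv/= !andbT; first exact: le_trans.
  exact: uA.
have : itg `[s, t] (dens A u g) <= itg `[s, +oo[ (dens A u g).
  apply: itg_sub => //.
  - by move=> y; rewrite /= !in_itv/= andbT => /andP[].
  - by move=> x; rewrite /= in_itv/= andbT => sx; apply: dens_ge0 => //; exact: uA.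
have : Psi A (u t) <= e.
  apply: le_trans (Psi_le A0 (uA t st)) _.
  have h : u t ^+ 2 <= e' ^+ 2 by apply: norm_le_sqr; exact: HX.
  apply: le_trans (ler_wpM2l (sqr_ge0 A) h) _.
  have -> : A ^+ 2 * e' ^+ 2 = e by rewrite /e' expr_div_n sqr_sqrtr ?ltW//; field; rewrite gt_eqF.
  exact: lexx.
by lra.
Qed.

Definition en (u g : R -> R) (x : R) := 2^-1 * g x ^+ 2 - 6^-1 * u x ^+ 6.

End halfline.

Lemma densE A (u g : R -> R) : dens A u g = (fun x => en u g x + A ^+ 4 / 6 * u x ^+ 2).
Proof. by apply/funext => x; rewrite /dens /en /pot; field. Qed.

Lemma igr_en (D D' : set R) u g (A : R) : segdom D -> H1on D u g -> measurable D' ->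
  D' `<=` D -> 0 < A -> (forall x, D' x -> `|u x| <= A) -> igr D' (en u g).
Proof.
move=> sD H mD' DD A0 uA; have mD : measurable D by case: sD.
have u2 : igr D' (fun x => A ^+ 4 / 6 * u x ^+ 2).
  by apply: igrZ => //; case: H => _ _ u2 _; exact: integrableS u2.
have -> : en u g = (fun x => dens A u g x - A ^+ 4 / 6 * u x ^+ 2).
  by apply/funext => x; rewrite densE addrK.
by apply: igrB => //; exact: (igr_dens sD H).
Qed.

Lemma itg_dens (D D' : set R) u g (A : R) : segdom D -> H1on D u g -> measurable D' ->
  D' `<=` D -> 0 < A -> (forall x, D' x -> `|u x| <= A) ->
  itg D' (dens A u g) = itg D' (en u g) + A ^+ 4 / 6 * itg D' (fun x => u x ^+ 2).
Proof.
move=> sD H mD' DD A0 uA; have mD : measurable D by case: sD.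
have u2 : igr D' (fun x => u x ^+ 2).
  by case: H => _ _ u2 _; exact: integrableS u2.
rewrite densE RintegralD//; [|exact: (igr_en sD H mD' DD A0 uA)|exact: igrZ].
by rewrite RintegralZl.
Qed.

Lemma mu_lineE : mu_line R = 2 * mu_halfline R.
Proof. by rewrite /mu_line /mu_halfline; field. Qed.

(** From the maximum [a] of the tail, [Psi a] descends to 0 towards infinity and to its value at [N]
    on the other side. The two descents from [Psi a a] pay for a mass up to 2 mu_(R^+) = mu_R, so
    only the boundary term [Psi a (u N)] is lost. *)
Lemma tail_energy_ge u g (N A : R) : H1on `[0, +oo[ u g -> 0 <= N ->
  itg `[N, +oo[ (fun x => u x ^+ 2) <= mu_line R ->
  (forall x, N <= x -> `|u x| <= A) ->
  - (A ^+ 2 * u N ^+ 2) <= itg `[N, +oo[ (en u g).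
Proof.
move=> H N0 mass uA; have sD := segdom_y R.
have [y Ny Hy] := H1on_max_y H N0.
have y0 : 0 <= y by exact: le_trans Ny.
have [uy0|uy0] := eqVneq (u y) 0.
  have u0 x : N <= x -> u x = 0.
    by move=> /Hy; rewrite uy0 normr0 normr_le0 => /eqP.
  rewrite u0// expr0n/= mulr0 oppr0; apply: Rintegral_ge0 => x; rewrite /= in_itv/= andbT => Nx.
  by rewrite /en u0// expr0n/= mulr0 subr0 mulr_ge0// sqr_ge0.
set a := `|u y|; have a0 : 0 < a by rewrite normr_gt0.
have sub z : 0 <= z -> `[z, +oo[ `<=` [set` `[(0:R), +oo[].
  by move=> z0 x; rewrite /= !in_itv/= !andbT; exact: le_trans.
have bnd x : `[N, +oo[%classic x -> `|u x| <= a.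
  by rewrite /= in_itv/= andbT; exact: Hy.
have := itg_dens sD H (measurable_itv `[N, +oo[) (sub _ N0) a0 bnd.
rewrite (itg_splity Ny); last exact: (igr_dens sD H a0 (measurable_itv _) (sub _ N0) bnd).
have : Psi a (u y) <= itg `[y, +oo[ (dens a u g).
  by apply: Psi_le_tail => // x yx; apply: Hy; exact: le_trans yx.
have : Psi a (u y) - Psi a (u N) <= itg `[N, y] (dens a u g).
  apply: le_trans (ler_norm _) _; apply: (Psi_incr_le sD H) => //; rewrite ?N0//.
    by rewrite /= in_itv/= y0.
  by move=> x /andP[Nx _]; exact: Hy.
have -> : Psi a (u y) = a ^+ 4 / 6 * mu_halfline R by rewrite -Psi_abs Psi_max.
have a4 : 0 < a ^+ 4 / 6 by rewrite divr_gt0// exprn_gt0.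
have aA : a ^+ 2 <= A ^+ 2.
  by apply: norm_le_sqr; rewrite /a normr_id; exact: uA.
have := ler_wpM2r (sqr_ge0 (u N)) aA.
have := Psi_le a0 (Hy _ (lexx N)).
have := ler_wpM2l (ltW a4) mass; rewrite mu_lineE; lra.
Qed.

(** The left side is affine in u^2 and thus integrates to a constant part and a multiple of the
    mass. If u^2 <= A^2 / 2, the potential is at least A^4 u^2 / 4; otherwise the left side is not
    positive. *)
Lemma pot_lower (A u m : R) : `|u| <= A -> 0 <= m -> m <= `|u| ->
  A ^+ 4 * m ^+ 2 / 4 - A ^+ 2 * m ^+ 2 / 2 * u ^+ 2 <= pot A u.
Proof.
move=> uA m0 mu'.
have vA : u ^+ 2 <= A ^+ 2 by exact: norm_le_sqr.
have mv : m ^+ 2 <= u ^+ 2.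
  by rewrite -(real_normK (num_real u)) lerXn2r// nnegrE.
rewrite /pot (exprM u 2 3) (exprM A 2 2).
move: vA mv (sqr_ge0 m); set v := u ^+ 2; set a := A ^+ 2; set q := m ^+ 2 => va qv q0.
have [h|h] := leP v (a / 2).
  have : q * a ^+ 2 <= v * a ^+ 2 by rewrite ler_wpM2r// sqr_ge0.
  have a0 : 0 <= a by lra.
  have v0 : 0 <= v by lra.
  have := mulr_ge0 (mulr_ge0 a0 q0) v0.
  have : v * v ^+ 2 <= v * (a ^+ 2 / 4) by rewrite ler_wpM2l//; nra.
  lra.
have : 0 <= v * (a ^+ 2 - v ^+ 2) by rewrite mulr_ge0//; nra.
have : 0 <= a * q * (v / 2 - a / 4) by rewrite mulr_ge0// ?mulr_ge0//; lra.
lra.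
Qed.

Lemma escape_num (A l M T P0 p1 p2 p3 F1 F2 F3 q1 q2 q3 : R) : 0 < A -> 0 < l ->
  T >= P0 - p1 + F1 / 2 -> T >= P0 - p2 + F2 / 2 -> T >= P0 - p3 + F3 / 2 ->
  p1 <= A * q1 -> p2 <= A * q2 -> p3 <= A * q3 ->
  A ^+ 2 * q2 * l / 8 <= F1 -> A ^+ 2 * q3 * l / 8 <= F2 -> 0 <= F3 ->
  0 <= q1 -> q1 * l <= M -> T >= P0 - 256 * M / (A * l ^+ 3).
Proof.
move=> A0 l0 T1 T2 T3 b1 b2 b3 f1 f2 f3 q0 q1M.
have d0 : 0 < A * l ^+ 3 by rewrite mulr_gt0// exprn_gt0.
have M0' : 0 <= M by apply: le_trans q1M; rewrite mulr_ge0// ltW.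
have M0 : 0 <= 256 * M / (A * l ^+ 3) by rewrite divr_ge0 ?mulr_ge0// ltW.
have [TP|TP] := leP P0 T; first by lra.
have e1 : A * q2 * l <= 16 * q1.
  by rewrite -(ler_pM2l A0); lra.
have e2 : A * q3 * l <= 16 * q2.
  by rewrite -(ler_pM2l A0); lra.
suff : A * q3 <= 256 * M / (A * l ^+ 3) by lra.
rewrite ler_pdivlMr//.
have : A * q3 * l * (A * l ^+ 2) <= 16 * q2 * (A * l ^+ 2).
  by rewrite ler_wpM2r// mulr_ge0 ?sqr_ge0// ltW.
have : A * q2 * l * l <= 16 * q1 * l by rewrite ler_wpM2r// ltW.
lra.
Qed.

Lemma ler_distlB (x y F T : R) : `|x - y| + F <= T -> y - x + F <= T.
Proof. by rewrite distrC; apply: le_trans; rewrite lerD2r ler_norm. Qed.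

Lemma ler_distrB (x y F T : R) : `|x - y| + F <= T -> x - y + F <= T.
Proof. by apply: le_trans; rewrite lerD2r ler_norm. Qed.

Section escape.
Variables (D : set R) (u g : R -> R).
Hypotheses (sD : segdom D) (H : H1on D u g).

(** The point [z] minimises |u|, so u(z)^2 is at most the mean of u^2. Under the smallness condition
    on the mass, the correction in [pot_lower] takes away at most half of its constant part, which
    leaves the denominator 8. *)
Lemma part_min (A M a b : R) : 0 < A -> 0 <= a -> a < b -> D b ->
  (forall x, a <= x <= b -> `|u x| <= A) ->
  itg `[a, b] (fun x => u x ^+ 2) <= M -> 4 * M <= A ^+ 2 * (b - a) ->
  exists z, [/\ a <= z <= b, u z ^+ 2 * (b - a) <= M &
    (A ^+ 2) ^+ 2 * u z ^+ 2 * (b - a) / 8 <= itg `[a, b] (fun x => pot A (u x))].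
Proof.
move=> A0 a0 ab Db uA uM MA.
have mD : measurable D by case: sD.
have sub : `[a, b] `<=` D by exact: segdom_sub.
have cn : {within `[a, b], continuous (fun x => `|u x|)}.
  have /subspace_continuousP cu : {within `[a, b], continuous u} by exact: (H1on_cont_seg sD H).
  by apply/subspace_continuousP => x xab; apply: cvg_norm; exact: cu.
have [z] := EVT_min (ltW ab) cn; rewrite in_itv/= => zab zmin.
have u2 : igr `[a, b] (fun x => u x ^+ 2).
  by case: H => _ _ u2 _; exact: integrableS u2.
have sqm x : a <= x <= b -> u z ^+ 2 <= u x ^+ 2.
  move=> xab; rewrite -(real_normK (num_real (u x))); apply: norm_le_sqr.
  by apply: zmin; rewrite in_itv.
have h1 : u z ^+ 2 * (b - a) <= M.
  have : itg `[a, b] (fun=> u z ^+ 2) <= itg `[a, b] (fun x => u x ^+ 2).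
    apply: le_Rintegral => //; first exact: igr_cst.
  by rewrite (itg_cst _ (ltW ab)) => /le_trans; apply.
exists z; split => //.
set m := `|u z|; have m2 : u z ^+ 2 = m ^+ 2 by rewrite real_normK// num_real.
have : itg `[a, b] (fun x => A ^+ 4 * m ^+ 2 / 4 - A ^+ 2 * m ^+ 2 / 2 * u x ^+ 2) <=
   itg `[a, b] (fun x => pot A (u x)).
  apply: le_Rintegral => //.
  - by apply: igrB => //; [exact: igr_cst|exact: igrZ].
  - by apply: (igr_pot sD H) => // x; rewrite /= in_itv/=; exact: uA.
  - move=> x; rewrite /= in_itv/= => xab; apply: pot_lower; [exact: uA|exact: normr_ge0|].
    by apply: zmin; rewrite in_itv.
apply: le_trans; rewrite RintegralB//; [|exact: igr_cst|exact: igrZ].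
rewrite (itg_cst (A ^+ 4 * m ^+ 2 / 4) (ltW ab)) RintegralZl// m2.
have : 0 <= A ^+ 2 * m ^+ 2 by rewrite mulr_ge0 ?sqr_ge0.
set I := itg _ _ in uM *; rewrite (exprM A 2 2).
move: MA; set q := A ^+ 2; set p := m ^+ 2 => MA qp.
have : q * p * (4 * I) <= q * p * (q * (b - a)) by rewrite ler_wpM2l//; lra.
lra.
Qed.

(** On one side of [z] the density pays for the variation of [Psi]; on the other side half of the
    potential is still available. *)
Let split_dens (A s z t : R) : 0 < A -> 0 <= s -> s <= z <= t -> D t ->
  (forall x, s <= x <= t -> `|u x| <= A) ->
  [/\ `|Psi A (u z) - Psi A (u s)| + itg `[z, t] (fun x => pot A (u x)) / 2 <=
        itg `[s, t] (dens A u g) &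
      `|Psi A (u t) - Psi A (u z)| + itg `[s, z] (fun x => pot A (u x)) / 2 <=
        itg `[s, t] (dens A u g)].
Proof.
move=> A0 s0 /andP[sz zt] Dt uA.
have z0 : 0 <= z by exact: le_trans sz.
have st : s <= t by exact: le_trans zt.
have mD : measurable D by case: sD.
have sub : `[s, t] `<=` D by exact: segdom_sub.
have Dz : D z by apply: sub; rewrite /= in_itv/= sz.
have di : igr `[s, t] (dens A u g).
  by apply: (igr_dens sD H) => // x; rewrite /= in_itv/=; exact: uA.
have low a b : s <= a -> b <= t -> a <= b ->
    itg `[a, b] (fun x => pot A (u x)) / 2 <= itg `[a, b] (dens A u g).
  move=> sa bt ab.
  have sab : `[a, b] `<=` `[s, t].
    by move=> x; rewrite /= !in_itv/= => /andP[? ?]; apply/andP; split; lra.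
  have pi : igr `[a, b] (fun x => pot A (u x)).
    apply: (igr_pot sD H) => // x; first by move=> /sab/sub.
    by move=> /sab; rewrite /= in_itv/=; exact: uA.
  rewrite mulrC -RintegralZl//; apply: le_Rintegral => //; first exact: igrZ.
    by apply: integrableS di.
  by move=> x _; rewrite /dens mulrDr lerDr mulr_ge0// sqr_ge0.
rewrite (itg_split sz zt di).
have H1 : `|Psi A (u z) - Psi A (u s)| <= itg `[s, z] (dens A u g).
  apply: (Psi_incr_le sD H) => //; first by rewrite s0.
  by move=> x /andP[? ?]; apply: uA; apply/andP; split; lra.
have H2 : `|Psi A (u t) - Psi A (u z)| <= itg `[z, t] (dens A u g).
  apply: (Psi_incr_le sD H) => //; first by rewrite z0.
  by move=> x /andP[? ?]; apply: uA; apply/andP; split; lra.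
have l1 := low z t sz (lexx _) zt; have l2 := low s z (lexx _) zt sz.
by split; [exact: lerD|rewrite [leRHS]addrC; exact: lerD].
Qed.

(** Up to an error that decreases with [A], crossing a bounded segment costs as much as descending
    to zero, from either end. The segment is cut into thirds to supply the three dips of
    [escape_num]. *)
Lemma escape (A M s t : R) : 0 < A -> 0 <= s -> s < t -> D t ->
  (forall x, s <= x <= t -> `|u x| <= A) ->
  itg `[s, t] (fun x => u x ^+ 2) <= M -> 4 * M <= A ^+ 2 * ((t - s) / 3) ->
  Psi A (u s) - 256 * M / (A ^+ 2 * ((t - s) / 3) ^+ 3) <= itg `[s, t] (dens A u g) /\
  Psi A (u t) - 256 * M / (A ^+ 2 * ((t - s) / 3) ^+ 3) <= itg `[s, t] (dens A u g).
Proof.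
move=> A0 s0 st Dt uA uM MA; set l := (t - s) / 3 in MA *.
have l0 : 0 < l by rewrite /l; lra.
have mD : measurable D by case: sD.
have sub : `[s, t] `<=` D by exact: segdom_sub.
have u2 : igr `[s, t] (fun x => u x ^+ 2).
  by case: H => _ _ u2 _; exact: integrableS u2.
have sst a b : s <= a -> b <= t -> `[a, b] `<=` `[s, t].
  by move=> sa bt x; rewrite /= !in_itv/= => /andP[? ?]; apply/andP; split; lra.
have part a : s <= a -> a + l <= t -> exists z, [/\ a <= z <= a + l, u z ^+ 2 * l <= M &
    (A ^+ 2) ^+ 2 * u z ^+ 2 * l / 8 <= itg `[a, a + l] (fun x => pot A (u x))].
  move=> sa alt; have := @part_min A M a (a + l) A0.
  rewrite [a + l - a]addrC addKr; apply => //; [lra|lra| | |].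
  - by apply: sub; rewrite /= in_itv/=; apply/andP; split; lra.
  - by move=> x /andP[? ?]; apply: uA; apply/andP; split; lra.
  - apply: le_trans uM; apply: itg_sub => //; first exact: sst.
    by move=> x _; exact: sqr_ge0.
have [z1 [/andP[a1 b1] c1 d1]] := part s (lexx _) ltac:(rewrite /l; lra).
have [z2 [/andP[a2 b2] c2 d2]] := part (s + l) ltac:(lra) ltac:(rewrite /l; lra).
have [z3 [/andP[a3 b3] c3 d3]] := part (s + l + l) ltac:(lra) ltac:(rewrite /l; lra).
have t3 : s + l + l + l = t by rewrite /l; field.
have pp x : `[s, t]%classic x -> 0 <= pot A (u x).
  by rewrite /= in_itv/= => xst; apply: pot_ge0 => //; exact: uA.
have ip : igr `[s, t] (fun x => pot A (u x)).
  by apply: (igr_pot sD H) => // x; rewrite /= in_itv/=; exact: uA.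
have mono a b a' b' : s <= a' -> a' <= a -> b <= b' -> b' <= t ->
    itg `[a, b] (fun x => pot A (u x)) <= itg `[a', b'] (fun x => pot A (u x)).
  move=> sa aa bb bt; apply: itg_sub => //.
  - by move=> x; rewrite /= !in_itv/= => /andP[? ?]; apply/andP; split; lra.
  - by move=> x /(sst _ _ sa bt); exact: pp.
  - by apply: integrableS ip => //; exact: sst.
have ple z : s <= z <= t -> Psi A (u z) <= A ^+ 2 * u z ^+ 2.
  by move=> zst; apply: Psi_le => //; exact: uA.
have e1 : s + l <= t by rewrite -t3 -addrA lerDl addr_ge0// ltW.
have e2 : s + l + l <= t by rewrite -t3 lerDl ltW.
have se1 : s <= s + l by rewrite lerDl ltW.
have se2 : s <= s + l + l by rewrite -addrA lerDl addr_ge0// ltW.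
have z1t := le_trans b1 e1; have z2t := le_trans b2 e2.
have z3t : z3 <= t by rewrite -t3.
have sz2 := le_trans se1 a2; have sz3 := le_trans se2 a3.
have i1 : s <= z1 <= t by rewrite a1 z1t.
have i2 : s <= z2 <= t by rewrite sz2 z2t.
have i3 : s <= z3 <= t by rewrite sz3 z3t.
have f1 := le_trans d2 (mono _ _ z1 t a1 b1 e2 (lexx t)).
have f2 : (A ^+ 2) ^+ 2 * u z3 ^+ 2 * l / 8 <= itg `[z2, t] (fun x => pot A (u x)).
  by apply: (le_trans d3); apply: mono => //; rewrite t3.
have h1 := le_trans d2 (mono _ _ s z3 (lexx s) se1 a3 z3t).
have h2 := le_trans d1 (mono _ _ s z2 (lexx s) (lexx s) a2 z2t).
have p0 a b : s <= a -> b <= t -> 0 <= itg `[a, b] (fun x => pot A (u x)).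
  by move=> sa bt; apply: Rintegral_ge0 => x /(sst _ _ sa bt); exact: pp.
have AA : 0 < A ^+ 2 by rewrite exprn_gt0.
have [/ler_distlB L1 /ler_distrB R1] := split_dens A0 s0 i1 Dt uA.
have [/ler_distlB L2 /ler_distrB R2] := split_dens A0 s0 i2 Dt uA.
have [/ler_distlB L3 /ler_distrB R3] := split_dens A0 s0 i3 Dt uA.
(* Seen from [s] the dips come in the order z1, z2, z3 and the potential to their right is used;
   seen from [t] the roles are mirrored. *)
split.
  exact: (escape_num AA l0 L1 L2 L3 (ple _ i1) (ple _ i2) (ple _ i3) f1 f2
    (p0 _ _ sz3 (lexx t)) (sqr_ge0 _) c1).
exact: (escape_num AA l0 R3 R2 R1 (ple _ i3) (ple _ i2) (ple _ i1) h1 h2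
    (p0 _ _ (lexx s) z1t) (sqr_ge0 _) c3).
Qed.

End escape.
End Pieces.

(** * Paths *)

Lemma card_setb (T : finType) (P : pred T) : #|[set x | P x]| = #|P|.
Proof. by apply: eq_card => x; apply/idP/idP => [/set_mem//|h]; exact/mem_set. Qed.

Section Paths.
Variables (R : realType) (G : metric_graph R).
Implicit Types (w v : V G) (e : BE G) (E : {set BE G}).

(* The only property of a path with edge set [E] that is needed: increments telescope along it. *)
Definition linked w v E := forall psi : V G -> R,
  `|psi w - psi v| <= \sum_(e in E) `|psi (bsrc e) - psi (btgt e)|.

Lemma linked0 w : linked w w finset.set0.
Proof. by move=> psi; rewrite subrr normr0 big_set0. Qed.

Lemma linkedU1 e w w' v E : e \notin E ->
  (bsrc e = w /\ btgt e = w') \/ (bsrc e = w' /\ btgt e = w) ->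
  linked w' v E -> linked w v (e |: E).
Proof.
move=> eE ew l psi; rewrite big_setU1//=.
apply: le_trans (ler_distD (psi w') _ _) _; rewrite lerD//.
by case: ew => [[-> ->]|[-> ->]] //; rewrite distrC.
Qed.

Lemma adj_edge w w' : adj w w' -> exists e,
  (bsrc e = w /\ btgt e = w') \/ (bsrc e = w' /\ btgt e = w).
Proof.
by move=> /existsP[e /orP[/andP[/eqP ? /eqP ?]|/andP[/eqP ? /eqP ?]]]; exists e; [left|right].
Qed.

Lemma path_linked p w : path (@adj R G) w p -> uniq (w :: p) ->
  exists2 E, linked w (last w p) E &
    forall e, e \in E -> bsrc e \in w :: p /\ btgt e \in w :: p.
Proof.
elim: p w => [w _ _|w' p IH w /= /andP[/adj_edge[e ew] pth] /andP[wp up]].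
  by exists finset.set0 => [|e]; [exact: linked0|rewrite finset.in_set0].
have [E lE Ein] := IH w' pth up.
have eE : e \notin E.
  apply/negP => /Ein[s t]; case: ew => [[h _]|[_ h]]; first by rewrite h (negbTE wp) in s.
  by rewrite h (negbTE wp) in t.
exists (e |: E); first exact: linkedU1 lE.
move=> e'; rewrite !finset.inE => /orP[/eqP ->|/Ein[s t]]; last first.
  by move: s t; rewrite !in_cons => -> ->; rewrite !orbT.
by case: ew => [[-> ->]|[-> ->]]; rewrite !eqxx ?orbT.
Qed.

Hypothesis conn : connected_graph G.

(** A simple path never returns to its origin, so after its first edge it uses no edge incident to
    [w]: every other edge end at [w] is left free. *)
Lemma first_step w v : w = v \/ exists e w' E,
  [/\ w != w', (bsrc e = w /\ btgt e = w') \/ (bsrc e = w' /\ btgt e = w),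
   linked w' v E & forall e', e' \in E -> bsrc e' != w /\ btgt e' != w].
Proof.
have /connectP[p pth ->] := conn w v.
case/shortenP: pth => -[|w' q] /= pth up _; first by left.
right; move: pth up => /andP[/adj_edge[e ew] pth] /andP[wp up].
have [E lE Ein] := path_linked pth up.
exists e, w', E; split => //.
- by apply: contra wp => /eqP ->; rewrite mem_head.
- by move=> e' /Ein[s t]; split; [move: s|move: t]; apply: contraTneq => ->.
Qed.

(** A simple path from [bsrc e0] can contain [e0] only as its first edge, and then the rest starts
    from [btgt e0]. Hence from a point inside [e0] one can leave through one end and never use the
    part of [e0] on the other side. *)
Lemma linked_avoid e0 v : exists E, e0 \notin E /\ (linked (bsrc e0) v E \/ linked (btgt e0) v E).
Proof.
have [<-|[e [w' [E [ww' ew lE av]]]]] := first_step (bsrc e0) v.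
  by exists finset.set0; rewrite finset.in_set0; split => //; left; exact: linked0.
have e0E : e0 \notin E by apply/negP => /av[]; rewrite eqxx.
have [ee|ee] := eqVneq e e0.
  exists E; split => //; right; case: ew => [[_ h]|[h _]]; first by rewrite -ee h.
  by move: ww'; rewrite -h ee eqxx.
exists (e |: E); rewrite finset.in_setU1 eq_sym (negbTE ee) (negbTE e0E); split => //; left.
apply: (linkedU1 _ ew lE); apply/negP => /av[].
by case: ew => [[-> _]|[_ ->]]; rewrite eqxx.
Qed.

(** The pairs [(e, b)] are the edge ends counted by [deg]; a loop has two of them at the same
    vertex. *)
Definition dend e (b : bool) := if b then bsrc e else btgt e.

Lemma dend_other w e0 b0 : dend e0 b0 = w -> deg w <> 1%N ->
  (exists e b, (e, b) <> (e0, b0) /\ dend e b = w) \/ (exists h, hsrc h = w).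
Proof.
move=> ew dw; apply: contrapT => /not_orP[/forallNP H1 /forallNP H2]; apply: dw.
have only e b : dend e b = w -> (e, b) = (e0, b0).
  by move=> h; apply: contrapT => ne; apply: (H1 e); exists b.
rewrite /deg !card_setb.
have -> : #|fun h : HL G => hsrc h == w| = 0%N.
  by apply: eq_card0 => h; apply/eqP; exact: H2.
case: b0 ew only {H1} => ew only.
  have -> : #|fun e : BE G => btgt e == w| = 0%N.
    by apply: eq_card0 => e; apply/eqP => /(only e false).
  rewrite (@eq_card _ _ (pred1 e0)) ?card1// => e; apply/eqP/eqP => [h|->//].
  by have [] := only e true h.
have -> : #|fun e : BE G => bsrc e == w| = 0%N.
  by apply: eq_card0 => e; apply/eqP => /(only e true).
rewrite (@eq_card _ _ (pred1 e0)) ?card1// => e; apply/eqP/eqP => [h|->//].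
by have [] := only e false h.
Qed.

Hypothesis oneHL : #|HL G| = 1%N.

Lemma HL_unique (h h' : HL G) : h = h'.
Proof. have /card_le1_eqP : (#|HL G| <= 1)%N by rewrite oneHL.
by apply.
Qed.

Lemma dend_hsrc (h : HL G) : deg (hsrc h) <> 1%N -> exists e b, dend e b = hsrc h.
Proof.
move=> dw; apply: contrapT => /forallNP H1; apply: dw.
have no e b : dend e b <> hsrc h by move=> E; apply: (H1 e); exists b.
rewrite /deg !card_setb.
have -> : #|fun e : BE G => btgt e == hsrc h| = 0%N.
  by apply: eq_card0 => e; apply/eqP; exact: (no e false).
have -> : #|fun e : BE G => bsrc e == hsrc h| = 0%N.
  by apply: eq_card0 => e; apply/eqP; exact: (no e true).
rewrite (@eq_card _ _ (pred1 h)) ?card1// => h'.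
by rewrite -!topredE/= (HL_unique h' h) !eqxx.
Qed.

(** The edge [e] at [w] provides mass that the path does not see. At the root of the halfline the
    path is empty and any edge there will do; elsewhere a degree other than one yields a second edge
    end besides the one through which the path leaves. *)
Lemma linked_offpath w (h : HL G) : (forall v, deg v <> 1%N) ->
  exists E e b, [/\ linked w (hsrc h) E, e \notin E & dend e b = w].
Proof.
move=> noterm.
have [->|[e [w' [E [ww' ew lE av]]]]] := first_step w (hsrc h).
  have [e [b eb]] := dend_hsrc (noterm (hsrc h)).
  by exists finset.set0, e, b; split => //; [exact: linked0|rewrite finset.in_set0].
(* The second alternative of [first_step] does not by itself exclude that [w] is the root of the
   halfline. *)
have [whs|whs] := eqVneq (hsrc h) w.
  have [e' [b eb]] := dend_hsrc (noterm (hsrc h)).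
  exists finset.set0, e', b; rewrite finset.in_set0 -whs; split => //; exact: linked0.
pose b := bsrc e == w.
have eb : dend e b = w.
  by rewrite /b /dend; case: eqP => // ne; case: ew => [[]|[]].
have eE : e \notin E.
  by apply/negP => /av[]; rewrite -eb /dend; case: ifP => _; rewrite eqxx.
have lE' : linked w (hsrc h) (e |: E) by exact: linkedU1 lE.
have [[e' [b' [ne eb']]]|[h' hw]] := dend_other eb (noterm w).
  exists (e |: E), e', b'; split => //.
  rewrite finset.in_setU1 negb_or; apply/andP; split.
    (* If the second end belonged to the same edge, this edge would be a loop, whereas it leads from
       [w] to [w' != w]. *)
    apply/eqP => ee; apply: ne; rewrite ee; congr (_, _); move: eb'; rewrite ee.
    rewrite /b; case: b' => /= [->|tw]; first by rewrite eqxx.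
    by apply/esym/eqP => sw; move: ww'; case: ew => -[h1 h2]; rewrite -h1 -?h2 ?sw ?tw eqxx//=;
       rewrite -h2 tw eqxx.
  by apply/negP => /av[]; rewrite -eb' /dend; case: b' {ne eb'}; rewrite eqxx.
by rewrite (HL_unique h' h) in hw; rewrite hw eqxx in whs.
Qed.

End Paths.

(** * Limits in L^2 *)

Section SquareIntegrable.
Variable R : realType.
Local Notation mu := (@lebesgue_measure R).
Local Notation igr D f := (mu.-integrable D (EFin \o f)).
Local Notation itg D f := (Rintegral mu D f).

Lemma igr_sqB (D : set R) (f g : R -> R) : measurable D -> measurable_fun D f ->
  measurable_fun D g -> igr D (fun x => f x ^+ 2) -> igr D (fun x => g x ^+ 2) ->
  igr D (fun x => (f x - g x) ^+ 2).
Proof.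
move=> mD mf mg fi gi.
apply: (@igr_le _ _ _ (fun x => 2 * f x ^+ 2 + 2 * g x ^+ 2)) => //.
- by apply: measurable_funX; exact: measurable_funB.
- by move=> x _; rewrite ger0_norm ?sqr_ge0//; have := sqr_ge0 (f x + g x); nra.
- by apply: igrD => //; exact: igrZ.
Qed.

Lemma igr_sqD (D : set R) (f g : R -> R) : measurable D -> measurable_fun D f ->
  measurable_fun D g -> igr D (fun x => f x ^+ 2) -> igr D (fun x => g x ^+ 2) ->
  igr D (fun x => (f x + g x) ^+ 2).
Proof.
move=> mD mf mg fi gi.
apply: (@igr_le _ _ _ (fun x => 2 * f x ^+ 2 + 2 * g x ^+ 2)) => //.
- by apply: measurable_funX; exact: measurable_funD.
- by move=> x _; rewrite ger0_norm ?sqr_ge0//; have := sqr_ge0 (f x - g x); nra.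
- by apply: igrD => //; exact: igrZ.
Qed.

Lemma wsq_amgm (p y : R) : 0 < p -> `|y| <= p * y ^+ 2 + p^-1.
Proof.
move=> p0; rewrite -(real_normK (num_real y)); have := normr_ge0 y; set z := `|y| => z0.
rewrite -(ler_pM2r p0) mulrDl mulVf ?gt_eqF//.
have := sqr_ge0 (p * z - 1); have := mulr_ge0 (ltW p0) z0; lra.
Qed.

(* AM-GM makes the increments summable: 2 |d_n| <= 2^n d_n^2 + 2^-n. *)
Lemma cvg_seq_wsq (h : nat -> R) (S : R) :
  (forall n, \sum_(0 <= i < n) (2 ^+ i * (h i.+1 - h i) ^+ 2) <= S) -> cvgn h.
Proof.
move=> HS.
have hE : h = (fun n => h 0%N + series (telescope h) n).
  by apply/funext => n; rewrite -eq_sum_telescope.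
rewrite hE; apply: is_cvgD; first exact: is_cvg_cst.
apply: normed_cvg; apply: nondecreasing_is_cvgn.
  by apply: nondecreasing_series => n _ _; exact: normr_ge0.
exists (S + 2) => _ [n _ <-]; rewrite /series/=.
apply: (@le_trans _ _ (\sum_(0 <= i < n) (2 ^+ i * (h i.+1 - h i) ^+ 2) +
   \sum_(0 <= i < n) (2^-1) ^+ i)).
  rewrite -big_split/=; apply: ler_sum => i _; rewrite /telescope/= exprVn.
  have p0 : 0 < 2 ^+ i :> R by rewrite exprn_gt0.
  exact: wsq_amgm.
rewrite lerD//.
have -> : \sum_(0 <= i < n) 2^-1 ^+ i = series (geometric 1 2^-1) n :> R.
  by rewrite /series/=; apply: eq_bigr => i _; rewrite mul1r.
rewrite (geometric_seriesE 1)/=; last by rewrite lt_eqF// invf_lt1//; lra.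
have -> : 1 - 2^-1 = 2^-1 :> R by field.
rewrite mul1r invrK; have : 0 <= 2^-1 ^+ n :> R by rewrite exprn_ge0// invr_ge0.
lra.
Qed.

Lemma limn_einf_le_cst (v : nat -> \bar R) (c : \bar R) :
  (forall k, (v k <= c)%E) -> (limn_einf v <= c)%E.
Proof.
move=> vc; rewrite limn_einf_lim; apply: lime_le; first exact: is_cvg_einfs.
by near=> k; apply: le_trans (vc k); apply: ereal_inf_lbound; exists k => //=.
Unshelve. all: by end_near. Qed.

(** Completeness of L^2 with the rate retained: a weighted sum of the squared increments is
    integrable, hence finite almost everywhere, which gives pointwise convergence; Fatou's lemma
    carries the rate to the limit. *)
Lemma L2_cauchy_limit (D : set R) (h : nat -> R -> R) (K : R) : measurable D ->
  (forall n, measurable_fun D (h n)) -> (forall n, igr D (fun x => h n x ^+ 2)) ->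
  (forall n m, (n <= m)%N -> itg D (fun x => (h n x - h m x) ^+ 2) <= K / 4 ^+ n) ->
  exists g : R -> R, [/\ measurable_fun D g, igr D (fun x => g x ^+ 2) &
    forall n, itg D (fun x => (h n x - g x) ^+ 2) <= K / 4 ^+ n].
Proof.
move=> mD mh h2 hK.
have K0 : 0 <= K.
  have := hK 0%N 0%N (leqnn _); rewrite expr0 divr1; apply: le_trans.
  by apply: Rintegral_ge0 => x _; exact: sqr_ge0.
have hB n m : igr D (fun x => (h n x - h m x) ^+ 2) by exact: igr_sqB.
(* The weight 2^n against the decay 4^-n leaves the convergent series of 2^-n. *)
pose f n x := (2 ^+ n * (h n.+1 x - h n x) ^+ 2)%:E.
have f0 n x : (0 <= f n x)%E by rewrite lee_fin mulr_ge0 ?sqr_ge0// exprn_ge0.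
have fi n : igr D (fun x => 2 ^+ n * (h n.+1 x - h n x) ^+ 2) by apply: igrZ.
have mf n : measurable_fun D (f n) by apply/measurable_EFinP; exact: igr_meas (fi n).
pose F x := (\sum_(0 <= n <oo) f n x)%E.
have mF : measurable_fun D F.
  have := @ge0_emeasurable_sum _ _ R D f xpredT; apply => // k x Dx _; exact: f0.
have F0 x : (0 <= F x)%E by apply: nneseries_ge0 => n _ _; exact: f0.
have iF : mu.-integrable D F.
  apply/integrableP; split => //.
  have -> : (\int[mu]_(x in D) `|F x| = \int[mu]_(x in D) F x)%E.
    by apply: eq_integral => x _; rewrite gee0_abs.
  rewrite /F integral_nneseries//.
  apply: (@le_lt_trans _ _ (\sum_(0 <= n <oo) (2 * K / (2 ^ (n + 1))%:R)%:E)%E).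
    apply: lee_nneseries => n _; first by move=> _; exact: integral_ge0.
    rewrite (itgE _ (fi n))// lee_fin RintegralZl//.
    have -> : itg D (fun x => (h n.+1 x - h n x) ^+ 2) = itg D (fun x => (h n x - h n.+1 x) ^+ 2).
      by apply: eq_Rintegral => x _; rewrite -sqrrN opprB.
    apply: le_trans (ler_wpM2l _ (hK n n.+1 (leqnSn n))) _; first by rewrite exprn_ge0.
    rewrite addn1 natrX exprS (_ : 4 = 2 * 2)%R; last by ring.
    by rewrite exprMn le_eqVlt; apply/orP; left; apply/eqP; field; rewrite expf_neq0.
  have /cvg_lim -> // := @cvg_geometric_eseries_half R (2 * K) 0.
  exact: ltry.
have mD' : @measurable _ (measurableTypeR R) D by [].
have [N [mN' N0 DN]] := integrable_ae mD' iF.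
have mN : measurable (N : set R) by [].
have cvgh x : D x -> ~ N x -> cvgn (h^~ x).
  move=> Dx Nx; have Ff : F x \is a fin_num.
    by apply: contrapT => nF; apply: Nx; apply: DN => /(_ Dx).
  apply: (@cvg_seq_wsq _ (fine (F x))) => n.
  rewrite -lee_fin fineK// -sumEFin.
  by apply: nneseries_lim_ge => k _ _; exact: f0.
have mCN : measurable (~` N) by exact: measurableC.
(* Setting the functions to 0 on the exceptional set makes the limit exist everywhere on [D], which
   gives measurability. *)
pose hN n x := h n x * (\1_(~` N) x).
have mhN n : measurable_fun D (hN n).
  by apply: measurable_funM => //; exact: measurable_indic.
pose g x := limn (hN^~ x).
have hNE n x : ~ N x -> hN n x = h n x.
  by move=> Nx; rewrite /hN indicE mem_set// mulr1.
have cvgN x : D x -> hN n x @[n --> \oo] --> g x.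
  move=> Dx; have [Nx|Nx] := pselect (N x).
    have E : hN^~ x = (fun=> 0).
      by apply/funext => n; rewrite /hN indicE memNset ?mulr0.
    by rewrite /g E; exact: is_cvg_cst.
  have E : hN^~ x = h^~ x by apply/funext => n; rewrite hNE.
  by rewrite /g E; exact: cvgh.
have mg : measurable_fun D g by exact: measurable_fun_cvg cvgN.
have mB n : measurable_fun D (fun x => (h n x - g x) ^+ 2).
  by apply: measurable_funX; exact: measurable_funB.
have bound n : (\int[mu]_(x in D) ((h n x - g x) ^+ 2)%:E <= (K / 4 ^+ n)%:E)%E.
  rewrite (ge0_negligible_integral mN')//; last first.
  - by move=> x _; rewrite lee_fin sqr_ge0.
  - by apply/measurable_EFinP; exact: (mB n).
  have mDN : measurable (D `\` N) by exact: measurableD.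
  pose w k x := ((h n x - h (k + n)%N x) ^+ 2)%:E.
  have -> : (\int[mu]_(x in D `\` N) ((h n x - g x) ^+ 2)%:E =
      \int[mu]_(x in D `\` N) limn_einf (w^~ x))%E.
    apply: eq_integral => x; rewrite inE => -[Dx Nx].
    rewrite (@cvg_limn_einf_sup _ _ ((h n x - g x) ^+ 2)%:E)//.
    apply/fine_cvgP; split; first by near=> k.
    have c : h k x @[k --> \oo] --> g x.
      rewrite (_ : (fun k => h k x) = (fun k => hN k x)); first exact: cvgN.
      by apply/funext => k; rewrite hNE.
    have c' : h (k + n)%N x @[k --> \oo] --> g x by have := c; rewrite -(cvg_shiftn n).
    have c2 : (h n x - h (k + n)%N x) @[k --> \oo] --> h n x - g x.
      by apply: cvgB => //; exact: cvg_cst.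
    rewrite (_ : fine \o w^~ x =
      (fun k => (h n x - h (k + n)%N x) * (h n x - h (k + n)%N x))); last first.
      by apply/funext => k; rewrite /= expr2.
    by rewrite expr2; exact: cvgM.
  apply: le_trans (fatou _ _ _ _) _ => //.
  - by move=> k; apply/measurable_EFinP; apply: measurable_funS (igr_meas (hB n (k + n)%N)) => //; exact: subDsetl.
  - by move=> k x _; rewrite lee_fin sqr_ge0.
  apply: limn_einf_le_cst => k.
  apply: (@le_trans _ _ (\int[mu]_(x in D) w k x)%E).
    apply: (@ge0_subset_integral _ _ _ mu (D `\` N) D mDN mD) => [|x _|].
    + by apply/measurable_EFinP; exact: igr_meas (hB n (k + n)%N).
    + by rewrite lee_fin sqr_ge0.
    + exact: subDsetl.
  by rewrite (itgE _ (hB _ _))// lee_fin hK// leq_addl.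
have ib n : igr D (fun x => (h n x - g x) ^+ 2).
  apply: igr_ge0 => //; first by move=> x _; exact: sqr_ge0.
  by apply: le_lt_trans (bound n) _; exact: ltry.
exists g; split => //; last first.
  by move=> n; rewrite -lee_fin -itgE.
apply: (@igr_le _ _ _ (fun x => 2 * (h 0%N x - g x) ^+ 2 + 2 * h 0%N x ^+ 2)) => //.
- exact: measurable_funX.
- move=> x _; rewrite ger0_norm ?sqr_ge0//.
  by have := sqr_ge0 (2 * h 0%N x - g x); nra.
- by apply: igrD => //; exact: igrZ.
Unshelve. all: by end_near. Qed.

(* Near-minimisers of the norm over a decreasing sequence of midpoint-convex sets form a
   Cauchy sequence by the parallelogram identity; this replaces weak compactness. *)
Lemma L2_convex_limit (D : set R) (S : nat -> set (R -> R)) (C : R) : measurable D ->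
  (forall n h, S n h -> [/\ measurable_fun D h, igr D (fun x => h x ^+ 2) &
     itg D (fun x => h x ^+ 2) <= C]) ->
  (forall n m, (n <= m)%N -> S m `<=` S n) ->
  (forall n h k, S n h -> S n k -> S n (fun x => (h x + k x) / 2)) ->
  (forall n, S n !=set0) ->
  exists (g : R -> R) (h : nat -> R -> R), [/\ forall n, S n (h n), measurable_fun D g,
    igr D (fun x => g x ^+ 2) & forall n, itg D (fun x => (h n x - g x) ^+ 2) <= 8 / 4 ^+ n].
Proof.
move=> mD SP Snd Sconv Sne.
pose N h := itg D (fun x : R => h x ^+ 2).
pose I n := [set N h | h in S n].
have Ilb n : lbound (I n) 0.
  by move=> _ [h _ <-]; apply: Rintegral_ge0 => x _; exact: sqr_ge0.
have Iinf n : has_inf (I n).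
  by split; [have [h Sh] := Sne n; exists (N h), h|exists 0; exact: Ilb].
pose c n := inf (I n).
have cle n h : S n h -> c n <= N h.
  by move=> Sh; apply: ge_inf; [exists 0; exact: Ilb|exists h].
have cC n : c n <= C.
  by have [h Sh] := Sne n; apply: le_trans (cle _ _ Sh) _; have [] := SP _ _ Sh.
have cub : has_sup (range c).
  by split; [exists (c 0%N), 0%N|exists C => _ [n _ <-]; exact: cC].
pose cs := sup (range c).
have cs_ge n : c n <= cs.
  by apply: ub_le_sup; [case: cub|exists n].
have cnd n m : (n <= m)%N -> c n <= c m.
  move=> nm; apply: lb_le_inf; first by case: (Iinf m).
  by move=> _ [h Sh <-]; apply: cle; exact: Snd nm _ Sh.
have p4 j : 0 < (4 ^+ j)^-1 :> R by rewrite invr_gt0 exprn_gt0.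
(* The infimal norms [c n] increase to [cs]. The index is taken large enough both for [c] to be
   close to [cs] and to exceed [j]. *)
have ex j : exists hM : (R -> R) * nat, [/\ (j <= hM.2)%N, S hM.2 hM.1,
    cs - (4 ^+ j)^-1 <= c hM.2 & N hM.1 <= cs + (4 ^+ j)^-1].
  have [_ [M _ <-] cM] := sup_adherent (p4 j) cub.
  have Mm : cs - (4 ^+ j)^-1 <= c (maxn M j).
    by apply: le_trans (ltW cM) _; apply: cnd; exact: leq_maxl.
  have [_ [h Sh <-] hc] := inf_adherent (p4 j) (Iinf (maxn M j)).
  exists (h, maxn M j); split => //=; first exact: leq_maxr.
  by apply: le_trans (ltW hc) _; rewrite lerD2r; exact: cs_ge.
have [hM hMP] := choice ex.
pose h j := (hM j).1.
have Sh j : S j (h j) by have [jM ShM _ _] := hMP j; exact: Snd jM _ ShM.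
have mh j : measurable_fun D (h j) by have [] := SP _ _ (Sh j).
have ih j : igr D (fun x => h j x ^+ 2) by have [] := SP _ _ (Sh j).
(* The midpoint of two near-minimisers lies in the larger of their two sets, so its norm is at least
   about [cs]. The parallelogram identity then gives 8 = 2 + 2 + 4 times 4^-n. *)
have hK n m : (n <= m)%N -> itg D (fun x => (h n x - h m x) ^+ 2) <= 8 / 4 ^+ n.
  move=> nm.
  have [_ Sn cn Nn] := hMP n; have [_ Sm cm Nm] := hMP m.
  have p4nm : (4 ^+ m)^-1 <= (4 ^+ n)^-1 :> R.
    by rewrite lef_pV2 ?posrE ?exprn_gt0// ler_weXn2l//; lra.
  pose p := minn (hM n).2 (hM m).2.
  have cp : cs - (4 ^+ n)^-1 <= c p.
    rewrite /p /minn; case: ifP => _ //; apply: le_trans cm.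
    by rewrite lerD2l lerN2.
  have Sp1 : S p (h n) by apply: Snd Sn; exact: geq_minl.
  have Sp2 : S p (h m) by apply: Snd Sm; exact: geq_minr.
  have Nmid := le_trans cp (cle _ _ (Sconv _ _ _ Sp1 Sp2)).
  have E : itg D (fun x => (h n x - h m x) ^+ 2) =
    2 * N (h n) + 2 * N (h m) - 4 * N (fun x => (h n x + h m x) / 2).
    have imid : igr D (fun x => ((h n x + h m x) / 2) ^+ 2).
      by have [] := SP _ _ (Sconv _ _ _ Sp1 Sp2).
    have i1 : igr D (fun x => 2 * h n x ^+ 2) by exact: igrZ.
    have i2 : igr D (fun x => 2 * h m x ^+ 2) by exact: igrZ.
    have i3 : igr D (fun x => 4 * ((h n x + h m x) / 2) ^+ 2) by exact: igrZ.
    rewrite /N -!RintegralZl// -RintegralD// -RintegralB//; last exact: igrD.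
    by apply: eq_Rintegral => x _; field.
  rewrite E -/(h n) -/(h m) in Nn Nm *; rewrite mulrC; lra.
have [g [mg ig gK]] := L2_cauchy_limit mD mh ih hK.
by exists g, h.
Qed.

Lemma le_of_geometric (X Y c : R) : 0 <= c -> (forall n, X <= Y + c / 2 ^+ n) -> X <= Y.
Proof.
move=> c0 H; apply/ler_addgt0Pr => e e0.
have [n Hn] : exists n, c / 2 ^+ n <= e.
  exists (Num.truncn (c / e)).+1; rewrite ler_pdivrMr ?exprn_gt0// mulrC -ler_pdivrMr//.
  apply: le_trans (ltW (truncnS_gt _)) _.
  by rewrite -natrX ler_nat ltnW// ltn_expl.
by apply: le_trans (H n) _; rewrite lerD2l.
Qed.

(** Young's inequality with weight d = 2^-k gives g^2 <= (1 + d) h^2 + (1 + 1 / d) (h - g)^2; the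
    error K d^2 of the second integral outweighs the factor 1 / d. *)
Lemma itg_sq_limit_le (D B : set R) (g : R -> R) (h : nat -> R -> R) (K c : R) :
  measurable D -> measurable B -> B `<=` D -> 0 <= K -> 0 <= c ->
  measurable_fun D g -> igr D (fun x => g x ^+ 2) ->
  (forall n, measurable_fun D (h n)) -> (forall n, igr D (fun x => h n x ^+ 2)) ->
  (forall n, itg D (fun x => (h n x - g x) ^+ 2) <= K / 4 ^+ n) ->
  (forall e : R, 0 < e -> exists n, forall m, (n <= m)%N ->
      itg B (fun x => h m x ^+ 2) <= c + e) ->
  itg B (fun x => g x ^+ 2) <= c.
Proof.
move=> mD mB BD K0 c0 mg g2 mh h2 hg hc.
have hD n : igr D (fun x => (h n x - g x) ^+ 2) by exact: igr_sqB.
have iB f : igr D f -> igr B f by move=> fi; apply: integrableS fi.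
apply: (@le_of_geometric _ _ (c + 2 + 4 * K)) => [|k]; first lra.
have p0 : 0 < 2 ^+ k :> R by rewrite exprn_gt0.
have p1 : 1 <= 2 ^+ k :> R by rewrite exprn_ege1//; lra.
have [n Hn] := hc (2 ^+ k)^-1 ltac:(by rewrite invr_gt0).
pose m := maxn n k.
have Hm := Hn m (leq_maxl _ _).
set d := (2 ^+ k)^-1 in Hm *.
have d0 : 0 < d by rewrite invr_gt0.
have d1 : d <= 1 by rewrite invf_le1.
have : itg B (fun x => g x ^+ 2) <=
   itg B (fun x => (1 + d) * h m x ^+ 2 + (1 + d^-1) * (h m x - g x) ^+ 2).
  apply: le_Rintegral => //; first exact: iB.
    by apply: igrD => //; apply: igrZ => //; exact: iB.
  move=> x _; rewrite -subr_ge0.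
  have -> : (1 + d) * h m x ^+ 2 + (1 + d^-1) * (h m x - g x) ^+ 2 - g x ^+ 2 =
    d^-1 * ((1 + d) * h m x - g x) ^+ 2 by field; rewrite gt_eqF.
  by rewrite mulr_ge0 ?sqr_ge0// invr_ge0 ltW.
rewrite RintegralD//; [|apply: igrZ => //; exact: iB..].
rewrite !RintegralZl//; [|exact: iB..].
have : itg B (fun x => (h m x - g x) ^+ 2) <= K * d * d.
  apply: (@le_trans _ _ (itg D (fun x => (h m x - g x) ^+ 2))).
    by apply: itg_sub => // x _; exact: sqr_ge0.
  apply: le_trans (hg m) _; rewrite -mulrA ler_wpM2l// /d -invfM -exprMn.
  have -> : 2 * 2 = 4 :> R by ring.
  by rewrite lef_pV2 ?posrE ?exprn_gt0// ler_weXn2l ?leq_maxr//; lra.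
have b0 : 0 <= itg B (fun x => h m x ^+ 2) by apply: Rintegral_ge0 => x _; exact: sqr_ge0.
have e0 : 0 <= itg B (fun x => (h m x - g x) ^+ 2) by apply: Rintegral_ge0 => x _; exact: sqr_ge0.
move: Hm b0 e0; set X := itg B _; set Y := itg B _; set Z := itg B _ => Hm b0 e0 hY hZ.
have dd : d * d^-1 = 1 by rewrite divff ?gt_eqF.
have hY2 : (1 + d^-1) * Y <= (1 + d^-1) * (K * d * d).
  by rewrite ler_wpM2l// addr_ge0// invr_ge0 ltW.
have eY : (1 + d^-1) * (K * d * d) = K * d * d + K * d by field; rewrite gt_eqF.
have k1 : K * d * d <= K * d by rewrite ler_piMr// mulr_ge0// ltW.
have x1 : (1 + d) * X <= (1 + d) * (c + d) by rewrite ler_wpM2l//; lra.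
have x2 : (1 + d) * (c + d) <= c + (c + 2) * d by nra.
have k0 : 0 <= K * d by rewrite mulr_ge0// ltW.
lra.
Qed.

End SquareIntegrable.

(** * Solitons *)

Section Soliton.
Variable R : realType.
Local Notation mu := (@lebesgue_measure R).
Local Notation igr D f := (mu.-integrable D (EFin \o f)).

Definition sech (y : R) := 2 / (expR y + expR (- y)).
Definition tanh (y : R) := (expR y - expR (- y)) / (expR y + expR (- y)).

Lemma cosh2_gt0 (y : R) : 0 < expR y + expR (- y).
Proof. by rewrite addr_gt0 ?expR_gt0. Qed.

Lemma sech_gt0 (y : R) : 0 < sech y.
Proof. by rewrite divr_gt0// cosh2_gt0. Qed.

Lemma sech_le (y : R) : sech y <= 2 * expR (- y).
Proof.
rewrite ler_pdivrMr ?cosh2_gt0// -mulrA ler_peMr// mulrDr -expRD addNr expR0.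
by rewrite lerDl -expRD expR_ge0.
Qed.

Lemma sech_tanh2 (y : R) : tanh y ^+ 2 = 1 - sech y ^+ 2.
Proof.
rewrite /tanh /sech !expRN; have e0 := expR_gt0 y; field.
by rewrite gt_eqF//= gt_eqF// addr_gt0// ?mulr_gt0.
Qed.

Lemma tanh_le1 (y : R) : `|tanh y| <= 1.
Proof.
rewrite -(ler_pXn2r (n := 2)) ?nnegrE// expr1n real_normK ?num_real// sech_tanh2.
by rewrite lerBlDr lerDl sqr_ge0.
Qed.

Lemma sechN (y : R) : sech (- y) = sech y.
Proof. by rewrite /sech opprK addrC. Qed.

Lemma tanhN (y : R) : tanh (- y) = - tanh y.
Proof. by rewrite /tanh opprK [expR (- y) + expR y]addrC -mulNr opprB. Qed.

Lemma is_derive_expRN (y : R) : is_derive y 1 (fun z : R => expR (- z)) (- expR (- y)).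
Proof.
by apply: is_derive_eq; rewrite mulrN1.
Qed.

Lemma is_derive_sech (y : R) : is_derive y 1 sech (- (sech y * tanh y)).
Proof.
have c0 := cosh2_gt0 y; have d1 := is_derive_expRN y.
have dc : is_derive y 1 (fun z : R => expR z + expR (- z)) (expR y - expR (- y)).
  by apply: is_derive_eq.
have dv := @is_deriveV R _ y _ 1 (lt0r_neq0 c0) dc.
rewrite /sech; apply: is_derive_eq; rewrite /GRing.scale/= /tanh.
by field; rewrite gt_eqF.
Qed.

Lemma is_derive_tanh (y : R) : is_derive y 1 tanh (sech y ^+ 2).
Proof.
have c0 := cosh2_gt0 y; have d1 := is_derive_expRN y.
have dc : is_derive y 1 (fun z : R => expR z + expR (- z)) (expR y - expR (- y)).
  by apply: is_derive_eq.
have dv := @is_deriveV R _ y _ 1 (lt0r_neq0 c0) dc.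
rewrite /tanh; apply: is_derive_eq; rewrite /GRing.scale/= opprK.
have -> : sech y ^+ 2 = 1 - tanh y ^+ 2 by rewrite sech_tanh2; ring.
rewrite /tanh; field; rewrite gt_eqF//.
Qed.

(* Primitives of sech and sech^3. *)
Definition gd (y : R) := 2 * atan (expR y).
Definition gd3 (y : R) := 2^-1 * (sech y * tanh y + gd y).

Lemma is_derive_gd (y : R) : is_derive y 1 gd (sech y).
Proof.
have d1 : is_derive y 1 (fun z : R => atan (expR z)) ((1 + expR y ^+ 2)^-1 * expR y).
  exact: is_derive1_comp.
rewrite /gd; apply: is_derive_eq; rewrite /GRing.scale/= /sech expRN.
have e0 := expR_gt0 y; field.
by rewrite gt_eqF//= gt_eqF// addr_gt0// ?mulr_gt0.
Qed.

Lemma is_derive_gd3 (y : R) : is_derive y 1 gd3 (sech y ^+ 3).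
Proof.
have d1 := is_derive_sech y; have d2 := is_derive_tanh y; have d3 := is_derive_gd y.
rewrite /gd3; apply: is_derive_eq; rewrite /GRing.scale/=.
have t2 := sech_tanh2 y.
have -> : 2^-1 * (sech y * sech y ^+ 2 + tanh y * - (sech y * tanh y) + sech y) =
  2^-1 * (sech y * sech y ^+ 2 - sech y * tanh y ^+ 2 + sech y) by ring.
by rewrite t2; field.
Qed.

Lemma is_derive_continuous (f : R -> R) (x d : R) : is_derive x 1 f d -> {for x, continuous f}.
Proof.
by move=> [df _]; apply: differentiable_continuous; exact/derivable1_diffP.
Qed.

Lemma cvg_gd : gd y @[y --> +oo] --> pi.
Proof.
rewrite /gd (_ : pi = 2 * (pi / 2)); last by field.
apply: cvgM; first exact: cvg_cst.
apply: (cvg_comp _ _ _ (@cvgy_atan R)).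
apply/cvgryPge => M; near=> x; apply: (@le_trans _ _ (1 + x)); last exact: expR_ge1Dx.
rewrite -lerBlDl; near: x; exact: nbhs_pinfty_ge (num_real _).
Unshelve. all: by end_near.
Qed.

Lemma cvg_sech : sech y @[y --> +oo] --> 0.
Proof.
apply: (@squeeze_cvgr _ _ _ _ (fun=> 0) (fun y => 2 * expR (- y))).
- by near=> y; rewrite ltW ?sech_gt0// sech_le.
- exact: cvg_cst.
- rewrite -(mulr0 2); apply: cvgM; first exact: cvg_cst.
  exact: cvgr_expR.
Unshelve. all: by end_near. Qed.

Lemma cvg_gd3 : gd3 y @[y --> +oo] --> pi / 2.
Proof.
rewrite /gd3 (_ : pi / 2 = 2^-1 * (0 + pi)); last by rewrite add0r mulrC.
apply: cvgM; first exact: cvg_cst.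
apply: cvgD; last exact: cvg_gd.
apply: (@squeeze_cvgr _ _ _ _ (fun y => - sech y) sech).
- near=> y; have := tanh_le1 y; have := sech_gt0 y; rewrite ler_norml => s0 /andP[a b].
  by apply/andP; split; nra.
- by rewrite -oppr0; apply: cvgN; exact: cvg_sech.
- exact: cvg_sech.
Unshelve. all: by end_near. Qed.

Section profile.
Variables (A k T : R).
Hypothesis k0 : 0 < k.

Let aff (x : R) := k * x - T.

Let is_derive_aff (x : R) : is_derive x 1 aff k.
Proof. by rewrite /aff; apply: is_derive_eq; rewrite /GRing.scale/= mulr1 subr0. Qed.

Let comp_aff (f : R -> R) (x d : R) : is_derive (aff x) 1 f d ->
  is_derive x 1 (fun z => f (aff z)) (d * k).
Proof. by move=> df; have := @is_derive1_comp _ f aff x d k df (is_derive_aff x). Qed.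

Let cvg_aff : aff x @[x --> +oo] --> +oo.
Proof.
apply/cvgryPge => M; near=> x; rewrite /aff lerBrDr mulrC -ler_pdivrMr//.
Unshelve. all: by end_near. Qed.

Definition sol (x : R) := A * Num.sqrt (sech (k * x - T)).
Definition dsol (x : R) := - (k / 2) * tanh (k * x - T) * sol x.

Lemma sol2 (x : R) : sol x ^+ 2 = A ^+ 2 * sech (k * x - T).
Proof. by rewrite /sol exprMn sqr_sqrtr// ltW// sech_gt0. Qed.

Lemma is_derive_sol (x : R) : is_derive x 1 sol (dsol x).
Proof.
have s0 := sech_gt0 (aff x).
have d1 : is_derive (aff x) 1 (fun z : R => Num.sqrt (sech z))
   ((2 * Num.sqrt (sech (aff x)))^-1 * - (sech (aff x) * tanh (aff x))).
  apply: (@is_derive1_comp _ Num.sqrt sech); last exact: is_derive_sech.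
  exact: is_derive1_sqrt.
have d2 := comp_aff d1.
rewrite /sol -/(aff x); apply: is_derive_eq; rewrite /GRing.scale/= /dsol /sol -/(aff x).
have q0 : 0 < Num.sqrt (sech (aff x)) by rewrite sqrtr_gt0.
have q2 : Num.sqrt (sech (aff x)) ^+ 2 = sech (aff x) by rewrite sqr_sqrtr// ltW.
rewrite -{2}q2; field; rewrite gt_eqF//.
Qed.

Let cont_sol : continuous sol.
Proof. by move=> x; exact: is_derive_continuous (is_derive_sol x). Qed.

Let cont_tanh : continuous (fun x => tanh (k * x - T)).
Proof. by move=> x; exact: is_derive_continuous (comp_aff (is_derive_tanh (aff x))). Qed.

Let cont_dsol : continuous dsol.
Proof.
by move=> x; apply: cvgM; [apply: cvgM; [exact: cvg_cst|exact: cont_tanh]|exact: cont_sol].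
Qed.

Let cont_sech : continuous (fun x => sech (k * x - T)).
Proof. by move=> x; exact: is_derive_continuous (comp_aff (is_derive_sech (aff x))). Qed.

Let FTCy (f F : R -> R) (l : R) : (forall y, 0 <= f y) ->
  (forall y : R, is_derive y 1 F (f y)) -> continuous (fun x => f (aff x)) ->
  F y @[y --> +oo] --> l ->
  (\int[mu]_(x in `[0%R, +oo[) (f (k * x - T))%:E = (k^-1 * (l - F (- T)))%:E)%E.
Proof.
move=> f0 dF cf Fl.
pose G x := k^-1 * F (aff x).
have dG (x : R) : is_derive x 1 G (f (aff x)).
  have := comp_aff (dF (aff x)) => d; rewrite /G; apply: is_derive_eq.
  by rewrite /GRing.scale/=; field; rewrite gt_eqF.
rewrite (@ge0_continuous_FTC2y R (fun x => f (aff x)) G 0 (k^-1 * l)).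
- by rewrite -EFinB /G /aff mulr0 sub0r -mulrBr.
- by move=> x _; exact: f0.
- exact: continuous_subspaceT.
- by apply: cvgM; [exact: cvg_cst|exact: cvg_comp cvg_aff Fl].
- by move=> x _; have [] := dG x.
- apply: cvg_at_right_filter; exact: is_derive_continuous (dG 0).
- by move=> x _; rewrite derive1E; have [_ ->] := dG x.
Qed.

Lemma int_sech : (\int[mu]_(x in `[0%R, +oo[) (sech (k * x - T))%:E =
  (k^-1 * (pi - gd (- T)))%:E)%E.
Proof.
apply: FTCy; [by move=> y; rewrite ltW ?sech_gt0|exact: is_derive_gd|exact: cont_sech|exact: cvg_gd].
Qed.

Lemma int_sech3 : (\int[mu]_(x in `[0%R, +oo[) (sech (k * x - T) ^+ 3)%:E =
  (k^-1 * (pi / 2 - gd3 (- T)))%:E)%E.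
Proof.
apply: (@FTCy (fun y => sech y ^+ 3)); [by move=> y; rewrite exprn_ge0// ltW ?sech_gt0|
  exact: is_derive_gd3| |exact: cvg_gd3].
move=> x; apply: (@continuous_comp _ _ _ (fun x => sech (aff x)) (fun y => y ^+ 3)).
  exact: cont_sech.
exact: exprn_continuous.
Qed.

Let igr_sech : igr `[0, +oo[ (fun x => sech (k * x - T)).
Proof.
apply: igr_ge0 => //.
- by apply: measurable_funS (continuous_measurable_fun cont_sech).
- by move=> x _; rewrite ltW ?sech_gt0.
- by rewrite int_sech ltry.
Qed.

Let igr_sech3 : igr `[0, +oo[ (fun x => sech (k * x - T) ^+ 3).
Proof.
apply: igr_ge0 => //.
- apply: measurable_funX; exact: igr_meas igr_sech.
- by move=> x _; rewrite exprn_ge0// ltW ?sech_gt0.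
- by rewrite int_sech3 ltry.
Qed.

Lemma int_sol2 : (\int[mu]_(x in `[0%R, +oo[) (sol x ^+ 2)%:E =
  (A ^+ 2 * (k^-1 * (pi - gd (- T))))%:E)%E.
Proof.
have E : (fun x => sol x ^+ 2) = (fun x => A ^+ 2 * sech (k * x - T)).
  by apply/funext => x; rewrite sol2.
have i2 : igr `[0, +oo[ (fun x => sol x ^+ 2) by rewrite E; exact: igrZ.
rewrite itgE// E RintegralZl//; congr (_ * _)%:E.
by have := int_sech; rewrite (itgE _ igr_sech)// => -[].
Qed.

Lemma int_sol6 : (\int[mu]_(x in `[0%R, +oo[) (`|sol x| ^+ 6)%:E =
  (A ^+ 6 * (k^-1 * (pi / 2 - gd3 (- T))))%:E)%E.
Proof.
have E : (fun x => `|sol x| ^+ 6) = (fun x => A ^+ 6 * sech (k * x - T) ^+ 3).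
  apply/funext => x; rewrite (exprM _ 2 3) real_normK ?num_real// sol2 exprMn -exprM.
  by [].
have i2 : igr `[0, +oo[ (fun x => `|sol x| ^+ 6) by rewrite E; exact: igrZ.
rewrite itgE// E RintegralZl//; congr (_ * _)%:E.
by have := int_sech3; rewrite (itgE _ igr_sech3)// => -[].
Qed.

Lemma int_dsol2 : (\int[mu]_(x in `[0%R, +oo[) (dsol x ^+ 2)%:E =
  (k * A ^+ 2 / 4 * ((pi - gd (- T)) - (pi / 2 - gd3 (- T))))%:E)%E.
Proof.
have E : (fun x => dsol x ^+ 2) =
    (fun x => k ^+ 2 * A ^+ 2 / 4 * (sech (k * x - T) - sech (k * x - T) ^+ 3)).
  apply/funext => x; rewrite /dsol exprMn sol2 exprMn sech_tanh2; by field.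
have i3 : igr `[0, +oo[ (fun x => sech (k * x - T) - sech (k * x - T) ^+ 3) by exact: igrB.
have i2 : igr `[0, +oo[ (fun x => dsol x ^+ 2) by rewrite E; exact: igrZ.
rewrite itgE// E RintegralZl// RintegralB//.
have := int_sech; rewrite (itgE _ igr_sech)// => -[->].
have := int_sech3; rewrite (itgE _ igr_sech3)// => -[->].
by congr (_%:E); field; rewrite gt_eqF.
Qed.

Lemma sol_H1 : H1_hl sol dsol.
Proof.
split.
- by apply: measurable_funS (continuous_measurable_fun cont_dsol).
- by rewrite int_dsol2 ltry.
- by rewrite int_sol2 ltry.
move=> x; rewrite le_eqVlt => /predU1P[<-|x0]; first by rewrite itg_pt addr0.
rewrite /Rintegral (@continuous_FTC2 _ dsol sol 0 x x0).
- by rewrite -EFinB/= addrC subrK.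
- exact: continuous_subspaceT.
- split.
  + by move=> y _; have [] := is_derive_sol y.
  + by apply: cvg_at_right_filter; exact: cont_sol.
  + by apply: cvg_at_left_filter; exact: cont_sol.
- by move=> y _; rewrite derive1E; have [_ ->] := is_derive_sol y.
Qed.

End profile.
End Soliton.

(** * Functions on the graph *)

Section GraphFunctions.
Variables (R : realType) (G : metric_graph R).
Local Notation mu := (@lebesgue_measure R).
Local Notation igr D f := (mu.-integrable D (EFin \o f)).
Local Notation itg D f := (Rintegral mu D f).
Local Notation J := (BE G + HL G)%type.
Implicit Types (f : gfun G) (j : J).

(** A single index type for both kinds of edges lets sums and maxima run over the whole graph. *)
Definition dom j : set R :=
  match j with inl e => `[0, blen e]%classic | inr h => `[0, +oo[%classic end.
Definition uu f j := match j with inl e => ub f e | inr h => uh f h end.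
Definition gg f j := match j with inl e => gb f e | inr h => gh f h end.

Lemma segdom_dom j : segdom (dom j).
Proof. by case: j => [e|h]; [apply: segdom_bnd; exact: ltW (blen_gt0 e)|exact: segdom_y]. Qed.

Lemma mdom j : measurable (dom j). Proof. by have [] := segdom_dom j. Qed.

Lemma within_eq_continuous (D : set R) (u v : R -> R) : (forall x, D x -> u x = v x) ->
  {within D, continuous v} -> {within D, continuous u}.
Proof.
move=> uv /subspace_continuousP cv; apply/subspace_continuousP => x Dx.
apply/cvgrPdist_le => e e0; have /cvgrPdist_le/(_ e e0) := cv x Dx.
rewrite !near_withinE; apply: filterS => y h Dy.
by change (`|u x - u y| <= e); rewrite !uv//; exact: h.
Qed.

(** Square integrability of [u], implicit in [H1_seg], follows from the continuity of the indefinite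
    integral on a compact interval. *)
Lemma H1_seg_on (l : R) (u g : R -> R) : 0 < l -> H1_seg l u g -> H1on `[0, l] u g.
Proof.
move=> l0 [mg g2 H].
have g2i : igr `[0, l] (fun x => g x ^+ 2).
  by apply: igr_ge0 => //; [exact: measurable_funX|move=> x _; exact: sqr_ge0].
have gi : igr `[0, l] g by exact: igr_sq.
have u' x : `[0, l]%classic x -> u x = u 0 + itg `[0, x] g.
  by rewrite /= in_itv/=; exact: H.
have cu : {within `[0, l], continuous u}.
  apply: (within_eq_continuous u').
  apply/subspace_continuousP => x xl; apply: cvgD; first exact: cvg_cst.
  have := @parameterized_integral_continuous R 0 l g (ltW l0) gi.
  by move/subspace_continuousP; apply.
split => //.
have -> : (fun x => u x ^+ 2) = (fun x => u x * u x).
  by apply/funext => x; rewrite expr2.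
have c2 : {within `[0, l], continuous (fun x => u x * u x)}.
  move/subspace_continuousP : cu => cu.
  by apply/subspace_continuousP => x xl; apply: cvgM; exact: cu.
by apply: continuous_compact_integrable => //; exact: segment_compact.
Qed.

Lemma H1_hl_on (u g : R -> R) : H1_hl u g -> H1on `[0, +oo[ u g.
Proof.
move=> [mg g2 u2 H].
have g2i : igr `[0, +oo[ (fun x => g x ^+ 2).
  by apply: igr_ge0 => //; [exact: measurable_funX|move=> x _; exact: sqr_ge0].
have u' x : `[0, +oo[%classic x -> u x = u 0 + itg `[0, x] g.
  by rewrite /= in_itv/= andbT; exact: H.
split => //.
have gi x : igr `[0, x] g.
  apply: igr_sq.
    by apply: measurable_funS mg => // y; rewrite /= !in_itv/= andbT => /andP[].
  by apply: integrableS g2i => // y; rewrite /= !in_itv/= andbT => /andP[].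
apply: igr_ge0 => //; last by move=> x _; exact: sqr_ge0.
apply: measurable_funX; rewrite itv_bndy_bigcup_BRight; apply/measurable_fun_bigcup => // n.
have n0 : 0 <= n%:R :> R by [].
apply: subspace_continuous_measurable_fun => //.
rewrite add0r; apply: (@within_eq_continuous _ _ (fun x => u 0 + itg `[0, x] g)).
  by move=> x xl; apply: u'; move: xl; rewrite /= !in_itv/= => /andP[-> _].
apply/subspace_continuousP => x xl; apply: cvgD; first exact: cvg_cst.
have := @parameterized_integral_continuous R 0 n%:R g n0 (gi _).
by move/subspace_continuousP; apply.
Qed.

Lemma H1_on f j : H1 f -> H1on (dom j) (uu f j) (gg f j).
Proof.
move=> [_ [Hb Hh]]; case: j => [e|h] /=; last exact: H1_hl_on.
by apply: H1_seg_on => //; exact: blen_gt0.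
Qed.

Lemma piece_max f j : H1 f -> exists2 y, dom j y &
  forall x, dom j x -> `|uu f j x| <= `|uu f j y|.
Proof.
move=> Hf; have Hj := H1_on j Hf; case: j Hj => [e|h] /= Hj.
  have l0 := ltW (blen_gt0 e).
  have /subspace_continuousP cu := H1on_continuous (segdom_dom (inl e)) Hj.
  have cn : {within `[0, blen e], continuous (fun x => `|ub f e x|)}.
    by apply/subspace_continuousP => x xe; apply: cvg_norm; exact: cu.
  by have [y yi ymax] := EVT_max l0 cn; exists y.
have [y y0 ymax] := H1on_max_y Hj (lexx 0).
exists y; first by rewrite in_itv/= y0.
by move=> x; rewrite in_itv/= andbT; exact: ymax.
Qed.

Lemma gfun_max f (j0 : J) : H1 f -> exists j y, dom j y /\
  forall j' x, dom j' x -> `|uu f j' x| <= `|uu f j y|.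
Proof.
move=> Hf.
have [y yP] := choice (fun j => let: ex_intro2 y a b := piece_max j Hf in
   ex_intro (fun y => dom j y /\ forall x, dom j x -> `|uu f j x| <= `|uu f j y|) y (conj a b)).
pose F j := `|uu f j (y j)|.
have [j _ jmax] := @Order.TotalTheory.arg_maxP _ _ J j0 xpredT F isT.
exists j, (y j); split; first by case: (yP j).
by move=> j' x Dx; apply: le_trans ((yP j').2 x Dx) _; exact: jmax.
Qed.

Definition Mass f := \sum_j itg (dom j) (fun x => uu f j x ^+ 2).
Definition Dn f := \sum_j itg (dom j) (fun x => gg f j x ^+ 2).
Definition P6 f := \sum_j itg (dom j) (fun x => uu f j x ^+ 6).
Definition Ene f := \sum_j itg (dom j) (en (uu f j) (gg f j)).

Lemma sumJ (F : J -> R) : \sum_j F j = \sum_e F (inl e) + \sum_h F (inr h).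
Proof. by rewrite big_sumType. Qed.

Lemma gintE (F : R -> R) (u : BE G -> R -> R) (w : HL G -> R -> R) :
  (forall e, igr `[0, blen e] (fun x => F (u e x))) ->
  (forall h, igr `[0, +oo[ (fun x => F (w h x))) ->
  gint F u w = (\sum_e itg `[0, blen e] (fun x => F (u e x)) +
    \sum_h itg `[0, +oo[ (fun x => F (w h x)))%:E.
Proof.
move=> Hu Hw; rewrite /gint EFinD -!sumEFin; congr (_ + _)%E.
  by apply: eq_bigr => e _; rewrite itgE.
by apply: eq_bigr => h _; rewrite itgE.
Qed.

Section H1.
Variable f : gfun G.
Hypothesis Hf : H1 f.

Lemma massE : mass f = (Mass f)%:E.
Proof.
rewrite /mass gintE /Mass ?sumJ//=.
  by move=> e; have [] := H1_on (inl e) Hf.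
by move=> h; have [] := H1_on (inr h) Hf.
Qed.

Lemma dnormE : dnorm f = (Dn f)%:E.
Proof.
rewrite /dnorm gintE /Dn ?sumJ//=.
  by move=> e; have [] := H1_on (inl e) Hf.
by move=> h; have [] := H1_on (inr h) Hf.
Qed.

Lemma gfun_bounded : exists2 A : R, 0 < A & forall j x, dom j x -> `|uu f j x| <= A.
Proof.
have [B BP] := choice (fun j => let: ex_intro2 y a b := piece_max j Hf in
   ex_intro (fun B => forall x, dom j x -> `|uu f j x| <= B) _ b).
exists (1 + \sum_j `|B j|); first by rewrite ltr_pwDl// sumr_ge0.
move=> j x Dx; apply: le_trans (BP j x Dx) _; apply: le_trans (ler_norm _) _.
by rewrite (bigD1 j)//= addrCA lerDl addr_ge0// sumr_ge0.
Qed.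

Lemma igr_u6 j : igr (dom j) (fun x => uu f j x ^+ 6).
Proof.
have [A A0 HA] := gfun_bounded.
exact: (H1on_igr_pow (segdom_dom j) (H1_on j Hf) 4 (HA j)).
Qed.

Lemma norm6 (y : R) : `|y| ^+ 6 = y ^+ 6.
Proof. by rewrite -normrX ger0_norm// (exprM y 2 3) exprn_ge0// sqr_ge0. Qed.

Lemma p6E : p6 f = (P6 f)%:E.
Proof.
rewrite /p6 gintE /P6 ?sumJ//=.
- congr ((_ + _)%:E).
    by apply: eq_bigr => e _; apply: eq_Rintegral => x _; rewrite norm6.
  by apply: eq_bigr => e _; apply: eq_Rintegral => x _; rewrite norm6.
- move=> e; rewrite (_ : (fun x => `|ub f e x| ^+ 6) = (fun x => ub f e x ^+ 6)).
    exact: (igr_u6 (inl e)).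
  by apply/funext => x; rewrite norm6.
- move=> h; rewrite (_ : (fun x => `|uh f h x| ^+ 6) = (fun x => uh f h x ^+ 6)).
    exact: (igr_u6 (inr h)).
  by apply/funext => x; rewrite norm6.
Qed.

Lemma itg_en j : itg (dom j) (en (uu f j) (gg f j)) =
  2^-1 * itg (dom j) (fun x => gg f j x ^+ 2) - 6^-1 * itg (dom j) (fun x => uu f j x ^+ 6).
Proof.
have mj := mdom j; have [_ g2 _ _] := H1_on j Hf; have u6 := igr_u6 j.
rewrite /en RintegralB//; [|exact: igrZ..].
by rewrite !RintegralZl.
Qed.

Lemma EneE : Ene f = 2^-1 * Dn f - 6^-1 * P6 f.
Proof.
rewrite /Ene /Dn /P6 !mulr_sumr -sumrB; apply: eq_bigr => j _; exact: itg_en.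
Qed.

Lemma energyE : energy f = (Ene f)%:E.
Proof. by rewrite /energy dnormE p6E EneE -!EFinM -EFinB. Qed.

Lemma sum_dens A : 0 < A -> (forall j x, dom j x -> `|uu f j x| <= A) ->
  \sum_j itg (dom j) (dens A (uu f j) (gg f j)) = Ene f + A ^+ 4 / 6 * Mass f.
Proof.
move=> A0 uA; rewrite /Ene /Mass mulr_sumr -big_split/=; apply: eq_bigr => j _.
by rewrite (itg_dens (segdom_dom j) (H1_on j Hf) (mdom j) _ A0)//; exact: uA.
Qed.

End H1.

Lemma sumJ_ge1 (t : J -> R) j1 : (forall j, 0 <= t j) -> t j1 <= \sum_j t j.
Proof. by move=> t0; rewrite (bigD1 j1)//= lerDl sumr_ge0. Qed.

Lemma sumJ_ge2 (t : J -> R) j1 j2 : (forall j, 0 <= t j) -> j1 != j2 ->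
  t j1 + t j2 <= \sum_j t j.
Proof.
move=> t0 j12; rewrite (bigD1 j1)//= lerD2l (bigD1 j2)//=; last by rewrite eq_sym.
by rewrite lerDl sumr_ge0.
Qed.

(** Three disjoint contributions: an edge off the path, the edges of the path, whose increments
    telescope, and the halfline. *)
Lemma sumJ_linked (t : J -> R) (psi : V G -> R) w h0 E e0 : (forall j, 0 <= t j) ->
  linked w (hsrc h0) E -> e0 \notin E ->
  (forall e, e \in E -> `|psi (bsrc e) - psi (btgt e)| <= t (inl e)) ->
  t (inl e0) + `|psi w - psi (hsrc h0)| + t (inr h0) <= \sum_j t j.
Proof.
move=> t0 lE e0E tE; rewrite sumJ; apply: lerD; last first.
  by rewrite (bigD1 h0)//= lerDl sumr_ge0.
rewrite (bigD1 e0)//= lerD2l.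
apply: le_trans (lE psi) _.
apply: (@le_trans _ _ (\sum_(e in E) t (inl e))); first exact: ler_sum.
rewrite [leRHS](bigID (fun e => e \in E))/=.
rewrite (eq_bigl (fun e => (e != e0) && (e \in E))); last first.
  by move=> e; case: eqVneq => [->|//]; rewrite (negbTE e0E).
by rewrite lerDl sumr_ge0.
Qed.

Lemma itg_sq_gt0 (D : set R) (u g : R -> R) (s t c : R) : segdom D -> H1on D u g ->
  0 <= s -> s < t -> D t -> s <= c <= t -> u c != 0 ->
  0 < itg `[s, t] (fun x => u x ^+ 2).
Proof.
move=> sD H s0 st Dt /andP[sc ct] uc.
have mD : measurable D by case: sD.
have sub : `[s, t] `<=` D by exact: segdom_sub.
set C := itg D (fun x => g x ^+ 2) + 1.
have C0 : 0 < C.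
  by rewrite ltr_wpDl//; apply: Rintegral_ge0 => y _; exact: sqr_ge0.
have a0 : 0 < `|u c| by rewrite normr_gt0.
pose eta := `|u c| / 2; have eta0 : 0 < eta by rewrite divr_gt0.
pose d := eta ^+ 2 / C.
have d0 : 0 < d by rewrite divr_gt0// exprn_gt0.
(* The neighbourhood of [c] is clipped to the interval; it keeps positive length even when [c] is an
   end point. *)
pose p := Num.max s (c - d); pose q := Num.min t (c + d).
have pc : p <= c by rewrite ge_max sc gerBl ltW.
have cq : c <= q by rewrite le_min ct lerDl ltW.
have sp : s <= p by rewrite le_max lexx.
have qt : q <= t by rewrite ge_min lexx.
have pq : p < q.
  rewrite /p /q gt_max !lt_min st/=; apply/andP; split; first by rewrite ltr_pwDr.
  by apply/andP; split; lra.
have u2 : igr `[s, t] (fun x => u x ^+ 2).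
  by case: H => _ _ u2 _; exact: integrableS u2.
have spq : `[p, q] `<=` `[s, t].
  by move=> x; rewrite /= !in_itv/= => /andP[? ?]; apply/andP; split; lra.
have : itg `[p, q] (fun=> eta ^+ 2) <= itg `[p, q] (fun x => u x ^+ 2).
  apply: le_Rintegral => //; [exact: igr_cst|by apply: integrableS u2|].
  move=> x xpq.
  have Dx : D x by apply: sub; exact: spq.
  have Dc : D c by apply: sub; rewrite /= in_itv/= sc.
  have xcd : `|x - c| <= d.
    move: xpq; rewrite /= in_itv/= /p /q ge_max le_min => /andP[/andP[_ h1] /andP[_ h2]].
    by rewrite ler_norml; apply/andP; split; lra.
  have : `|u x - u c| <= eta.
    by apply: (@H1on_equicont _ _ _ _ sD H C) => //; rewrite /C lerDl ler01.
  rewrite distrC => h; have := le_trans (lerB_dist (u c) (u x)) h => h2.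
  rewrite -(real_normK (num_real (u x))); apply: norm_le_sqr; rewrite (ger0_norm (ltW eta0)).
  by rewrite /eta in h2 *; lra.
have : itg `[p, q] (fun x => u x ^+ 2) <= itg `[s, t] (fun x => u x ^+ 2).
  by apply: itg_sub => // x _; exact: sqr_ge0.
move=> h1; rewrite (itg_cst _ (ltW pq)) => h2; apply: lt_le_trans (le_trans h2 h1).
by rewrite mulr_gt0 ?exprn_gt0// subr_gt0.
Qed.

End GraphFunctions.

(** * Lower bounds of the energy *)

Section LowerBounds.
Variables (R : realType) (G : metric_graph R).
Local Notation mu := (@lebesgue_measure R).
Local Notation igr D f := (mu.-integrable D (EFin \o f)).
Local Notation itg D f := (Rintegral mu D f).
Local Notation J := (BE G + HL G)%type.
Hypotheses (conn : connected_graph G) (oneHL : #|HL G| = 1%N).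
Hypothesis noterm : forall v : V G, ~ terminal_point v.
Variable h0 : HL G.

Section fixed.
Variable f : gfun G.
Hypothesis Hf : H1 f.
Variables (j0 : J) (y0 : R).
Hypotheses (Dy0 : dom j0 y0)
  (max0 : forall j x, dom j x -> `|uu f j x| <= `|uu f j0 y0|).
Local Notation a := `|uu f j0 y0|.
Hypothesis a0 : 0 < a.

Section A.
Variable A : R.
Hypothesis aA : a <= A.
Let A0 : 0 < A. Proof. exact: lt_le_trans aA. Qed.
Let bnd j x : dom j x -> `|uu f j x| <= A.
Proof. by move=> Dx; apply: le_trans (max0 Dx) aA. Qed.

Let dj j := dens A (uu f j) (gg f j).

Let dj_ge0 j D : D `<=` dom j -> 0 <= itg D (dj j).
Proof.
by move=> DD; apply: Rintegral_ge0 => x /DD Dx; apply: dens_ge0 => //; exact: bnd.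
Qed.

Lemma itg_en_ge j D : measurable D -> D `<=` dom j ->
  - (a ^+ 4 / 6 * itg D (fun x => uu f j x ^+ 2)) <= itg D (en (uu f j) (gg f j)).
Proof.
move=> mD DD.
have b x : D x -> `|uu f j x| <= a by move=> /DD; exact: max0.
have := itg_dens (segdom_dom j) (H1_on j Hf) mD DD a0 b.
have : 0 <= itg D (dens a (uu f j) (gg f j)).
  by apply: Rintegral_ge0 => x /b Dx; exact: dens_ge0.
lra.
Qed.

Section split.
Variables (j1 : J) (U S : set R).
Hypotheses (mU : measurable U) (mS : measurable S) (UD : U `<=` dom j1) (SD : S `<=` dom j1).
Hypothesis US : forall k : R -> R, igr (dom j1) k -> itg (dom j1) k = itg U k + itg S k.

(** What remains of the calibrated density when the spare part of the piece [j1] is removed. *)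
Definition used j := if j == j1 then itg U (dj j1) else itg (dom j) (dj j).

Lemma used_ge0 j : 0 <= used j.
Proof. by rewrite /used; case: ifP => _; exact: dj_ge0. Qed.

(** On the spare set [S] the calibration is applied at height [a] instead of [A], so its mass is
    charged only a^4 / 6. The difference to A^4 / 6 is the whole source of strictness. *)
Lemma used_le : \sum_j used j <= Ene f
  + A ^+ 4 / 6 * (Mass f - itg S (fun x => uu f j1 x ^+ 2))
  + a ^+ 4 / 6 * itg S (fun x => uu f j1 x ^+ 2).
Proof.
have rest : \sum_(j | j != j1) used j = \sum_(j | j != j1)
    (itg (dom j) (en (uu f j) (gg f j)) + A ^+ 4 / 6 * itg (dom j) (fun x => uu f j x ^+ 2)).
  apply: eq_bigr => j jj; rewrite /used (negbTE jj).
  by rewrite /dj (itg_dens (segdom_dom j) (H1_on j Hf) (mdom j) _ A0)//; exact: bnd.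
rewrite (bigD1 j1)//= rest big_split/= -mulr_sumr /used eqxx.
have -> : Ene f = itg (dom j1) (en (uu f j1) (gg f j1)) +
    \sum_(j | j != j1) itg (dom j) (en (uu f j) (gg f j)) by rewrite /Ene (bigD1 j1).
have -> : Mass f = itg (dom j1) (fun x => uu f j1 x ^+ 2) +
    \sum_(j | j != j1) itg (dom j) (fun x => uu f j x ^+ 2) by rewrite /Mass (bigD1 j1).
have b x : U x -> `|uu f j1 x| <= A by move=> /UD; exact: bnd.
rewrite /dj (itg_dens (segdom_dom j1) (H1_on j1 Hf) mU UD A0 b).
have := itg_en_ge mS SD.
have -> : itg (dom j1) (en (uu f j1) (gg f j1)) = itg U (en (uu f j1) (gg f j1)) + itg S (en (uu f j1) (gg f j1)).
  by apply: US; apply: (igr_en (segdom_dom j1) (H1_on j1 Hf) (mdom j1) _ A0) => //; exact: bnd.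
have -> : itg (dom j1) (fun x => uu f j1 x ^+ 2) =
    itg U (fun x => uu f j1 x ^+ 2) + itg S (fun x => uu f j1 x ^+ 2).
  by apply: US; have [] := H1_on j1 Hf.
move: (\sum_(i | i != j1) _) (\sum_(i | i != j1) _) => X Y.
move: (itg U _) (itg S _) (itg U _) (itg S _) => p q r s h.
lra.
Qed.

End split.

Variable phi : V G -> R.
Hypothesis phib : forall e, ub f e 0 = phi (bsrc e) /\ ub f e (blen e) = phi (btgt e).
Hypothesis phih : forall h, uh f h 0 = phi (hsrc h).

Lemma edge_seg_var e s t : 0 <= s -> s <= t -> t <= blen e ->
  `|Psi A (ub f e t) - Psi A (ub f e s)| <= itg `[s, t] (dj (inl e)).
Proof.
move=> s0 st tl; apply: (Psi_incr_le (segdom_dom (inl e)) (H1_on (inl e) Hf) A0).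
- by rewrite s0.
- by rewrite /= in_itv/= (le_trans s0 st).
- move=> x /andP[sx xt]; apply: (@bnd (inl e)).
  by rewrite /= in_itv/= (le_trans s0 sx) (le_trans xt tl).
Qed.

Lemma edge_var e : `|Psi A (phi (bsrc e)) - Psi A (phi (btgt e))| <= itg (dom (inl e)) (dj (inl e)).
Proof.
have [<- <-] := phib e; rewrite distrC; apply: edge_seg_var => //.
exact: ltW (blen_gt0 e).
Qed.

Lemma hl_seg_var h s : 0 <= s -> Psi A (uh f h s) <= itg `[s, +oo[ (dj (inr h)).
Proof.
move=> s0; apply: Psi_le_tail => //; first exact: (H1_on (inr h) Hf).
by move=> x sx; apply: (@bnd (inr h)); rewrite /= in_itv/= andbT (le_trans s0).
Qed.

Lemma hl_var h : Psi A (phi (hsrc h)) <= itg (dom (inr h)) (dj (inr h)).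
Proof. by rewrite -phih; exact: hl_seg_var. Qed.

Lemma used_path e1 U w E : U `<=` dom (inl e1) -> linked w (hsrc h0) E -> e1 \notin E ->
  itg U (dj (inl e1)) + Psi A (phi w) <= \sum_j used (inl e1) U j.
Proof.
move=> UD lE eE.
have tE e : e \in E -> `|Psi A (phi (bsrc e)) - Psi A (phi (btgt e))| <= used (inl e1) U (inl e).
  move=> eE'; rewrite /used; case: eqP => [[ee]|_]; first by rewrite -ee eE' in eE.
  exact: edge_var.
have := @sumJ_linked _ _ (used (inl e1) U) (fun v => Psi A (phi v)) w h0 E e1 (used_ge0 UD) lE eE tE.
apply: le_trans; rewrite {1}/used eqxx -addrA lerD2l.
apply: (@le_trans _ _ (`|Psi A (phi w) - Psi A (phi (hsrc h0))| + Psi A (phi (hsrc h0)))).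
  by rewrite -lerBlDr ler_norm.
by rewrite lerD2l /used; exact: hl_var.
Qed.

End A.

(* A point of maximal modulus is joined to infinity by a path avoiding a set of positive mass. *)
Lemma path_to_infinity : exists j1 U S,
  [/\ measurable U, measurable S, U `<=` dom j1, S `<=` dom j1 &
  [/\ forall k : R -> R, igr (dom j1) k -> itg (dom j1) k = itg U k + itg S k,
    0 < itg S (fun x => uu f j1 x ^+ 2) &
    forall A : R, a <= A -> Psi A a <= \sum_j used A j1 U j]].
Proof.
have [[phi [phib phih]] _] := Hf.
(* At a vertex maximum a whole edge off the path is spare; its mass is positive because u does not
   vanish at the end [w]. *)
have vertex w : `|phi w| = a -> exists j1 U S,
  [/\ measurable U, measurable S, U `<=` dom j1, S `<=` dom j1 &
  [/\ forall k : R -> R, igr (dom j1) k -> itg (dom j1) k = itg U k + itg S k,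
    0 < itg S (fun x => uu f j1 x ^+ 2) &
    forall A : R, a <= A -> Psi A a <= \sum_j used A j1 U j]].
  move=> wa; have [E [e [b [lE eE ew]]]] := linked_offpath conn oneHL w h0 noterm.
  exists (inl e), set0, (dom (inl e)); split; [exact: measurable0|exact: mdom|by []|by []|split].
  - by move=> k _; rewrite Rintegral_set0 add0r.
  - pose c := if b then 0 else blen e.
    have l0 := blen_gt0 e.
    apply: (@itg_sq_gt0 _ _ _ _ 0 (blen e) c (segdom_dom (inl e)) (H1_on (inl e) Hf)) => //.
    + by rewrite /= in_itv/= ltW// lexx.
    + by rewrite /c; case: (b); rewrite ?lexx ltW.
    + rewrite -normr_gt0 (_ : uu f (inl e) c = phi w) ?wa//.
      by rewrite -ew /c /dend /=; case: (b); have [] := phib e.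
  - move=> A aA; have := @used_path A aA phi phib phih e set0 w E (fun x h => False_ind _ h) lE eE.
    by rewrite Rintegral_set0 add0r -wa Psi_abs.
have [y00|y0n] := eqVneq y0 0.
  case Ej : j0 => [e|h]; move: Dy0 max0 a0 vertex; rewrite Ej y00 /=.
    by have [-> _] := phib e => _ _ _ /(_ (bsrc e) erefl).
  by rewrite phih => _ _ _ /(_ (hsrc h) erefl).
(* On the halfline the ray beyond [y0] is the path, and the segment back to the vertex is spare. *)
case Ej : j0 => [e|h]; move: (Dy0); rewrite Ej /= in_itv/=; last first.
  rewrite andbT => yge.
  have ygt : 0 < y0 by rewrite lt_neqAle eq_sym y0n.
  have S1 : `[0, y0] `<=` dom (inr h).
    by move=> x; rewrite /= !in_itv/= andbT => /andP[].
  have S2 : `[y0, +oo[ `<=` dom (inr h).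
    by move=> x; rewrite /= !in_itv/= !andbT; exact: le_trans.
  exists (inr h), [set` `[y0, +oo[], [set` `[0, y0]]; split => //; split.
  - by move=> k ki; rewrite addrC; exact: itg_splity.
  - apply: (@itg_sq_gt0 _ _ _ _ 0 y0 y0 (segdom_dom (inr h)) (H1_on (inr h) Hf)) => //.
    + by rewrite /= in_itv/= yge.
    + by rewrite lexx ltW.
    + by move: a0; rewrite Ej normr_gt0.
  - move=> A aA'; have aA : a <= A by rewrite Ej.
    apply: (@le_trans _ _ (used A (inr h) [set` `[y0, +oo[] (inr h))).
      by rewrite Psi_abs /used eqxx; exact: (hl_seg_var aA).
    by apply: sumJ_ge1 => j; exact: (used_ge0 aA).
move=> /andP[yge yl].
have [yel|ynl] := eqVneq y0 (blen e).
  move: max0 a0 vertex; rewrite Ej yel /=.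
  by have [_ ->] := phib e => _ _ /(_ (btgt e) erefl).
have ygt : 0 < y0 by rewrite lt_neqAle eq_sym y0n.
have ylt : y0 < blen e by rewrite lt_neqAle ynl.
have S1 : `[0, y0] `<=` dom (inl e).
  by move=> x; rewrite /= !in_itv/= => /andP[-> /le_trans]; exact.
have S2 : `[y0, blen e] `<=` dom (inl e).
  by move=> x; rewrite /= !in_itv/= => /andP[/(le_trans yge) ->].
have uy : ub f e y0 != 0 by move: a0; rewrite Ej normr_gt0.
have Dl : dom (inl e) (blen e) by rewrite /= in_itv/= lexx ltW// blen_gt0.
(* Inside an edge, the part towards the vertex where the path starts is used, and the other part is
   spare. *)
have [E [eE [lE|lE]]] := linked_avoid conn e (hsrc h0).
- exists (inl e), [set` `[0, y0]], [set` `[y0, blen e]]; split => //; split.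
  + by move=> k ki; exact: itg_split.
  + apply: (@itg_sq_gt0 _ _ _ _ y0 (blen e) y0 (segdom_dom (inl e)) (H1_on (inl e) Hf)) => //.
    by rewrite lexx.
  + move=> A aA'; have aA : a <= A by rewrite Ej.
    apply: le_trans (@used_path A aA phi phib phih e _ _ E S1 lE eE).
    have := edge_seg_var aA (lexx 0) yge yl; have [-> _] := phib e.
    move=> /(le_trans (ler_norm _)); rewrite lerBlDr; apply: le_trans.
    by rewrite Psi_abs.
- exists (inl e), [set` `[y0, blen e]], [set` `[0, y0]]; split => //; split.
  + by move=> k ki; rewrite addrC; exact: itg_split.
  + apply: (@itg_sq_gt0 _ _ _ _ 0 y0 y0 (segdom_dom (inl e)) (H1_on (inl e) Hf)) => //.
    * by rewrite /= in_itv/= yge.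
    * by rewrite lexx ltW.
  + move=> A aA'; have aA : a <= A by rewrite Ej.
    apply: le_trans (@used_path A aA phi phib phih e _ _ E S2 lE eE).
    have := edge_seg_var aA yge yl (lexx _); have [_ ->] := phib e; rewrite distrC.
    move=> /(le_trans (ler_norm _)); rewrite lerBlDr; apply: le_trans.
    by rewrite Psi_abs.
Qed.

(** The spare mass [mS] does not depend on [A], so the height may be chosen afterwards in terms of
    it. *)
Lemma energy_lower_bound : exists2 mS : R, 0 < mS & forall A : R, a <= A ->
  Psi A a - A ^+ 4 / 6 * (Mass f - mS) - a ^+ 4 / 6 * mS <= Ene f.
Proof.
have [j1 [U [S [mU mS UD SD [US S0 H]]]]] := path_to_infinity.
exists (itg S (fun x => uu f j1 x ^+ 2)) => // A aA.
by have := le_trans (H A aA) (used_le aA mU mS UD SD US); lra.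
Qed.

End fixed.
End LowerBounds.

(** * Expansion of the calibration just above the maximum *)

Section Calibration_value.
Variable R : realType.

Lemma atan_le (c : R) : 0 <= c -> atan c <= c.
Proof.
move=> c0; have [|x] := @MVT_segment R atan (fun x => (1 + x ^+ 2)^-1) 0 c c0.
  by apply: continuous_subspaceT => x; exact: continuous_atan.
rewrite atan0 !subr0 in_itv/= => /andP[x0 _] ->.
by rewrite ler_piMl// invf_le1 ?ltr_pwDl ?sqr_ge0// lerDl sqr_ge0.
Qed.

Lemma asin_cos_atan (c : R) : 0 <= c -> asin (Num.sqrt (1 + c ^+ 2))^-1 = pi / 2 - atan c.
Proof.
move=> c0; rewrite -cos_atan.
have -> : cos (atan c) = sin (pi / 2 - atan c).
  by rewrite sinB sin_pihalf cos_pihalf mul1r mul0r subr0.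
have p0 := pi_gt0 R; have := atan_ltpi2 c; have := le_atan c0; rewrite atan0 => h1 h2.
by rewrite sinK// in_itv/=; apply/andP; split; lra.
Qed.

(** For this height a^2 / A^2 = cos(atan c), and up to the factor a^4 / (4 sqrt 3) the value is c +
    (1 + c^2) (pi / 2 - atan c). The bound atan c <= c leaves (1 + c^2) pi / 2 - c^3: the
    first-order terms cancel. *)
Lemma Psi_lower (a c : R) : 0 < a -> 0 <= c -> exists A : R,
  [/\ a <= A, A ^+ 4 = a ^+ 4 * (1 + c ^+ 2) &
   a ^+ 4 / 6 * mu_halfline R * (1 + c ^+ 2) - a ^+ 4 * c ^+ 3 / (4 * Num.sqrt 3) <= Psi A a].
Proof.
move=> a0 c0.
pose r := Num.sqrt (1 + c ^+ 2).
have p1 : 0 < 1 + c ^+ 2 by rewrite ltr_pwDl// sqr_ge0.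
have r0 : 0 < r by rewrite sqrtr_gt0.
have r2 : r ^+ 2 = 1 + c ^+ 2 by rewrite sqr_sqrtr// ltW.
have r1 : 1 <= r.
  rewrite -(ler_pXn2r (n := 2)) ?nnegrE// ?(ltW r0)// expr1n r2 lerDl sqr_ge0//.
pose A := a * Num.sqrt r.
have A2 : A ^+ 2 = a ^+ 2 * r by rewrite exprMn sqr_sqrtr// ltW.
have s1 : 1 <= Num.sqrt r.
  by rewrite -(ler_pXn2r (n := 2)) ?nnegrE// ?sqrtr_ge0// expr1n sqr_sqrtr// ltW.
exists A; split.
- by rewrite ler_peMr// ltW.
- by rewrite (exprM A 2 2) A2 exprMn r2 -exprM.
rewrite /Psi (exprM A 2 2) A2.
have -> : a ^+ 2 / (a ^+ 2 * r) = r^-1 by field; rewrite !gt_eqF.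
rewrite /psi0 asin_cos_atan//.
have -> : Num.sqrt (1 - r^-1 ^+ 2) = c / r.
  rewrite (_ : 1 - r^-1 ^+ 2 = (c / r) ^+ 2); first by rewrite sqrtr_sqr ger0_norm// divr_ge0// ltW.
  have -> : (c / r) ^+ 2 = (r ^+ 2 - 1) / r ^+ 2 by rewrite r2 expr_div_n r2 addrC addrK.
  by field; rewrite gt_eqF.
have s3 : 0 < Num.sqrt 3 :> R by rewrite sqrtr_gt0.
have s32 : Num.sqrt 3 ^+ 2 = 3 :> R by rewrite sqr_sqrtr.
have E1 : a ^+ 4 / 6 * mu_halfline R = a ^+ 4 / (4 * Num.sqrt 3) * (pi / 2).
  rewrite /mu_halfline; apply: (mulIf (lt0r_neq0 s3)).
  rewrite -[LHS]mulrA -[pi * _ / 4 * _](_ : pi / 4 * Num.sqrt 3 ^+ 2 = _); last by ring.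
  by rewrite s32; field; rewrite gt_eqF.
rewrite E1.
have -> : a ^+ 4 * c ^+ 3 / (4 * Num.sqrt 3) = a ^+ 4 / (4 * Num.sqrt 3) * c ^+ 3 by ring.
rewrite exprMn r2 -mulrA -mulrBr -exprM.
have -> : a ^+ (2 * 2) * (1 + c ^+ 2) / (4 * Num.sqrt 3) * (r^-1 * (c / r) + (pi / 2 - atan c))
  = a ^+ 4 / (4 * Num.sqrt 3) * ((1 + c ^+ 2) * (r^-1 * (c / r) + (pi / 2 - atan c))) by ring.
apply: ler_wpM2l; first by rewrite divr_ge0 ?exprn_ge0 ?mulr_ge0 ?(ltW a0) ?(ltW s3).
have -> : (1 + c ^+ 2) * (r^-1 * (c / r) + (pi / 2 - atan c)) =
  c + (1 + c ^+ 2) * (pi / 2 - atan c).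
  by rewrite mulrDr -r2; field; rewrite gt_eqF.
have := atan_le c0; nra.
Qed.

End Calibration_value.

(** * Multiplication by a constant *)

Section Scaling.
Variables (R : realType) (G : metric_graph R).
Local Notation mu := (@lebesgue_measure R).
Local Notation igr D f := (mu.-integrable D (EFin \o f)).
Local Notation itg D f := (Rintegral mu D f).

Definition gscale (c : R) (f : gfun G) : gfun G := GFun
  (fun e x => c * ub f e x) (fun e x => c * gb f e x)
  (fun h x => c * uh f h x) (fun h x => c * gh f h x).

Lemma uu_gscale c f j : uu (gscale c f) j = (fun x => c * uu f j x).
Proof. by case: j. Qed.

Lemma gg_gscale c f j : gg (gscale c f) j = (fun x => c * gg f j x).
Proof. by case: j. Qed.

Lemma H1_gscale c f : H1 f -> H1 (gscale c f).
Proof.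
move=> Hf; have [[phi [phib phih]] [Hb Hh]] := Hf; split.
  exists (fun v => c * phi v); split=> [e|h] /=; last by rewrite phih.
  by have [-> ->] := phib e.
split=> [e|h] /=.
  have [mg g2 Hu] := Hb e; have Hon := H1_on (inl e) Hf.
  have g2i : igr `[0, blen e] (fun x => gb f e x ^+ 2) by case: Hon.
  have g2c : igr `[0, blen e] (fun x => (c * gb f e x) ^+ 2).
    by rewrite (_ : (fun x => _) = (fun x => c ^+ 2 * gb f e x ^+ 2));
      [exact: igrZ|apply/funext => x; rewrite exprMn].
  split.
  - by apply: measurable_funM => //; exact: measurable_cst.
  - by rewrite itgE// ltry.
  - move=> x xl; rewrite Hu// mulrDr RintegralZl//.
    by apply: (H1on_igr_g (segdom_dom (inl e)) Hon) => //; rewrite /= in_itv.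
have [mg g2 u2 Hu] := Hh h; have Hon := H1_on (inr h) Hf.
have [_ g2i u2i _] := Hon.
have g2c : igr `[0, +oo[ (fun x => (c * gh f h x) ^+ 2).
  by rewrite (_ : (fun x => _) = (fun x => c ^+ 2 * gh f h x ^+ 2));
    [exact: igrZ|apply/funext => x; rewrite exprMn].
have u2c : igr `[0, +oo[ (fun x => (c * uh f h x) ^+ 2).
  by rewrite (_ : (fun x => _) = (fun x => c ^+ 2 * uh f h x ^+ 2));
    [exact: igrZ|apply/funext => x; rewrite exprMn].
split.
- by apply: measurable_funM => //; exact: measurable_cst.
- by rewrite itgE// ltry.
- by rewrite itgE// ltry.
- move=> x x0; rewrite Hu// mulrDr RintegralZl//.
  by apply: (H1on_igr_g (segdom_dom (inr h)) Hon) => //; rewrite /= in_itv/= x0.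
Qed.

Lemma itg_scale_pow (c : R) (n : nat) (D : set R) (v : R -> R) : measurable D ->
  igr D (fun x => v x ^+ n) -> itg D (fun x => (c * v x) ^+ n) = c ^+ n * itg D (fun x => v x ^+ n).
Proof.
by move=> mD vi; rewrite -RintegralZl//; apply: eq_Rintegral => x _; rewrite exprMn.
Qed.

Lemma Mass_gscale c f : H1 f -> Mass (gscale c f) = c ^+ 2 * Mass f.
Proof.
move=> Hf; rewrite /Mass mulr_sumr; apply: eq_bigr => j _.
by rewrite uu_gscale itg_scale_pow//; [exact: mdom|have [] := H1_on j Hf].
Qed.

Lemma Dn_gscale c f : H1 f -> Dn (gscale c f) = c ^+ 2 * Dn f.
Proof.
move=> Hf; rewrite /Dn mulr_sumr; apply: eq_bigr => j _.
by rewrite gg_gscale itg_scale_pow//; [exact: mdom|have [] := H1_on j Hf].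
Qed.

Lemma P6_gscale c f : H1 f -> P6 (gscale c f) = c ^+ 6 * P6 f.
Proof.
move=> Hf; rewrite /P6 mulr_sumr; apply: eq_bigr => j _.
by rewrite uu_gscale itg_scale_pow//; [exact: mdom|exact: igr_u6].
Qed.

Lemma Ene_gscale c f : H1 f -> Ene (gscale c f) = 2^-1 * c ^+ 2 * Dn f - 6^-1 * c ^+ 6 * P6 f.
Proof.
move=> Hf; rewrite EneE; last exact: H1_gscale.
by rewrite Dn_gscale// P6_gscale//; ring.
Qed.

End Scaling.

(** * Gagliardo-Nirenberg inequality with the constant of the halfline *)

Section GagliardoNirenberg.
Variables (R : realType) (G : metric_graph R).
Hypotheses (conn : connected_graph G) (oneHL : #|HL G| = 1%N).
Hypothesis noterm : forall v : V G, ~ terminal_point v.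

Lemma mu_halfline_gt0 : 0 < mu_halfline R.
Proof. by rewrite /mu_halfline divr_gt0// mulr_gt0 ?pi_gt0// sqrtr_gt0. Qed.

Lemma exists_HL : exists h : HL G, True.
Proof.
have : (0 < #|HL G|)%N by rewrite oneHL.
by move/card_gt0P => [h _]; exists h.
Qed.

Lemma Mass_max0 (f : gfun G) : (forall j x, dom j x -> uu f j x = 0) -> Mass f = 0.
Proof.
move=> u0; rewrite /Mass big1// => j _.
rewrite (@eq_Rintegral _ _ _ _ _ (fun=> 0)); first by rewrite /Rintegral integral0.
by move=> x; rewrite inE => Dx; rewrite u0// expr0n.
Qed.

Lemma energy_gt0 (f : gfun G) : H1 f -> Mass f <> 0 -> Mass f <= mu_halfline R -> 0 < Ene f.
Proof.
move=> Hf M0 Mle; have [h0 _] := exists_HL.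
have [j [y [Dy mx]]] := gfun_max (inr h0) Hf.
have [a0|] := ltP 0 `|uu f j y|; last first.
  rewrite normr_le0 => /eqP uy; exfalso; apply: M0; apply: Mass_max0 => j' x Dx.
  by have := mx j' x Dx; rewrite uy normr0 normr_le0 => /eqP.
have [mS mS0 H] := energy_lower_bound conn oneHL noterm h0 Hf Dy mx a0.
set a := `|uu f j y| in a0 H.
(* With c = mS / 2, and per unit of a^4, the spare mass saves mS c^2 / 6 = c^3 / 3 while [Psi_lower]
   loses c^3 / (4 sqrt 3), which is at most c^3 / 4. *)
have c0 : 0 <= mS / 2 by lra.
have [A [aA A4 HA]] := Psi_lower a0 c0.
have := H A aA; rewrite A4.
have a4 : 0 < a ^+ 4 by rewrite exprn_gt0.
set q := a ^+ 4 in HA A4 a4 *; set c := mS / 2 in HA A4 c0 *.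
have mSc : mS = 2 * c by rewrite /c; field.
have cgt : 0 < c by lra.
have s3 : 1 <= Num.sqrt 3 :> R.
  by rewrite -(ler_pXn2r (n := 2)) ?nnegrE// ?sqrtr_ge0// expr1n sqr_sqrtr//; lra.
have : q * c ^+ 3 / (4 * Num.sqrt 3) <= q * c ^+ 3 / 4.
  rewrite ler_pdivrMr; last by rewrite mulr_gt0// sqrtr_gt0.
  have : 0 <= q * c ^+ 3 by rewrite mulr_ge0// ?exprn_ge0// ltW.
  by move: (q * c ^+ 3) => z z0; nra.
have : 0 <= q / 6 * (mu_halfline R - Mass f) * (1 + c ^+ 2).
  apply: mulr_ge0; last by rewrite addr_ge0// sqr_ge0.
  by apply: mulr_ge0; [rewrite divr_ge0// ltW|rewrite subr_ge0].
have : 0 < q * c ^+ 3 by rewrite mulr_gt0// exprn_gt0.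
rewrite mSc; move: HA; nra.
Qed.

Lemma gagliardo_nirenberg (f : gfun G) : H1 f -> Mass f <> 0 ->
  P6 f * mu_halfline R ^+ 2 < 3 * Mass f ^+ 2 * Dn f.
Proof.
move=> Hf M0.
have Mgt : 0 < Mass f.
  rewrite lt_neqAle eq_sym; apply/andP; split; first exact/eqP.
  by apply: sumr_ge0 => j _; apply: Rintegral_ge0 => x _; exact: sqr_ge0.
have m0 := mu_halfline_gt0.
pose c := Num.sqrt (mu_halfline R / Mass f).
have c2 : c ^+ 2 = mu_halfline R / Mass f by rewrite sqr_sqrtr// divr_ge0// ltW.
have Mc : Mass (gscale c f) = mu_halfline R by rewrite Mass_gscale// c2 divfK// gt_eqF.
have := @energy_gt0 (gscale c f) (H1_gscale c Hf); rewrite Mc => /(_ _ (lexx _)) H.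
have : 0 < Ene (gscale c f) by apply: H => E; rewrite E ltxx in m0.
rewrite Ene_gscale// (exprM c 2 3) c2.
set q := mu_halfline R in m0 *; set M := Mass f in Mgt *.
have -> : 2^-1 * (q / M) * Dn f - 6^-1 * (q / M) ^+ 3 * P6 f =
  q / (6 * M ^+ 3) * (3 * M ^+ 2 * Dn f - P6 f * q ^+ 2) by field; rewrite gt_eqF.
rewrite pmulr_rgt0 ?subr_gt0// divr_gt0// mulr_gt0// exprn_gt0//.
Qed.

End GagliardoNirenberg.

(** * Coercivity up to mass mu_R *)

Section Coercivity.
Variables (R : realType) (G : metric_graph R).
Local Notation mu := (@lebesgue_measure R).
Local Notation igr D f := (mu.-integrable D (EFin \o f)).
Local Notation itg D f := (Rintegral mu D f).
Hypothesis oneHL : #|HL G| = 1%N.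
Hypothesis noterm : forall v : V G, ~ terminal_point v.

(* A harmonic sum rather than a minimum, so that no edge needs to be exhibited. *)
Definition lmin : R := (1 + \sum_e (blen (m := G) e / 12)^-1)^-1.

Lemma lmin_gt0 : 0 < lmin.
Proof.
rewrite invr_gt0 ltr_pwDl// sumr_ge0// => e _.
by rewrite invr_ge0 divr_ge0// ltW// blen_gt0.
Qed.

Lemma lmin_le e : lmin <= blen (m := G) e / 12.
Proof.
have l0 := blen_gt0 e; have l12 : 0 < blen e / 12 by rewrite divr_gt0.
rewrite -[leRHS]invrK lef_pV2 ?posrE; last 2 first.
- by rewrite -[X in _ < X]invrK invr_gt0 lmin_gt0.
- by rewrite invr_gt0.
rewrite (bigD1 e)//= addrCA lerDl addr_ge0// sumr_ge0// => e' _.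
by rewrite invr_ge0 divr_ge0// ltW// blen_gt0.
Qed.

Section fixed.
Variable f : gfun G.
Hypothesis Hf : H1 f.
Variable a : R.
Hypothesis max0 : forall j x, dom j x -> `|uu f j x| <= a.
Hypothesis a0 : 0 < a.
Let m := Mass f.
Hypothesis big : 4 * m <= a ^+ 2 * lmin.
Let dj j := dens a (uu f j) (gg f j).
Let kap := 256 * m / (a ^+ 2 * lmin ^+ 3).

Lemma Mass_ge0 (f' : gfun G) : 0 <= Mass f'.
Proof. by apply: sumr_ge0 => j _; apply: Rintegral_ge0 => x _; exact: sqr_ge0. Qed.

Let kap_ge0 : 0 <= kap.
Proof.
apply: divr_ge0; first by apply: mulr_ge0 => //; exact: Mass_ge0.
by apply/ltW/mulr_gt0; apply: exprn_gt0 => //; exact: lmin_gt0.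
Qed.

Let djT j : 0 <= itg (dom j) (dj j).
Proof. by apply: Rintegral_ge0 => x Dx; apply: dens_ge0 => //; exact: max0. Qed.

(** A third of a quarter of an edge is the twelfth in [lmin], which makes the error [kap] uniform
    over edges. *)
Lemma edge_escape e s t : 0 <= s -> t <= blen e -> blen e / 4 <= t - s ->
  Psi a (ub f e s) - kap <= itg `[s, t] (dj (inl e)) /\
  Psi a (ub f e t) - kap <= itg `[s, t] (dj (inl e)).
Proof.
move=> s0 tl st; have l0 := blen_gt0 e.
have stlt : s < t by lra.
have Dt : dom (inl e) t by rewrite /= in_itv/=; apply/andP; split; lra.
have sub : `[s, t] `<=` dom (inl e) by exact: segdom_sub (segdom_dom (inl e)) s0 Dt.
have lm := lmin_le e; have lm0 := lmin_gt0.
have ll : lmin <= (t - s) / 3 by lra.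
have uM : itg `[s, t] (fun x => uu f (inl e) x ^+ 2) <= m.
  apply: (@le_trans _ _ (itg (dom (inl e)) (fun x => uu f (inl e) x ^+ 2))).
    apply: itg_sub => //; first exact: mdom.
      by move=> x _; exact: sqr_ge0.
    by have [] := H1_on (inl e) Hf.
  by apply: (@sumJ_ge1 _ _ (fun j => itg (dom j) (fun x => uu f j x ^+ 2))) => j;
     apply: Rintegral_ge0 => x _; exact: sqr_ge0.
have MA : 4 * m <= a ^+ 2 * ((t - s) / 3).
  by apply: le_trans big _; rewrite ler_wpM2l// sqr_ge0.
have kk : 256 * m / (a ^+ 2 * ((t - s) / 3) ^+ 3) <= kap.
  have l3 : 0 < (t - s) / 3 by lra.
  set q := (t - s) / 3 in ll l3 *.
  have d1 : 0 < a ^+ 2 * lmin ^+ 3 by apply: mulr_gt0; exact: exprn_gt0.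
  have d2 : 0 < a ^+ 2 * q ^+ 3 by apply: mulr_gt0; exact: exprn_gt0.
  apply: ler_wpM2l; first by apply: mulr_ge0 => //; exact: Mass_ge0.
  rewrite lef_pV2 ?posrE//.
  apply: ler_wpM2l; first exact: sqr_ge0.
  by apply: lerXn2r => //; rewrite nnegrE ltW.
have bd x : s <= x <= t -> `|uu f (inl e) x| <= a.
  by move=> xst; apply: max0; apply: sub; rewrite /= in_itv.
have [E1 E2] := escape (segdom_dom (inl e)) (H1_on (inl e) Hf) a0 s0 stlt Dt bd uM MA.
split; [apply: le_trans E1|apply: le_trans E2]; by rewrite lerD2l lerN2.
Qed.

Let di e s t : 0 <= s -> t <= blen e -> igr `[s, t] (dj (inl e)).
Proof.
move=> s0 tl.
have sub : `[s, t] `<=` dom (inl e).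
  by move=> x; rewrite /= !in_itv/= => /andP[/(le_trans s0) -> /le_trans ->].
by apply: (igr_dens (segdom_dom (inl e)) (H1_on (inl e) Hf)) => // x /sub; exact: max0.
Qed.

Lemma split3 e s t : 0 <= s -> s <= t -> t <= blen e ->
  itg (dom (inl e)) (dj (inl e)) = itg `[0, s] (dj (inl e)) +
   itg `[s, t] (dj (inl e)) + itg `[t, blen e] (dj (inl e)).
Proof.
move=> s0 st tl; have l0 := blen_gt0 e.
rewrite /= (@itg_split _ 0 t (blen e) _ (le_trans s0 st) tl); last exact: di.
by rewrite (@itg_split _ 0 s t _ s0 st)//; exact: di.
Qed.

Lemma seg_var e s t : 0 <= s -> s <= t -> t <= blen e ->
  `|Psi a (ub f e t) - Psi a (ub f e s)| <= itg `[s, t] (dj (inl e)).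
Proof.
move=> s0 st tl; apply: (Psi_incr_le (segdom_dom (inl e)) (H1_on (inl e) Hf) a0).
- by rewrite s0.
- by rewrite /= in_itv/= (le_trans s0 st).
- move=> x /andP[sx xt]; apply: (max0 (j := inl e)).
  by rewrite /= in_itv/= (le_trans s0 sx) (le_trans xt tl).
Qed.

Variable phi : V G -> R.
Hypothesis phib : forall e, ub f e 0 = phi (bsrc e) /\ ub f e (blen e) = phi (btgt e).
Hypothesis phih : forall h, uh f h 0 = phi (hsrc h).

(** The end quarters leave room for two escapes in one edge: a point in one half is at least a
    quarter of the length away from the quarter at the opposite end. *)
Definition quarter (e : BE G) (b : bool) : set R :=
  if b then `[0, blen e / 4]%classic else `[3 * blen e / 4, blen e]%classic.

Lemma dend_escape e b : Psi a (phi (dend e b)) - kap <= itg (quarter e b) (dj (inl e)).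
Proof.
have l0 := blen_gt0 e; have [h1 h2] := phib e.
case: b => /=; [rewrite -h1|rewrite -h2].
  by have [] := @edge_escape e 0 (blen e / 4); [| |lra|]; lra.
by have [] := @edge_escape e (3 * blen e / 4) (blen e); [| |lra|]; lra.
Qed.

Lemma dend_escapeT e b : Psi a (phi (dend e b)) - kap <= itg (dom (inl e)) (dj (inl e)).
Proof.
apply: le_trans (dend_escape e b) _; have l0 := blen_gt0 e.
apply: itg_sub.
- exact: mdom.
- by case: b; exact: measurable_itv.
- by case: b => x; rewrite /= !in_itv/= => /andP[? ?]; apply/andP; split; lra.
- by move=> x Dx; apply: dens_ge0 => //; exact: max0.
- by apply: (igr_dens (segdom_dom (inl e)) (H1_on (inl e) Hf)) => //; [exact: mdom|exact: max0].
Qed.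

Lemma tail_var h s : 0 <= s -> Psi a (uh f h s) <= itg `[s, +oo[ (dj (inr h)).
Proof.
move=> s0; apply: Psi_le_tail => //; first exact: (H1_on (inr h) Hf).
by move=> x sx; apply: (max0 (j := inr h)); rewrite /= in_itv/= andbT (le_trans s0).
Qed.

(* From a point with value [p], one end of an edge is reached at cost [q] and leaves room for
   a further escape from that end, possibly through the opposite quarter [I] of the same edge. *)
Lemma escape_end e b (p I : R) : (forall j, 0 <= itg (dom j) (dj j)) ->
  (I + p - kap + (p - Psi a (phi (dend e b))) <= itg (dom (inl e)) (dj (inl e))) -> 0 <= I ->
  I = itg (quarter e (~~ b)) (dj (inl e)) ->
  2 * p - 2 * kap <= \sum_j itg (dom j) (dj j).
Proof.
move=> djp H I0 IE.
have [[e' [b' [ne eb']]]|[h hw]] := dend_other (erefl (dend e b)) (@noterm (dend e b)).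
  have [ee|ee] := eqVneq e' e.
    have bb : b' = ~~ b by case: (b) (b') ne => [] [] //; rewrite ee.
    apply: le_trans (sumJ_ge1 (inl e) djp); apply: le_trans H.
    by have := dend_escape e' b'; rewrite eb' ee bb -IE; lra.
  apply: le_trans (sumJ_ge2 djp (j1 := inl e) (j2 := inl e') _); last first.
    by apply/eqP => -[E]; rewrite E eqxx in ee.
  by have := dend_escapeT e' b'; rewrite eb'; lra.
apply: le_trans (sumJ_ge2 djp (j1 := inl e) (j2 := inr h) isT).
by have := @tail_var h 0 (lexx _); rewrite phih hw /= => ?; have := kap_ge0; lra.
Qed.

Lemma two_escapes j0 y0 : dom j0 y0 -> `|uu f j0 y0| = a ->
  2 * Psi a a - 2 * kap <= \sum_j itg (dom j) (dj j).
Proof.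
move=> Dy0 ua.
have Pa : Psi a a = Psi a (uu f j0 y0) by rewrite -ua Psi_abs.
rewrite Pa {Pa}; case: j0 Dy0 ua => [e|h]; rewrite /= in_itv/= => Dy0 ua; last first.
  move: Dy0; rewrite andbT => yge.
  (* With the maximum on the halfline, one way leads to infinity and the other back to the vertex
     and out through an edge. *)
  have [e [b eb]] := dend_hsrc oneHL (@noterm (hsrc h)).
  apply: le_trans (sumJ_ge2 djT (j1 := inl e) (j2 := inr h) isT).
  have := dend_escapeT e b; rewrite eb -phih => E1.
  have E2 := tail_var h yge.
  have E3 : Psi a (uh f h y0) - Psi a (uh f h 0) <= itg `[0, y0] (dj (inr h)).
    apply: le_trans (ler_norm _) _.
    apply: (Psi_incr_le (segdom_dom (inr h)) (H1_on (inr h) Hf) a0) => //.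
    + by rewrite lexx.
    + by rewrite /= in_itv/= yge.
    + by move=> x /andP[x0 _]; apply: (max0 (j := inr h)); rewrite /= in_itv/= x0.
  have -> : itg (dom (inr h)) (dj (inr h)) = itg `[0, y0] (dj (inr h)) + itg `[y0, +oo[ (dj (inr h)).
    apply: itg_splity => //.
    by apply: (igr_dens (segdom_dom (inr h)) (H1_on (inr h) Hf)) => // x; exact: (max0 (j := inr h)).
  by have := kap_ge0; lra.
move: Dy0 => /andP[yge yl]; have l0 := blen_gt0 e.
have Ige b : 0 <= itg (quarter e b) (dj (inl e)).
  apply: Rintegral_ge0 => x qx; apply: dens_ge0 => //; apply: (max0 (j := inl e)).
  by move: qx; case: b; rewrite /= !in_itv/= => /andP[? ?]; apply/andP; split; lra.
(* One escape takes place within the edge, from [y0] to the opposite quarter; the other leaves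
   through the nearer end, possibly into that quarter if the edge is a loop. *)
have [h|h] := leP (blen e / 2) y0.
  apply: (@escape_end e false _ (itg (quarter e true) (dj (inl e)))) => //.
  rewrite (@split3 e (blen e / 4) y0) /=; [|lra|lra|lra].
  rewrite -(phib e).2.
  have [|||_ E1] := @edge_escape e (blen e / 4) y0; [lra|lra|lra|].
  have := seg_var yge yl (lexx _); rewrite distrC => /(le_trans (ler_norm _)).
  by lra.
apply: (@escape_end e true _ (itg (quarter e false) (dj (inl e)))) => //.
rewrite (@split3 e y0 (3 * blen e / 4)) /=; [|lra|lra|lra].
rewrite -(phib e).1.
have [|||E1 _] := @edge_escape e y0 (3 * blen e / 4); [lra|lra|lra|].
have := seg_var (lexx 0) yge yl => /(le_trans (ler_norm _)).
by lra.
Qed.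

End fixed.

(** Up to mass mu_R the terms in a^4 have a favourable sign, so that only the errors of the two
    escapes remain. *)
Lemma energy_coercive (f : gfun G) j0 y0 : H1 f -> Mass f <= mu_line R ->
  dom j0 y0 -> (forall j x, dom j x -> `|uu f j x| <= `|uu f j0 y0|) ->
  0 < `|uu f j0 y0| -> 4 * Mass f <= `|uu f j0 y0| ^+ 2 * lmin ->
  - (512 * Mass f / (`|uu f j0 y0| ^+ 2 * lmin ^+ 3)) <= Ene f.
Proof.
move=> Hf Mle Dy mx a0 big; have [[phi [phib phih]] _] := Hf.
have := two_escapes Hf mx a0 big phib phih Dy erefl.
rewrite (sum_dens Hf a0 mx); set a := `|uu f j0 y0| in a0 *.
have -> : 2 * Psi a a = a ^+ 4 / 6 * mu_line R by rewrite Psi_max// mu_lineE; ring.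
have a4 : 0 <= a ^+ 4 / 6 by rewrite divr_ge0// exprn_ge0// ltW.
have := ler_wpM2l a4 Mle.
have -> : 512 * Mass f / (a ^+ 2 * lmin ^+ 3) = 2 * (256 * Mass f / (a ^+ 2 * lmin ^+ 3)) by ring.
by lra.
Qed.

End Coercivity.

(** * Competitors *)

Section TestFunctions.
Variables (R : realType) (G : metric_graph R).
Local Notation mu := (@lebesgue_measure R).
Local Notation itg D f := (Rintegral mu D f).
Hypothesis oneHL : #|HL G| = 1%N.
Hypothesis noterm : forall v : V G, ~ terminal_point v.

Definition core_len : R := \sum_e blen (m := G) e.

Lemma core_len_gt0 : 0 < core_len.
Proof.
have [h _] := exists_HL oneHL; have [e _] := dend_hsrc oneHL (@noterm (hsrc h)).
rewrite /core_len (bigD1 e)//= ltr_pwDl ?blen_gt0// sumr_ge0// => e' _.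
exact: ltW (blen_gt0 e').
Qed.

Definition testf (A k T : R) : gfun G := GFun
  (fun _ _ => A * Num.sqrt (sech T)) (fun _ _ => 0)
  (fun _ => sol A k T) (fun _ => dsol A k T).

Lemma sum_HL (F : HL G -> R) h0 : \sum_h F h = F h0.
Proof.
rewrite (bigD1 h0)//= big1 ?addr0// => h /eqP hh.
by exfalso; apply: hh; exact: HL_unique.
Qed.

Section params.
Variables A k T : R.
Hypothesis k0 : 0 < k.

Lemma testf_H1 : H1 (testf A k T).
Proof.
split.
  exists (fun _ => A * Num.sqrt (sech T)); split => //= h.
  by rewrite /sol mulr0 sub0r sechN.
split=> [e|h] /=; last exact: sol_H1.
split.
- exact: measurable_cst.
- by rewrite expr0n/= integral0 ltry.
- by move=> x _; rewrite /Rintegral integral0 addr0.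
Qed.

Let itg_edge n (e : BE G) :
  itg (dom (inl e)) (fun x => uu (testf A k T) (inl e) x ^+ n) =
  (A * Num.sqrt (sech T)) ^+ n * blen e.
Proof. by rewrite /= itg_cst ?subr0// ltW// blen_gt0. Qed.

Lemma testf_Mass : Mass (testf A k T) =
  A ^+ 2 * sech T * core_len + A ^+ 2 * (k^-1 * (pi - gd (- T))).
Proof.
have [h0 _] := exists_HL oneHL.
rewrite /Mass sumJ (eq_bigr _ (fun e _ => itg_edge 2 e)) -mulr_sumr; congr (_ + _).
  by rewrite exprMn sqr_sqrtr// ltW// sech_gt0.
by rewrite (sum_HL _ h0) /= /Rintegral int_sol2.
Qed.

Lemma testf_P6 : P6 (testf A k T) =
  A ^+ 6 * sech T ^+ 3 * core_len + A ^+ 6 * (k^-1 * (pi / 2 - gd3 (- T))).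
Proof.
have [h0 _] := exists_HL oneHL.
rewrite /P6 sumJ (eq_bigr _ (fun e _ => itg_edge 6 e)) -mulr_sumr; congr (_ + _).
  by rewrite exprMn (exprM (Num.sqrt _) 2 3) sqr_sqrtr// ltW// sech_gt0.
rewrite (sum_HL _ h0) /= /Rintegral.
have := int_sol6 A T k0; set r := (X in _ = X%:E) => e6.
rewrite -[RHS]/(fine r%:E) -e6; congr fine.
by apply: eq_integral => x _; rewrite norm6.
Qed.

Lemma testf_Dn : Dn (testf A k T) =
  k * A ^+ 2 / 4 * ((pi - gd (- T)) - (pi / 2 - gd3 (- T))).
Proof.
have [h0 _] := exists_HL oneHL.
rewrite /Dn sumJ big1 ?add0r; last first.
  by move=> e _; rewrite /= expr0n/= /Rintegral integral0.
by rewrite (sum_HL _ h0) /= /Rintegral int_dsol2.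
Qed.

End params.

Lemma sech0 : sech 0 = 1 :> R.
Proof. by rewrite /sech oppr0 expR0; field. Qed.

Lemma gd0 : gd (- 0) = pi / 2 :> R.
Proof. by rewrite /gd oppr0 expR0 atan1; field. Qed.

Lemma gd30 : gd3 (- 0) = pi / 4 :> R.
Proof. by rewrite /gd3 gd0 oppr0 /tanh oppr0 subrr mul0r mulr0 add0r; field. Qed.

Section half.
Variables A k : R.
Hypothesis k0 : 0 < k.
Local Notation f := (testf A k 0).
Let kn : k != 0. Proof. by rewrite gt_eqF. Qed.

Lemma testf0_Mass : Mass f = A ^+ 2 * (core_len + pi / (2 * k)).
Proof. by rewrite testf_Mass// sech0 gd0; field. Qed.

Lemma testf0_P6 : P6 f = A ^+ 6 * (core_len + pi / (4 * k)).
Proof. by rewrite testf_P6// sech0 gd30 expr1n; field. Qed.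

Lemma testf0_Dn : Dn f = A ^+ 2 * (k * pi / 16).
Proof. by rewrite testf_Dn// gd0 gd30; field. Qed.

End half.

Lemma testf_negative (m : R) : mu_halfline R < m ->
  exists f : gfun G, [/\ H1 f, Mass f = m & Ene f < 0].
Proof.
move=> hm; have L0 := core_len_gt0.
have s3 : 0 < Num.sqrt 3 :> R by rewrite sqrtr_gt0.
have s32 : Num.sqrt 3 ^+ 2 = 3 :> R by rewrite sqr_sqrtr.
(* The core receives exactly the excess mass. With k = 2 A^2 / sqrt 3 the half soliton has mass
   mu_(R^+) and zero energy, so the total energy is the core's - A^6 L / 6, L being the length of
   the core. *)
pose q := (m - mu_halfline R) / core_len.
have q0 : 0 < q by rewrite divr_gt0// subr_gt0.
pose A := Num.sqrt q.
have A2 : A ^+ 2 = q by rewrite sqr_sqrtr// ltW.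
pose k := 2 * q / Num.sqrt 3.
have k0 : 0 < k by rewrite divr_gt0// mulr_gt0.
exists (testf A k 0); split.
- exact: testf_H1.
- rewrite testf0_Mass// A2.
  have -> : q * (core_len + pi / (2 * k)) = q * core_len + pi * Num.sqrt 3 / 4.
    by rewrite /k; field; rewrite !gt_eqF.
  by rewrite /q divfK ?gt_eqF// /mu_halfline subrK.
- rewrite EneE; last exact: testf_H1.
  rewrite testf0_Dn// testf0_P6// (exprM A 2 3) A2.
  have -> : 2^-1 * (q * (k * pi / 16)) - 6^-1 * (q ^+ 3 * (core_len + pi / (4 * k))) =
     - (q ^+ 3 * core_len / 6) + q ^+ 2 * pi / (48 * Num.sqrt 3) * (3 - Num.sqrt 3 ^+ 2).
    by rewrite /k; field; rewrite !gt_eqF.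
  rewrite s32 subrr mulr0 addr0 oppr_lt0 divr_gt0// mulr_gt0// exprn_gt0//.
Qed.

Lemma testf_small (m e : R) : 0 < m -> 0 < e ->
  exists f : gfun G, [/\ H1 f, Mass f = m & Ene f <= e].
Proof.
move=> m0 e0; have L0 := core_len_gt0; have p0 := pi_gt0 R.
(* A small [k] spreads the function out: the kinetic term is at most k^2 m / 16 <= k m / 16 <= e,
   and the other term is not positive. *)
pose k := Num.min 1 (16 * e / m).
have k0 : 0 < k by rewrite lt_min ltr01 divr_gt0// mulr_gt0.
have k1 : k <= 1 by rewrite ge_min lexx.
have ke : k * m <= 16 * e by rewrite -ler_pdivlMr// ge_min lexx orbT.
have d0 : 0 < core_len + pi / (2 * k) by rewrite addr_gt0// divr_gt0// mulr_gt0.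
pose q := m / (core_len + pi / (2 * k)).
have q0 : 0 < q by rewrite divr_gt0.
pose A := Num.sqrt q; have A2 : A ^+ 2 = q by rewrite sqr_sqrtr// ltW.
exists (testf A k 0); split.
- exact: testf_H1.
- by rewrite testf0_Mass// A2 /q divfK// gt_eqF.
- rewrite EneE; last exact: testf_H1.
  rewrite testf0_Dn// testf0_P6// A2.
  have h1 : 0 <= A ^+ 6 * (core_len + pi / (4 * k)).
    rewrite mulr_ge0 ?exprn_ge0 ?sqrtr_ge0// addr_ge0 ?(ltW L0)//.
    by rewrite divr_ge0 ?(ltW p0)// mulr_ge0// ltW.
  have h2 : q * pi <= 2 * k * m.
    rewrite /q mulrAC ler_pdivrMr//.
    have -> : 2 * k * m * (core_len + pi / (2 * k)) = 2 * k * m * core_len + m * pi.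
      by field; rewrite gt_eqF.
    by rewrite lerDr !mulr_ge0 ?(ltW m0) ?(ltW L0) ?(ltW k0).
  have h3 : k * (q * pi) <= k * (2 * k * m) by rewrite ler_pM2l.
  have h4 : k * (k * m) <= k * m by rewrite ler_piMl// mulr_ge0// ltW.
  lra.
Qed.

(** A soliton truncated far from its peak has nearly the mass and the zero energy of the one on the
    line. Since m exceeds mu_R, it can be multiplied by a factor bounded away from 1, which makes
    the energy negative, and increasing the height drives it to -oo. *)
Lemma testf_unbounded (m M : R) : mu_line R < m ->
  exists f : gfun G, [/\ H1 f, Mass f = m & Ene f <= - M].
Proof.
move=> hm; have L0 := core_len_gt0; have p0 := pi_gt0 R.
have s3 : 0 < Num.sqrt 3 :> R by rewrite sqrtr_gt0.
have s32 : Num.sqrt 3 ^+ 2 = 3 :> R by rewrite sqr_sqrtr.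
have l0 : 0 < mu_line R by rewrite /mu_line divr_gt0// mulr_gt0.
pose th := m - mu_line R; have th0 : 0 < th by rewrite subr_gt0.
have mt : 0 < m - th / 2 by rewrite /th; lra.
(* Before rescaling the mass will be at most m - th / 2, so [rho] bounds the squared rescaling
   factor from below; [kap] is the resulting gain for the untruncated profile. *)
pose rho := m / (m - th / 2).
have rho1 : 1 < rho by rewrite ltr_pdivlMr//; lra.
pose kap := (rho ^+ 2 - 1) * pi / 2.
have kap0 : 0 < kap by rewrite divr_gt0// mulr_gt0//; nra.
(* [Q] is the squared height. It makes Q kap / (8 sqrt 3) at least M, half of [kap] being reserved
   for the truncation errors. *)
pose Q := 1 + `|M| * (8 * Num.sqrt 3) / kap.
have Q1 : 1 <= Q.
  by rewrite /Q lerDl divr_ge0 ?(ltW kap0)// mulr_ge0// mulr_ge0// ltW.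
have Q0 : 0 < Q by lra.
have r20 : 0 < 2 * rho ^+ 2.
  by apply: mulr_gt0 => //; apply: exprn_gt0; lra.
(* [tau] is e^-T. The three bounds ensure T >= 0, a core mass of at most th / 2, and a truncation
   error of at most kap / 2. [Q] is fixed first because the core mass grows with it. *)
pose tau := Num.min 1 (Num.min (th / (4 * Q * core_len)) (kap / (2 * rho ^+ 2))).
have tau0 : 0 < tau.
  rewrite !lt_min ltr01/=; apply/andP; split; apply: divr_gt0 => //.
  by apply: mulr_gt0 => //; apply: mulr_gt0.
have tau_le1 : tau <= 1 by rewrite ge_min lexx.
pose T := - ln tau.
have eT : expR (- T) = tau by rewrite /T opprK lnK.
have sT : sech T <= 2 * tau by rewrite -eT; exact: sech_le.
have sT0 := sech_gt0 T.
have dT : gd (- T) <= 2 * tau by rewrite /gd eT ler_pM2l// atan_le// ltW.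
have dT0 : 0 <= gd (- T).
  by rewrite /gd mulr_ge0// -[X in X <= _](@atan0 R) le_atan// expR_ge0.
have tau1 : 4 * Q * core_len * tau <= th.
  have q0 : 0 < 4 * Q * core_len by apply: mulr_gt0 => //; apply: mulr_gt0.
  by rewrite mulrC -ler_pdivlMr// !ge_min lexx orbT.
have tau2 : 2 * rho ^+ 2 * tau <= kap.
  by rewrite mulrC -ler_pdivlMr// !ge_min lexx !orbT.
pose a := Num.sqrt Q; have a2 : a ^+ 2 = Q by rewrite sqr_sqrtr// ltW.
pose k := 2 * Q / Num.sqrt 3.
have k0 : 0 < k by rewrite divr_gt0// mulr_gt0.
set d := gd (- T) in dT dT0.
pose m1 := Q * sech T * core_len + Num.sqrt 3 / 2 * (pi - d).
have dpi : d < pi.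
  have := atan_ltpi2 (expR (- T)); rewrite /d /gd; lra.
have m10 : 0 < m1.
  rewrite addr_gt0// mulr_gt0 ?divr_gt0// ?subr_gt0//.
  by rewrite mulr_gt0.
have m1le : m1 <= m - th / 2.
  have : Q * sech T * core_len <= th / 2.
    have : Q * core_len * sech T <= Q * core_len * (2 * tau) by rewrite ler_wpM2l// mulr_ge0// ltW.
    lra.
  have : Num.sqrt 3 / 2 * (pi - d) <= mu_line R.
    rewrite /mu_line; have : 0 <= Num.sqrt 3 / 2 * d by rewrite mulr_ge0// divr_ge0// ltW.
    lra.
  by rewrite /m1 /th; lra.
pose c := Num.sqrt (m / m1).
have m0 : 0 < m by lra.
have c2 : c ^+ 2 = m / m1 by rewrite sqr_sqrtr// divr_ge0// ltW.
have crho : rho <= c ^+ 2.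
  by rewrite c2 /rho ler_wpM2l ?(ltW m0)// lef_pV2 ?posrE.
exists (gscale c (testf a k T)).
have H1t := testf_H1 a T k0.
split.
- exact: H1_gscale.
- rewrite Mass_gscale// testf_Mass// a2 c2.
  have -> : Q * sech T * core_len + Q * (k^-1 * (pi - gd (- T))) = m1.
    by rewrite /m1 -/d /k; field; rewrite !gt_eqF.
  by rewrite divfK// gt_eqF.
rewrite Ene_gscale// testf_Dn// testf_P6// -/d a2 (exprM a 2 3) a2 (exprM c 2 3).
set w := c ^+ 2 in crho *.
set eta := gd3 (- T).
have etaE : eta = 2^-1 * (d - sech T * tanh T).
  by rewrite /eta /gd3 sechN tanhN -/d; ring.
have sth : 0 <= sech T * tanh T.
  rewrite mulr_ge0 ?(ltW sT0)// /tanh divr_ge0 ?(ltW (cosh2_gt0 _))// subr_ge0 ler_expR.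
  by have := ln_le0 tau_le1; rewrite /T; lra.
have eta1 : eta <= d / 2 by rewrite etaE; lra.
have w0 : 0 < w by lra.
have X1 : Q ^+ 3 * sech T ^+ 3 * core_len >= 0.
  by rewrite !mulr_ge0 ?exprn_ge0 ?(ltW L0) ?(ltW sT0) ?(ltW Q0).
have E : 2^-1 * w * (k * Q / 4 * (pi - d - (pi / 2 - eta))) -
   6^-1 * w ^+ 3 * (Q ^+ 3 * sech T ^+ 3 * core_len + Q ^+ 3 * (k^-1 * (pi / 2 - eta))) =
   w * Q ^+ 2 / (4 * Num.sqrt 3) * ((pi / 2 - d + eta) - w ^+ 2 * (Num.sqrt 3 ^+ 2 / 3) * (pi / 2 - eta))
   - 6^-1 * w ^+ 3 * (Q ^+ 3 * sech T ^+ 3 * core_len).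
  by rewrite /k; field; rewrite !gt_eqF.
rewrite E s32 divff// mulr1.
have Y1 : 0 <= 6^-1 * w ^+ 3 * (Q ^+ 3 * sech T ^+ 3 * core_len).
  by rewrite mulr_ge0// mulr_ge0// exprn_ge0// ltW.
have w2 : rho ^+ 2 <= w ^+ 2 by apply: norm_le_sqr; rewrite ger0_norm//; lra.
have Z1 : (pi / 2 - d + eta) - w ^+ 2 * (pi / 2 - eta) <= - (kap / 2).
  have : rho ^+ 2 * (pi / 2 - d / 2) <= w ^+ 2 * (pi / 2 - eta).
    apply: ler_pM => //; [exact: sqr_ge0|lra|lra].
  have : rho ^+ 2 * d <= rho ^+ 2 * (2 * tau) by rewrite ler_wpM2l// sqr_ge0.
  by rewrite /kap in tau2 *; lra.
have V0 : 0 <= w * Q ^+ 2 / (4 * Num.sqrt 3).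
  apply: divr_ge0; last by apply: mulr_ge0 => //; exact: ltW.
  by apply: mulr_ge0; [exact: ltW|exact: sqr_ge0].
have V1 : Q / (4 * Num.sqrt 3) <= w * Q ^+ 2 / (4 * Num.sqrt 3).
  rewrite ler_pM2r ?invr_gt0 ?mulr_gt0//.
  by rewrite -[leLHS]mul1r; apply: ler_pM => //; [exact: ltW|lra|nra].
have := ler_wpM2l V0 Z1.
have : Q / (4 * Num.sqrt 3) * (kap / 2) <= w * Q ^+ 2 / (4 * Num.sqrt 3) * (kap / 2).
  by rewrite ler_wpM2r// divr_ge0// ltW.
have : M <= Q / (4 * Num.sqrt 3) * (kap / 2).
  have -> : Q / (4 * Num.sqrt 3) * (kap / 2) = kap / (8 * Num.sqrt 3) + `|M|.
    by rewrite /Q; field; rewrite !gt_eqF.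
  have : 0 <= kap / (8 * Num.sqrt 3).
    by apply: divr_ge0; [exact: ltW|apply: mulr_ge0 => //; exact: ltW].
  by have := ler_norm M; lra.
lra.
Qed.

End TestFunctions.

(** * Existence of minimisers *)

Section UltraLimit.
Variables (R : realType) (I : Type) (U : set_system I).
Context {UU : UltraFilter U}.

(* The limit is the supremum of the eventual lower bounds. *)
Lemma ultra_limit (v : I -> R) (M : R) : U [set i | `|v i| <= M] ->
  exists l : R, forall e : R, 0 < e -> U [set i | `|v i - l| <= e].
Proof.
move=> UM; pose L := [set x | U [set i | x <= v i]].
have supL : has_sup L.
  split; first by exists (- M); apply: filterS UM => i /=; rewrite ler_norml => /andP[].
  exists M => x Lx; have [i [/= xv]] := filter_ex (filterI Lx UM).
  by rewrite ler_norml => /andP[_ vM]; exact: le_trans vM.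
exists (sup L) => e e0.
have [x Lx xs] := sup_adherent e0 supL.
have hi : U [set i | v i <= sup L + e].
  have [H|H] := in_ultra_setVsetC [set i | sup L + e <= v i] UU.
    by have := ub_le_sup supL.2 H; rewrite gerDl leNgt e0.
  by apply: filterS H => i /= /negP; rewrite -ltNge; exact: ltW.
apply: filterS2 hi Lx => i /= h1 h2.
by rewrite ler_norml; apply/andP; split; lra.
Qed.

End UltraLimit.

Lemma pow_lip (R : realType) (M : R) n : 0 <= M -> exists2 K : R, 0 <= K &
  forall a b : R, `|a| <= M -> `|b| <= M -> `|a ^+ n - b ^+ n| <= K * `|a - b|.
Proof.
move=> M0; elim: n => [|n [K K0 IH]].
  by exists 0 => // a b _ _; rewrite !expr0 subrr normr0 mul0r.
exists (M * K + M ^+ n) => [|a b aM bM]; first by rewrite addr_ge0 ?mulr_ge0 ?exprn_ge0.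
have -> : a ^+ n.+1 - b ^+ n.+1 = a * (a ^+ n - b ^+ n) + b ^+ n * (a - b).
  by rewrite !exprS; ring.
apply: le_trans (ler_normD _ _) _; rewrite !normrM mulrDl lerD//.
  by rewrite -mulrA ler_pM// IH.
by rewrite ler_wpM2r// normrX lerXn2r ?nnegrE.
Qed.

Section Truncation.
Variable R : realType.
Local Notation mu := (@lebesgue_measure R).
Local Notation igr D f := (mu.-integrable D (EFin \o f)).

Lemma igrS (D D' : set R) f : measurable D -> measurable D' -> D' `<=` D -> igr D f -> igr D' f.
Proof. by move=> mD mD' DD fi; apply: integrableS fi. Qed.

(** Fatou's lemma for the truncations to [0, k] turns a uniform bound into integrability. *)
Lemma igr_exhaust (D : set R) (f : R -> R) (c : R) : measurable D ->
  measurable_fun D f -> (forall x, D x -> 0 <= x) -> (forall x, 0 <= f x) ->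
  (forall k : nat, (\int[mu]_(x in (D `&` `[0, k%:R])%R) (f x)%:E <= c%:E)%E) -> igr D f.
Proof.
move=> mD mf D0 f0 fc; apply: igr_ge0 => //.
apply: (@le_lt_trans _ _ c%:E); last exact: ltry.
pose w k x := ((f x)%:E * (\1_(`[0, k%:R]%classic : set R) x)%:E)%E.
have mw k : measurable_fun D (w k).
  by apply: emeasurable_funM; [exact/measurable_EFinP|apply/measurable_EFinP; exact: measurable_indic].
have -> : (\int[mu]_(x in D) (f x)%:E = \int[mu]_(x in D) limn_einf (w^~ x))%E.
  apply: eq_integral => x; rewrite inE => Dx.
  rewrite (@cvg_limn_einf_sup _ _ (f x)%:E)//.
  apply: cvg_near_cst; near=> k; rewrite /w indicE mem_set ?mule1//=.
  rewrite in_itv/= D0//=; near: k; exact: nbhs_infty_ger.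
apply: le_trans (fatou _ _ _ _) _ => //.
  by move=> k x _; rewrite /w mule_ge0// lee_fin// indicE.
apply: limn_einf_le_cst => k.
suff <- : (\int[mu]_(x in (D `&` `[0, k%:R])%R) (f x)%:E = \int[mu]_(x in D) w k x)%E by [].
rewrite integral_mkcondr; apply: eq_integral => x _; rewrite patchE /w indicE.
by case: ifP => _; rewrite ?mule1 ?mule0.
Unshelve. all: by end_near. Qed.

End Truncation.

(** * Compactness on one edge *)

Section PieceLimit.
Variables (R : realType) (I : Type) (U : set_system I).
Context {UU : UltraFilter U}.
Local Notation mu := (@lebesgue_measure R).
Local Notation igr D f := (mu.-integrable D (EFin \o f)).
Local Notation itg D f := (Rintegral mu D f).
Variables (D : set R) (u g : I -> R -> R) (C M m : R).
Hypotheses (sD : segdom D) (C0 : 0 < C) (M0 : 0 <= M).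
Let P i := [/\ H1on D (u i) (g i), itg D (fun x => g i x ^+ 2) <= C,
  itg D (fun x => u i x ^+ 2) <= m & forall x, D x -> `|u i x| <= M].
Hypothesis UP : U P.
Let mD : measurable D. Proof. by case: sD. Qed.
Let D0 x : D x -> 0 <= x. Proof. by case: sD => _ _ [D0 _]; exact: D0. Qed.
Let B (k : nat) := D `&` `[0, k%:R].
Let mB k : measurable (B k). Proof. exact: measurableI. Qed.
Let BD k : B k `<=` D. Proof. exact: subIsetl. Qed.
Let igrB' k f : igr D f -> igr (B k) f. Proof. exact: igrS. Qed.

(** All values converge along the same ultrafilter. The indicator extends the uniform bound to
    points outside [D], where nothing is known. *)
Lemma pointwise_limit : exists phi : R -> R,
  forall x, D x -> forall e : R, 0 < e -> U [set i | `|u i x - phi x| <= e].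
Proof.
have [phi phiP] := choice (fun x : R =>
  ultra_limit (v := fun i => u i x * \1_D x) (M := M) ltac:(
    apply: filterS UP => i [_ _ _ uM] /=; rewrite indicE;
    have [/set_mem Dx|_] := boolP (x \in D); rewrite ?mulr1 ?mulr0 ?normr0//; exact: uM)).
exists phi => x Dx e e0; apply: filterS (phiP x e e0) => i /=.
by rewrite indicE mem_set// mulr1.
Qed.

Variable phi : R -> R.
Hypothesis phiP : forall x, D x -> forall e : R, 0 < e -> U [set i | `|u i x - phi x| <= e].

Lemma limit_bound x : D x -> `|phi x| <= M.
Proof.
move=> Dx; apply/ler_addgt0Pr => e e0.
have [i [[_ _ _ uM]]] := filter_ex (filterI UP (phiP Dx e0)).
rewrite /= distrC => /(le_trans (lerB_dist _ _)); have := uM x Dx; lra.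
Qed.

Lemma limit_equicont (eta s t : R) : 0 < eta -> D s -> D t -> `|t - s| <= eta ^+ 2 / C ->
  `|phi t - phi s| <= eta.
Proof.
move=> eta0 Ds Dt st; apply/ler_addgt0Pr => e e0.
have e20 : 0 < e / 2 by rewrite divr_gt0.
have [i [[Hi gC _ _] [/= h1 h2]]] := filter_ex (filterI UP (filterI (phiP Dt e20) (phiP Ds e20))).
have h3 := H1on_equicont sD Hi C0 eta0 gC Ds Dt st.
move: h1 h2 h3; rewrite !ler_norml => /andP[? ?] /andP[? ?] /andP[? ?].
by apply/andP; split; lra.
Qed.

(** The Arzela-Ascoli argument: convergence at the finitely many grid points up to [N] spreads to
    the points between them by equicontinuity. *)
Lemma uniform_limit (N e : R) : 0 < e ->
  U [set i | forall x, D x -> x <= N -> `|u i x - phi x| <= e].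
Proof.
move=> e0; pose eta := e / 3; have eta0 : 0 < eta by rewrite divr_gt0.
pose d := eta ^+ 2 / C; have d0 : 0 < d by rewrite divr_gt0// exprn_gt0.
pose K := (Num.truncn (N / d)).+1.
have UK : U [set i | forall k : 'I_K, D (k%:R * d) -> `|u i (k%:R * d) - phi (k%:R * d)| <= eta].
  apply: filter_forall => k; have [Dk|nDk] := pselect (D (k%:R * d)).
    by apply: filterS (phiP Dk eta0) => i.
  by apply: filterS filterT => i.
apply: filterS2 UP UK => i [Hi gC _ _] /= HK x Dx xN.
have x0 := D0 Dx.
have xd0 : 0 <= x / d by rewrite divr_ge0// ltW.
have kK : (Num.truncn (x / d) < K)%N.
  by rewrite ltnS le_truncn// ler_pM2r// invr_gt0.
have /andP[k1 k2] := truncn_itv xd0.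
move: (HK (Ordinal kK)) => /=; set k := Num.truncn _ in k1 k2 * => Hk.
have kx : k%:R * d <= x by rewrite -ler_pdivlMr.
have xk : x < k.+1%:R * d by rewrite -ltr_pdivrMr.
have Dk : D (k%:R * d).
  by case: sD => _ _ [_ Dc]; apply: Dc Dx _; rewrite kx mulr_ge0// ltW.
have dist : `|x - k%:R * d| <= eta ^+ 2 / C.
  rewrite ger0_norm ?subr_ge0// -/d; move: xk; rewrite -natr1 mulrDl mul1r; lra.
have h1 := H1on_equicont sD Hi C0 eta0 gC Dk Dx dist.
have h2 := limit_equicont eta0 Dk Dx dist.
move: h1 h2 (Hk Dk); rewrite !ler_norml /eta => /andP[? ?] /andP[? ?] /andP[? ?].
by apply/andP; split; lra.
Qed.

Lemma limit_continuous : {within D, continuous phi}.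
Proof.
apply/subspace_continuousP => x Dx; apply/cvgrPdist_le => e e0.
rewrite near_withinE; near=> y => Dy.
apply: limit_equicont => //.
near: y; apply: (@cvgr_dist_le _ _ _ _ _ id) => //.
by rewrite divr_gt0// exprn_gt0.
Unshelve. all: by end_near. Qed.

Let mphi : measurable_fun D phi.
Proof. by apply: subspace_continuous_measurable_fun => //; exact: limit_continuous. Qed.

Lemma limit_igr_trunc n k : igr (B k) (fun x => phi x ^+ n).
Proof.
apply: (@igr_le _ _ _ (fun=> M ^+ n)) => //.
- by apply: measurable_funX; apply: measurable_funS mphi.
- move=> x [Dx _]; rewrite normrX lerXn2r ?nnegrE//; exact: limit_bound.
- by apply: igrS (igr_cst 0 k%:R (M ^+ n)) => //; exact: subIsetr.
Qed.

Lemma limit_itg_pow n k (e : R) : 0 < e -> (forall i, P i -> igr D (fun x => u i x ^+ n)) ->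
  U [set i | `|itg (B k) (fun x => u i x ^+ n) - itg (B k) (fun x => phi x ^+ n)| <= e].
Proof.
move=> e0 ui; have [K K0 HK] := pow_lip n M0.
(* The error is at most K d times the length k; the added units cover vanishing factors. *)
pose d := e / (K + 1) / (k%:R + 1).
have d0 : 0 < d by rewrite !divr_gt0// ltr_wpDl.
apply: filterS2 UP (uniform_limit k%:R d0) => i Pi /= Hi.
have uB := igrB' k (ui i Pi); have pB := limit_igr_trunc n k.
have mBk := mB k; have wi := igrB mBk uB pB.
rewrite -RintegralB//; apply: le_trans (le_normr_Rintegral _ wi) _ => //.
apply: (@le_trans _ _ (itg (B k) (fun=> K * d))).
  apply: le_Rintegral => //.
  - exact: (integrable_norm wi).
  - by apply: igrS (igr_cst 0 k%:R _) => //; exact: subIsetr.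
  move=> x [Dx]; rewrite /= in_itv/= => /andP[_ xk].
  have [_ _ _ uM] := Pi.
  apply: le_trans (HK _ _ (uM x Dx) (limit_bound Dx)) _.
  by rewrite ler_wpM2l// Hi.
apply: (@le_trans _ _ (itg `[0, k%:R] (fun=> K * d))).
  apply: itg_sub => //; [exact: subIsetr| |exact: igr_cst].
  by move=> x _; rewrite mulr_ge0// ltW.
rewrite itg_cst// subr0 /d.
have -> : K * (e / (K + 1) / (k%:R + 1)) * k%:R = e * ((K / (K + 1)) * (k%:R / (k%:R + 1))).
  by field; rewrite !gt_eqF// ltr_wpDl.
rewrite ler_piMr ?(ltW e0)// mulr_ile1 ?divr_ge0 ?addr_ge0//.
  by rewrite ler_pdivrMr ?ltr_wpDl// mul1r lerDl.
by rewrite ler_pdivrMr ?ltr_wpDl// mul1r lerDl.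
Qed.

Let u2i i : P i -> igr D (fun x => u i x ^+ 2). Proof. by move=> [[]]. Qed.

Lemma limit_igr_sq : igr D (fun x => phi x ^+ 2).
Proof.
apply: (@igr_exhaust _ _ _ (m + 1)) => //.
- exact: measurable_funX.
- by move=> x; exact: sqr_ge0.
move=> k; rewrite (itgE (mB k) (limit_igr_trunc 2 k)) lee_fin.
have [i [Pi /=]] := filter_ex (filterI UP (limit_itg_pow k ltr01 u2i)).
rewrite ler_norml => /andP[h _].
have : itg (B k) (fun x => u i x ^+ 2) <= itg D (fun x => u i x ^+ 2).
  by apply: itg_sub => //; [move=> x _; exact: sqr_ge0|exact: u2i].
have [_ _ um _] := Pi; lra.
Qed.

Lemma itg_sq_mid (E : set R) (h1 h2 : R -> R) (c : R) : measurable E ->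
  measurable_fun E h1 -> measurable_fun E h2 ->
  igr E (fun x => h1 x ^+ 2) -> igr E (fun x => h2 x ^+ 2) ->
  itg E (fun x => h1 x ^+ 2) <= c -> itg E (fun x => h2 x ^+ 2) <= c ->
  itg E (fun x => ((h1 x + h2 x) / 2) ^+ 2) <= c.
Proof.
move=> mE m1 m2 i1 i2 c1 c2.
have imid : igr E (fun x => ((h1 x + h2 x) / 2) ^+ 2).
  rewrite (_ : (fun x => _) = (fun x => 2^-1 ^+ 2 * (h1 x + h2 x) ^+ 2)); last first.
    by apply/funext => x; rewrite exprMn mulrC.
  by apply: igrZ => //; exact: igr_sqD.
apply: (@le_trans _ _ (itg E (fun x => 2^-1 * h1 x ^+ 2 + 2^-1 * h2 x ^+ 2))).
  apply: le_Rintegral => //; first by apply: igrD => //; exact: igrZ.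
  by move=> x _; have := sqr_ge0 (h1 x - h2 x); lra.
rewrite RintegralD//; [|exact: igrZ..]; rewrite !RintegralZl//; lra.
Qed.

Lemma itg_small (x t : R) (w : R -> R) (c : R) : 0 <= x -> 0 < t -> igr `[0, x] w ->
  igr `[0, x] (fun x => w x ^+ 2) -> itg `[0, x] (fun x => w x ^+ 2) <= c ->
  `|itg `[0, x] w| <= t * c + x / t.
Proof.
move=> x0 t0 wi w2 wc; apply: le_trans (le_normr_Rintegral _ wi) _ => //.
apply: (@le_trans _ _ (itg `[0, x] (fun y => t * w y ^+ 2 + t^-1))).
  apply: le_Rintegral => //.
  - exact: (integrable_norm wi).
  - by apply: igrD => //; [exact: igrZ|exact: igr_cst].
  - by move=> y _; exact: wsq_amgm.
rewrite RintegralD//; [|exact: igrZ|exact: igr_cst].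
by rewrite RintegralZl// itg_cst// subr0 mulrC lerD// 1?mulrC// ler_pM2l.
Qed.

(** Being a derivative of [phi] and having norms at most the limits [c k] on all truncations are
    closed convex conditions. Relaxed by 2^-n, they are met by some [g i]; [L2_convex_limit] then
    produces one function that satisfies all of them exactly. *)
Lemma weak_limit : exists gam : R -> R, H1on D phi gam /\
  forall k (e : R), 0 < e ->
   U [set i | itg (B k) (fun x => gam x ^+ 2) <= itg (B k) (fun x => g i x ^+ 2) + e].
Proof.
have tri (a b c e d : R) : `|a + b - c| <= d -> `|a - e| <= d -> `|e + b - c| <= 2 * d.
  move=> h1 h2; rewrite (_ : e + b - c = (a + b - c) - (a - e)); last by ring.
  by apply: le_trans (ler_normB _ _) _; lra.
have g2i i k : P i -> igr (B k) (fun x => g i x ^+ 2).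
  by move=> [[_ gi _ _] _ _ _]; exact: igrB'.
have gle i k : P i -> itg (B k) (fun x => g i x ^+ 2) <= C.
  move=> [[_ gi _ _] gC _ _]; apply: le_trans gC; apply: itg_sub => // x _; exact: sqr_ge0.
have [c cP] := choice (fun k : nat =>
  ultra_limit (v := fun i => itg (B k) (fun x => g i x ^+ 2)) (M := C) ltac:(
    apply: filterS UP => i Pi /=; rewrite ger0_norm ?gle//;
    by apply: Rintegral_ge0 => x _; exact: sqr_ge0)).
have c0 k : 0 <= c k.
  apply/ler_addgt0Pr => e e0; have [i /=] := filter_ex (cP k e e0).
  rewrite ler_norml => /andP[_ h].
  have : 0 <= itg (B k) (fun x => g i x ^+ 2) by apply: Rintegral_ge0 => x _; exact: sqr_ge0.
  lra.
have p2 n : 0 < (2 ^+ n)^-1 :> R by rewrite invr_gt0 exprn_gt0.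
have p2le n n' : (n <= n')%N -> (2 ^+ n')^-1 <= (2 ^+ n)^-1 :> R.
  by move=> nn; rewrite lef_pV2 ?posrE ?exprn_gt0// ler_weXn2l//; lra.
(* At stage n only the first n truncations and the points up to n are controlled, so that finitely
   many conditions suffice for non-emptiness. *)
pose S n (h : R -> R) := [/\ [/\ measurable_fun D h, igr D (fun x => h x ^+ 2) &
    itg D (fun x => h x ^+ 2) <= C],
  (forall k, (k <= n)%N -> itg (B k) (fun x => h x ^+ 2) <= c k + (2 ^+ n)^-1) &
  (forall x, D x -> x <= n%:R -> `|phi 0 + itg `[0, x] h - phi x| <= 2 / 2 ^+ n)].
have sub x : D x -> `[0, x] `<=` D by exact: segdom_sub.
have loc x (h : R -> R) : D x -> measurable_fun D h -> igr D (fun x => h x ^+ 2) ->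
    igr `[0, x] h /\ igr `[0, x] (fun x => h x ^+ 2).
  move=> Dx mh h2.
  have h2' : igr `[0, x] (fun x => h x ^+ 2) by apply: integrableS h2 => //; exact: sub.
  by split=> //; apply: igr_sq => //; apply: measurable_funS mh => //; exact: sub.
have Snd n n' : (n <= n')%N -> S n' `<=` S n.
  move=> nn h [h1 h2 h3]; split => //.
    move=> k kn; apply: le_trans (h2 k (leq_trans kn nn)) _; rewrite lerD2l; exact: p2le.
  move=> x Dx xn; apply: le_trans (h3 x Dx _) _.
    by apply: le_trans xn _; rewrite ler_nat.
  by rewrite ler_pM2l//; exact: p2le.
have Sconv n (h1 h2 : R -> R) : S n h1 -> S n h2 -> S n (fun x => (h1 x + h2 x) / 2).
  move=> [[m1 i1 C1] k1 a1] [[m2 i2 C2] k2 a2]; split.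
  - split; last exact: itg_sq_mid.
      by apply: measurable_funM => //; exact: measurable_funD.
    rewrite (_ : (fun x => _) = (fun x => 2^-1 ^+ 2 * (h1 x + h2 x) ^+ 2)); last first.
      by apply/funext => x; rewrite exprMn mulrC.
    by apply: igrZ => //; exact: igr_sqD.
  - move=> k kn; apply: itg_sq_mid => //; rewrite ?k1 ?k2//.
    + by apply: measurable_funS m1.
    + by apply: measurable_funS m2.
    + exact: igrB'.
    + exact: igrB'.
  - move=> x Dx xn.
    have [l1 _] := loc x h1 Dx m1 i1; have [l2 _] := loc x h2 Dx m2 i2.
    have -> : itg `[0, x] (fun x => (h1 x + h2 x) / 2) =
       2^-1 * itg `[0, x] h1 + 2^-1 * itg `[0, x] h2.
      rewrite -!RintegralZl// -RintegralD//; [|exact: igrZ..].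
      by apply: eq_Rintegral => y _; field.
    move: (a1 x Dx xn) (a2 x Dx xn); rewrite !ler_norml => /andP[? ?] /andP[? ?].
    by apply/andP; split; lra.
have Sne n : S n !=set0.
  have Uk : U [set i | forall k : 'I_n.+1,
      `|itg (B k) (fun x => g i x ^+ 2) - c k| <= (2 ^+ n)^-1].
    by apply: filter_forall => k; apply: filterS (cP k _ (p2 n)).
  have [i [[Hi gC um uM] [/= Hk Hx]]] :=
    filter_ex (filterI UP (filterI Uk (uniform_limit n%:R (p2 n)))).
  exists (g i); have [mg gi _ Hu] := Hi; split => //.
    move=> k kn; have := Hk (Ordinal (kn : (k < n.+1)%N)) => /=.
    by rewrite ler_norml => /andP[_]; lra.
  move=> x Dx xn; have n0 : 0 <= n%:R :> R by [].
  have D00 : D 0 by case: sD.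
  by have := Hx x Dx xn; rewrite (Hu x Dx) => /tri; apply; exact: Hx.
have SP n h : S n h -> [/\ measurable_fun D h, igr D (fun x => h x ^+ 2) &
    itg D (fun x => h x ^+ 2) <= C] by case.
have [gam [h [Sh mg g2 hg]]] := L2_convex_limit mD SP Snd Sconv Sne.
have mh n : measurable_fun D (h n) by have [] := SP _ _ (Sh n).
have ih n : igr D (fun x => h n x ^+ 2) by have [] := SP _ _ (Sh n).
exists gam; split.
  split=> //; first exact: limit_igr_sq.
  move=> x Dx; apply/eqP; rewrite eq_sym -subr_eq0 -normr_le0.
  have x0 := D0 Dx.
  have [gx g2x] := loc x gam Dx mg g2.
  (* The 10 collects 2 from the defining condition of [S p] and 8 from the L^2 rate; [x] is the
     length term in [itg_small]. *)
  apply: (@le_of_geometric _ _ _ (10 + x)) => [|n]; first by rewrite addr_ge0.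
  pose p := maxn n (Num.truncn x).+1.
  have [_ _ hp] := Sh p.
  have xp : x <= p%:R.
    by apply: le_trans (ltW (truncnS_gt x)) _; rewrite ler_nat leq_maxr.
  have [hx h2x] := loc x (h p) Dx (mh p) (ih p).
  have wi : igr `[0, x] (fun y => h p y - gam y) by exact: igrB.
  have w2 : igr D (fun y => (h p y - gam y) ^+ 2) by exact: igr_sqB.
  have w2x : igr `[0, x] (fun y => (h p y - gam y) ^+ 2).
    by apply: integrableS w2 => //; exact: sub.
  have wc : itg `[0, x] (fun y => (h p y - gam y) ^+ 2) <= 8 / 4 ^+ p.
    apply: le_trans (hg p); apply: itg_sub => //; first exact: sub.
    by move=> y _; exact: sqr_ge0.
  have P0 : 0 < 2 ^+ p :> R by rewrite exprn_gt0.
  have := itg_small x0 P0 wi w2x wc; rewrite RintegralB//.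
  have -> : 2 ^+ p * (8 / 4 ^+ p) = 8 / 2 ^+ p :> R.
    rewrite (_ : 4 = 2 * 2 :> R); last by ring.
    by rewrite exprMn; field; rewrite gt_eqF.
  have := hp x Dx xp.
  have : (10 + x) / 2 ^+ p <= (10 + x) / 2 ^+ n.
    by rewrite ler_wpM2l ?addr_ge0//; apply: p2le; exact: leq_maxl.
  rewrite !ler_norml => h1 /andP[? ?] /andP[? ?].
  by apply/andP; split; lra.
move=> k e e0; apply: filterS (cP k e e0) => i /=.
rewrite ler_norml => /andP[h1 _].
suff : itg (B k) (fun x => gam x ^+ 2) <= c k by lra.
apply: (@itg_sq_limit_le _ D (B k) gam h 8 (c k)) => //.
move=> e' e'0; exists (maxn k (Num.truncn (e'^-1)).+1) => n nn.
have [_ hk _] := Sh n.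
apply: le_trans (hk k (leq_trans (leq_maxl _ _) nn)) _; rewrite lerD2l.
rewrite invf_ple ?posrE ?exprn_gt0//.
apply: le_trans (ltW (truncnS_gt _)) _.
by rewrite -natrX ler_nat; apply: leq_trans (leq_trans (leq_maxr k _) nn) (ltnW (ltn_expl _ _)).
Qed.

End PieceLimit.

(** * Lower semicontinuity of the energy on one edge *)

Section PieceSemicontinuity.
Variables (R : realType) (I : Type) (U : set_system I).
Context {UU : UltraFilter U}.
Local Notation mu := (@lebesgue_measure R).
Local Notation igr D f := (mu.-integrable D (EFin \o f)).
Local Notation itg D f := (Rintegral mu D f).
Local Notation sq u := (fun x => u x ^+ 2).

Section generic.
Variables (D : set R) (u g : I -> R -> R) (C M m : R).
Hypotheses (sD : segdom D) (C0 : 0 < C) (M0 : 0 <= M).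
Let P i := [/\ H1on D (u i) (g i), itg D (fun x => g i x ^+ 2) <= C,
  itg D (fun x => u i x ^+ 2) <= m & forall x, D x -> `|u i x| <= M].
Hypothesis UP : U P.
Let mD : measurable D. Proof. by case: sD. Qed.
Let B (k : nat) := D `&` `[0, k%:R].
Let mB k : measurable (B k). Proof. exact: measurableI. Qed.
Let BD k : B k `<=` D. Proof. exact: subIsetl. Qed.

Lemma itg_en_on (E : set R) (v h : R -> R) : measurable E ->
  igr E (sq h) -> igr E (fun x => v x ^+ 6) ->
  itg E (en v h) = 2^-1 * itg E (sq h) - 6^-1 * itg E (fun x => v x ^+ 6).
Proof.
move=> mE h2 v6; rewrite /en RintegralB//; [|exact: igrZ..].
by rewrite !RintegralZl.
Qed.

(* The truncations make the L^6 norm continuous, the energy of the discarded tails being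
   bounded below. *)
Lemma piece_lsc :
  (forall phi gam, H1on D phi gam -> (forall x, D x -> `|phi x| <= M) ->
    (forall x, D x -> forall e : R, 0 < e -> U [set i | `|u i x - phi x| <= e]) ->
    forall e : R, 0 < e -> exists k : nat,
    [/\ itg D (sq phi) <= itg (B k) (sq phi) + e,
        itg D (en phi gam) <= itg (B k) (en phi gam) + e &
        U [set i | itg (B k) (en (u i) (g i)) <= itg D (en (u i) (g i)) + e]]) ->
  exists phi gam : R -> R, [/\ H1on D phi gam,
    (forall x, D x -> forall e : R, 0 < e -> U [set i | `|u i x - phi x| <= e]),
    (forall e : R, 0 < e -> U [set i | itg D (sq phi) <= itg D (sq (u i)) + e]) &
    (forall e : R, 0 < e -> U [set i | itg D (en phi gam) <= itg D (en (u i) (g i)) + e])].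
Proof.
move=> Htail; have [phi phiP] := pointwise_limit M0 UP.
have phiM := limit_bound (UU := UU) UP phiP.
have [gam [Hphi gamP]] := weak_limit sD C0 M0 UP phiP.
have T := Htail _ _ Hphi phiM phiP.
have p6 i : P i -> igr D (fun x => u i x ^+ 6).
  by move=> [Hi _ _ uM]; exact: (H1on_igr_pow sD Hi 4 uM).
have p2 i : P i -> igr D (sq (u i)) by move=> [[]].
exists phi, gam; split => // e e0.
  have e20 : 0 < e / 2 by rewrite divr_gt0.
  have [k [h1 _ _]] := T _ e20.
  have H2 := limit_itg_pow (UU := UU) sD C0 M0 UP phiP k e20 p2.
  apply: filterS2 UP H2 => i Pi /=; rewrite ler_norml => /andP[h2 _].
  have : itg (B k) (sq (u i)) <= itg D (sq (u i)).
    by apply: itg_sub => //; [move=> x _; exact: sqr_ge0|exact: p2].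
  rewrite -/(B k) in h2; lra.
have e40 : 0 < e / 4 by rewrite divr_gt0.
have [k [_ h1 h2]] := T _ e40.
have H6 := limit_itg_pow (UU := UU) sD C0 M0 UP phiP k e40 p6.
have Hg := gamP k _ e40.
apply: filterS2 (filterI UP h2) (filterI H6 Hg) => i [Pi /= h3] [/= h4 h5].
have mBk := mB k.
have [[mgi g2i u2i _] _ _ _] := Pi; have [mgam gam2 _ _] := Hphi.
have phi6 : igr D (fun x => phi x ^+ 6) by exact: (H1on_igr_pow sD Hphi 4 phiM).
have E1 : itg (B k) (en (u i) (g i)) = 2^-1 * itg (B k) (sq (g i)) -
    6^-1 * itg (B k) (fun x => u i x ^+ 6).
  by apply: itg_en_on => //; [exact: igrS g2i|apply: igrS (p6 i Pi)].
have E2 : itg (B k) (en phi gam) = 2^-1 * itg (B k) (sq gam) -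
    6^-1 * itg (B k) (fun x => phi x ^+ 6).
  by apply: itg_en_on => //; [exact: igrS gam2|apply: igrS phi6].
move: h4; rewrite ler_norml => /andP[h4 h4'].
rewrite -/(B k) in h4 h4' h5.
by move: h1 h3; rewrite E1 E2; lra.
Qed.

End generic.

Lemma piece_lsc_bnd (l : R) (u g : I -> R -> R) (C M m : R) : 0 < l -> 0 < C -> 0 <= M ->
  U [set i | [/\ H1on `[0, l] (u i) (g i), itg `[0, l] (sq (g i)) <= C,
    itg `[0, l] (sq (u i)) <= m & forall x, `[0, l]%classic x -> `|u i x| <= M]] ->
  exists phi gam : R -> R, [/\ H1on `[0, l] phi gam,
    (forall x, `[0, l]%classic x -> forall e : R, 0 < e -> U [set i | `|u i x - phi x| <= e]),
    (forall e : R, 0 < e -> U [set i | itg `[0, l] (sq phi) <= itg `[0, l] (sq (u i)) + e]) &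
    (forall e : R, 0 < e -> U [set i | itg `[0, l] (en phi gam) <= itg `[0, l] (en (u i) (g i)) + e])].
Proof.
move=> l0 C0 M0 UP; apply: (piece_lsc (segdom_bnd (ltW l0)) C0 M0 UP).
move=> phi gam _ _ _ e e0; pose k := (Num.truncn l).+1; exists k.
have -> : `[0, l]%classic `&` `[0, k%:R]%classic = `[0, l]%classic.
  apply/setIidPl => x; rewrite /= !in_itv/= => /andP[-> xl]/=.
  exact: le_trans xl (ltW (truncnS_gt _)).
by split; rewrite ?lerDl ?(ltW e0)//; apply: filterS filterT => i _ /=; rewrite lerDl ltW.
Qed.

(** What escapes to infinity has mass at most mu_R, so by [tail_energy_ge] its energy is bounded
    below by a boundary term at k, and this is small because u(k) is close to the small value
    phi(k). *)
Lemma piece_lsc_y (u g : I -> R -> R) (C M : R) : 0 < C -> 0 <= M ->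
  U [set i | [/\ H1on `[0, +oo[ (u i) (g i), itg `[0, +oo[ (sq (g i)) <= C,
    itg `[0, +oo[ (sq (u i)) <= mu_line R & forall x, `[0, +oo[%classic x -> `|u i x| <= M]] ->
  exists phi gam : R -> R, [/\ H1on `[0, +oo[ phi gam,
    (forall x, `[0, +oo[%classic x -> forall e : R, 0 < e -> U [set i | `|u i x - phi x| <= e]),
    (forall e : R, 0 < e -> U [set i | itg `[0, +oo[ (sq phi) <= itg `[0, +oo[ (sq (u i)) + e]) &
    (forall e : R, 0 < e -> U [set i | itg `[0, +oo[ (en phi gam) <= itg `[0, +oo[ (en (u i) (g i)) + e])].
Proof.
move=> C0 M0 UP; apply: (piece_lsc (segdom_y R) C0 M0 UP).
move=> phi gam Hphi phiM phiP e e0.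
have [mgam gam2 phi2 _] := Hphi.
have [X1 X10 HX1] := itg_tail phi2 (fun x _ => sqr_ge0 _) e0.
have [X2 X20 HX2] := itg_tail gam2 (fun x _ => sqr_ge0 _) e0.
(* Once |u(k)| <= 2 eta, the boundary term (M + 1)^2 u(k)^2 is at most [e]. *)
pose eta := Num.sqrt e / (2 * (M + 1)).
have eta0 : 0 < eta by rewrite divr_gt0 ?sqrtr_gt0// mulr_gt0// ltr_wpDl.
have [X3 X30 HX3] := H1on_cvg0 Hphi eta0.
(* The sum exceeds each of the three thresholds: tail mass, tail of the derivative, and size of
   phi. *)
pose k := (Num.truncn (X1 + X2 + X3)).+1; exists k.
have kX : X1 + X2 + X3 <= k%:R by exact: ltW (truncnS_gt _).
have k0 : 0 <= k%:R :> R by [].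
have -> : `[(0:R), +oo[%classic `&` `[0, k%:R]%classic = `[0, k%:R]%classic.
  by apply/setIidPr => x; rewrite /= !in_itv/= andbT => /andP[].
have kD : `[(0:R), +oo[%classic k%:R by rewrite /= in_itv/= k0.
have mk : measurable (`[k%:R, +oo[%classic : set R) by [].
have kS : `[(k%:R : R), +oo[ `<=` `[0, +oo[.
  by move=> x; rewrite /= !in_itv/= !andbT; exact: le_trans.
have phi6 : igr `[0, +oo[ (fun x => phi x ^+ 6).
  exact: (H1on_igr_pow (segdom_y R) Hphi 4 phiM).
have ien v h A : H1on `[0, +oo[ v h -> (forall x, `[(0:R), +oo[%classic x -> `|v x| <= A) ->
    igr `[0, +oo[ (en v h).
  move=> Hv vA; rewrite /en; apply: igrB => //; apply: igrZ => //; first by case: Hv.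
  exact: (H1on_igr_pow (segdom_y R) Hv 4 vA).
split.
- rewrite (itg_splity k0 phi2) lerD2l; apply: HX1; lra.
- rewrite (itg_splity k0 (ien _ _ _ Hphi phiM)) lerD2l.
  apply: (@le_trans _ _ (itg `[k%:R, +oo[ (sq gam))); last by apply: HX2; lra.
  apply: le_Rintegral => //.
  + by apply: igrS (ien _ _ _ Hphi phiM).
  + by apply: igrS gam2.
  + move=> x _; rewrite /en.
    have : 0 <= phi x ^+ 6 by rewrite (exprM _ 2 3) exprn_ge0// sqr_ge0.
    have := sqr_ge0 (gam x); lra.
- apply: filterS2 UP (phiP _ kD _ eta0) => i [Hi _ um uM] /= h.
  rewrite (itg_splity k0 (ien _ _ _ Hi uM)) -addrA lerDl.
  have mass : itg `[k%:R, +oo[ (sq (u i)) <= mu_line R.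
    apply: le_trans um; apply: itg_sub => //; first by move=> x _; exact: sqr_ge0.
    by case: Hi.
  have M1 : 0 < M + 1 by rewrite ltr_wpDl.
  have uM1 x : k%:R <= x -> `|u i x| <= M + 1.
    move=> kx; apply: (@le_trans _ _ M); last by rewrite lerDl.
    by apply: uM; rewrite /= in_itv/= (le_trans k0 kx).
  have T := tail_energy_ge Hi k0 mass uM1.
  have uk : `|u i k%:R| <= 2 * eta.
    have pk : `|phi k%:R| <= eta by apply: HX3; lra.
    rewrite -[u i k%:R](subrK (phi k%:R)); apply: le_trans (ler_normD _ _) _; lra.
  have := norm_le_sqr uk => u2.
  have : (M + 1) ^+ 2 * u i k%:R ^+ 2 <= e.
    apply: le_trans (ler_wpM2l (sqr_ge0 _) u2) _.
    have E : (M + 1) * (2 * eta) = Num.sqrt e by rewrite /eta; field; rewrite gt_eqF.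
    rewrite -exprMn E.
    by rewrite sqr_sqrtr// ltW.
  lra.
Qed.

End PieceSemicontinuity.

(** * Minimisers on the graph *)

Section Existence.
Variables (R : realType) (G : metric_graph R).
Local Notation mu := (@lebesgue_measure R).
Local Notation itg D f := (Rintegral mu D f).
Local Notation J := (BE G + HL G)%type.
Hypothesis oneHL : #|HL G| = 1%N.
Hypothesis noterm : forall v : V G, ~ terminal_point v.

Lemma P6_ge0 (f : gfun G) : 0 <= P6 f.
Proof.
apply: sumr_ge0 => j _; apply: Rintegral_ge0 => x _.
by rewrite (exprM _ 2 3) exprn_ge0// sqr_ge0.
Qed.

Lemma P6_le (f : gfun G) (A : R) : H1 f -> (forall j x, dom j x -> `|uu f j x| <= A) ->
  P6 f <= A ^+ 4 * Mass f.
Proof.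
move=> Hf uA; rewrite /P6 /Mass mulr_sumr; apply: ler_sum => j _.
have mj := mdom j; have [_ _ u2 _] := H1_on j Hf.
rewrite -RintegralZl//; apply: le_Rintegral => //; [exact: igr_u6|exact: igrZ|].
move=> x Dx; rewrite (exprD _ 4 2) ler_wpM2r ?sqr_ge0//.
rewrite (exprM _ 2 2) (exprM A 2 2); apply: norm_le_sqr.
by rewrite ger0_norm ?sqr_ge0//; apply: norm_le_sqr; exact: uA.
Qed.

Lemma H1_of_on (f : gfun G) (phi : V G -> R) :
  (forall e, ub f e 0 = phi (bsrc e) /\ ub f e (blen e) = phi (btgt e)) ->
  (forall h, uh f h 0 = phi (hsrc h)) ->
  (forall j, H1on (dom j) (uu f j) (gg f j)) -> H1 f.
Proof.
move=> phib phih Hj; split; first by exists phi.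
split=> [e|h].
  have [mg g2 _ Hu] := Hj (inl e); split=> //=.
  by have := itgE (mdom (inl e)) g2 => /= ->; exact: ltry.
have [mg g2 u2 Hu] := Hj (inr h); split=> //=.
- by have := itgE (mdom (inr h)) g2 => /= ->; exact: ltry.
- by have := itgE (mdom (inr h)) u2 => /= ->; exact: ltry.
- by move=> x x0; apply: Hu; rewrite /= in_itv/= x0.
Qed.

(** Either the maximum is too small for [energy_coercive], hence bounded, or that estimate
    contradicts the level -c unless the maximum is bounded. The derivative follows, since negative
    energy bounds [Dn] by a third of [P6]. *)
Lemma negative_energy_bounded (m c : R) : 0 < m -> m <= mu_line R -> 0 < c ->
  exists2 M : R, 0 <= M & forall f : gfun G, H1 f -> Mass f = m -> Ene f <= - c ->
    (forall j x, dom j x -> `|uu f j x| <= M) /\ Dn f <= M ^+ 4 * m.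
Proof.
move=> m0 ml c0; have l0 := lmin_gt0 G.
have l30 : 0 < lmin G ^+ 3 by rewrite exprn_gt0.
(* The two terms bound the squared maximum in the two cases; Q + 1 then bounds the maximum itself,
   as a <= a^2 + 1. *)
pose Q := 4 * m / lmin G + 512 * m / (c * lmin G ^+ 3).
have q1 : 0 <= 4 * m / lmin G by apply: divr_ge0; [apply: mulr_ge0|]; rewrite ?ltW.
have q2 : 0 <= 512 * m / (c * lmin G ^+ 3).
  by apply: divr_ge0; apply: mulr_ge0; rewrite ?ltW.
have Q0 : 0 <= Q by exact: addr_ge0.
exists (Q + 1) => [|f Hf fm Ef]; first by lra.
have [h0 _] := exists_HL oneHL.
have [j [y [Dy mx]]] := gfun_max (inr h0) Hf.
have aQ : `|uu f j y| ^+ 2 <= Q.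
  have [a0|] := ltP 0 `|uu f j y|; last first.
    by rewrite normr_le0 => /eqP ->; rewrite normr0 expr0n.
  have [big|small] := leP (4 * Mass f) (`|uu f j y| ^+ 2 * lmin G); last first.
    rewrite fm -ltr_pdivlMr// in small; rewrite /Q; lra.
  have := energy_coercive oneHL noterm Hf _ Dy mx a0 big; rewrite fm => /(_ ml) Ec.
  have a20 : 0 < `|uu f j y| ^+ 2 by rewrite exprn_gt0.
  have : c <= 512 * m / (`|uu f j y| ^+ 2 * lmin G ^+ 3) by lra.
  rewrite ler_pdivlMr; last by rewrite mulr_gt0.
  rewrite mulrCA -ler_pdivlMr; last by rewrite mulr_gt0.
  by rewrite /Q; lra.
have aM : `|uu f j y| <= Q + 1.
  by have := sqr_ge0 (`|uu f j y| - 1); have := normr_ge0 (uu f j y); lra.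
have bnd j' x : dom j' x -> `|uu f j' x| <= Q + 1 by move=> /mx h; exact: le_trans aM.
split => //.
have := P6_le Hf bnd; rewrite fm; have := EneE Hf.
have : 0 <= (Q + 1) ^+ 4 * m by rewrite mulr_ge0 ?ltW// exprn_gt0//; lra.
lra.
Qed.

Lemma Ene_ge (f : gfun G) (M : R) : H1 f -> (forall j x, dom j x -> `|uu f j x| <= M) ->
  - (M ^+ 4 * Mass f) <= Ene f.
Proof.
move=> Hf bnd; rewrite EneE//; have := P6_le Hf bnd; have := P6_ge0 f.
have : 0 <= Dn f.
  by apply: sumr_ge0 => j _; apply: Rintegral_ge0 => x _; exact: sqr_ge0.
lra.
Qed.

Lemma energy_bounded_below (m : R) : 0 < m -> m <= mu_line R ->
  exists b : R, forall f : gfun G, H1 f -> Mass f = m -> b <= Ene f.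
Proof.
move=> m0 ml; have [M M0 HM] := negative_energy_bounded m0 ml ltr01.
exists (- 1 - M ^+ 4 * m) => f Hf fm.
have := mulr_ge0 (exprn_ge0 4 M0) (ltW m0).
have [E1|E1] := leP (Ene f) (- 1); last by lra.
by have [bnd _] := HM f Hf fm E1; have := Ene_ge Hf bnd; rewrite fm; lra.
Qed.

Lemma ler_addmulP (X Y c : R) : 0 <= c -> (forall e : R, 0 < e -> X <= Y + c * e) -> X <= Y.
Proof.
move=> c0 H; apply/ler_addgt0Pr => e e0.
have c1 : 0 < c + 1 by rewrite ltr_wpDl.
have e'0 : 0 < e / (c + 1) by rewrite divr_gt0.
apply: le_trans (H _ e'0) _; rewrite lerD2l mulrA ler_pdivrMr// mulrC ler_pM2l//.
by rewrite lerDl.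
Qed.

Section limit.
Variables (U : set_system (gfun G)) (UU : UltraFilter U) (m C M : R).
Hypotheses (ml : m <= mu_line R) (C0 : 0 < C) (M0 : 0 <= M).
Hypothesis Ubnd : U [set f | [/\ H1 f, Mass f = m, Dn f <= C &
  forall j x, dom j x -> `|uu f j x| <= M]].

Lemma piece_limit (j : J) : exists pg : (R -> R) * (R -> R), [/\ H1on (dom j) pg.1 pg.2,
    (forall x, dom j x -> forall e : R, 0 < e -> U [set f | `|uu f j x - pg.1 x| <= e]),
    (forall e : R, 0 < e -> U [set f | itg (dom j) (fun x => pg.1 x ^+ 2) <=
       itg (dom j) (fun x => uu f j x ^+ 2) + e]) &
    (forall e : R, 0 < e -> U [set f | itg (dom j) (en pg.1 pg.2) <=
       itg (dom j) (en (uu f j) (gg f j)) + e])].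
Proof.
have UP : U [set f | [/\ H1on (dom j) (uu f j) (gg f j),
    itg (dom j) (fun x => gg f j x ^+ 2) <= C,
    itg (dom j) (fun x => uu f j x ^+ 2) <= mu_line R &
    forall x, dom j x -> `|uu f j x| <= M]].
  apply: filterS Ubnd => f [Hf fm fC fM]; split.
  - exact: H1_on.
  - apply: le_trans fC; apply: (@sumJ_ge1 _ _ (fun j => itg (dom j) (fun x => gg f j x ^+ 2))).
    by move=> j'; apply: Rintegral_ge0 => x _; exact: sqr_ge0.
  - apply: le_trans ml; rewrite -fm.
    apply: (@sumJ_ge1 _ _ (fun j => itg (dom j) (fun x => uu f j x ^+ 2))).
    by move=> j'; apply: Rintegral_ge0 => x _; exact: sqr_ge0.
  - exact: fM.
case: j UP => [e|h] UP.
  have [phi [gam H]] := piece_lsc_bnd (UU := UU) (blen_gt0 e) C0 M0 UP.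
  by exists (phi, gam).
have [phi [gam H]] := piece_lsc_y (UU := UU) C0 M0 UP.
by exists (phi, gam).
Qed.

Lemma limit_gfun : exists f0 : gfun G, [/\ H1 f0, Mass f0 <= m &
  forall c, (forall e : R, 0 < e -> U [set f | Ene f <= c + e]) -> Ene f0 <= c].
Proof.
have [pg pgP] := choice piece_limit.
pose f0 : gfun G := GFun (fun e => (pg (inl e)).1) (fun e => (pg (inl e)).2)
  (fun h => (pg (inr h)).1) (fun h => (pg (inr h)).2).
have u0 j : uu f0 j = (pg j).1 by case: j.
have g0 j : gg f0 j = (pg j).2 by case: j.
(* Vertex values are selected for all functions at once, so that their limits along the ultrafilter
   serve as common values of all limit edges at a vertex; outside H^1 the choice is arbitrary. *)
have [vf vfP] : exists vf : gfun G -> V G -> R, forall f, H1 f ->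
    (forall e, ub f e 0 = vf f (bsrc e) /\ ub f e (blen e) = vf f (btgt e)) /\
    (forall h, uh f h 0 = vf f (hsrc h)).
  have ex (f : gfun G) : exists vf : V G -> R, H1 f ->
      (forall e, ub f e 0 = vf (bsrc e) /\ ub f e (blen e) = vf (btgt e)) /\
      (forall h, uh f h 0 = vf (hsrc h)).
    have [[[phi P] _]|nH] := pselect (H1 f); first by exists phi.
    by exists (fun=> 0).
  by have [vf vfP] := choice ex; exists vf.
have vlim v j x : dom j x -> (forall f, H1 f -> uu f j x = vf f v) ->
    (pg j).1 x = lim (vf f v @[f --> U]).
  move=> Dx Hv; apply/esym/cvg_lim => //; apply/cvgrPdist_le => e e0.
  have [_ pw _ _] := pgP j.
  have F := pw x Dx e e0.
  change (U [set f | `|(pg j).1 x - vf f v| <= e]).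
  by apply: filterS2 Ubnd F => f [Hf _ _ _] /=; rewrite Hv// distrC.
have n0 : 0 <= #|{: J}|%:R :> R by [].
have H0 : H1 f0.
  apply: (@H1_of_on f0 (fun v => lim (vf f v @[f --> U]))).
  - move=> e; have l0 := ltW (blen_gt0 e); split.
      apply: (@vlim _ (inl e)) => [|f /vfP[vb _]]; first by rewrite /= in_itv/= lexx.
      by have [] := vb e.
    apply: (@vlim _ (inl e)) => [|f /vfP[vb _]]; first by rewrite /= in_itv/= lexx l0.
    by have [] := vb e.
  - move=> h; apply: (@vlim _ (inr h)) => [|f /vfP[_ vh]]; first by rewrite /= in_itv/= lexx.
    exact: vh.
  - by move=> j; rewrite u0 g0; have [] := pgP j.
exists f0; split => //.
  apply: (ler_addmulP n0) => e e0.
  have UJ : U [set f | forall j, itg (dom j) (fun x => (pg j).1 x ^+ 2) <=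
       itg (dom j) (fun x => uu f j x ^+ 2) + e].
    by apply: filter_forall => j; have [_ _ H _] := pgP j; exact: H.
  have [f [[Hf fm _ _] /= Hj]] := filter_ex (filterI Ubnd UJ).
  rewrite -fm /Mass mulr_natl -[#|_|]/(#|{: J}|) -sumr_const -big_split/=.
  by apply: ler_sum => j _; rewrite u0; exact: Hj.
move=> c Uc; apply: (@ler_addmulP _ _ (#|{: J}|%:R + 1)) => [|e e0]; first by rewrite addr_ge0.
have UJ : U [set f | forall j, itg (dom j) (en (pg j).1 (pg j).2) <=
     itg (dom j) (en (uu f j) (gg f j)) + e].
  by apply: filter_forall => j; have [_ _ _ H] := pgP j; exact: H.
have [f [/= fc Hj]] := filter_ex (filterI (Uc e e0) UJ).
rewrite mulrDl mul1r (addrC _ e) addrA; apply: le_trans (_ : Ene f + #|{: J}|%:R * e <= _); last first.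
  by rewrite lerD2r.
rewrite /Ene mulr_natl -sumr_const -big_split/=.
by apply: ler_sum => j _; rewrite u0 g0; exact: Hj.
Qed.

End limit.

(* A limit of mass smaller than m is rescaled, which only lowers a negative energy. *)
Lemma minimizer_exists (m : R) : mu_halfline R < m -> m <= mu_line R ->
  exists f : gfun G, [/\ H1 f, Mass f = m &
    forall f' : gfun G, H1 f' -> Mass f' = m -> Ene f <= Ene f'].
Proof.
move=> hm ml; have m0 : 0 < m by apply: lt_trans hm; exact: mu_halfline_gt0.
pose S := [set Ene f | f in [set f : gfun G | H1 f /\ Mass f = m]].
have [fn [Hn nm En]] := testf_negative oneHL noterm hm.
have [b Hb] := energy_bounded_below m0 ml.
have lbS : has_lbound S by exists b => _ [f [Hf fm] <-]; exact: Hb.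
have infS : has_inf S by split=> //; exists (Ene fn), fn.
pose c := inf S.
have cle (f : gfun G) : H1 f -> Mass f = m -> c <= Ene f.
  by move=> Hf fm; apply: ge_inf => //; exists f.
have c0 : c < 0 by apply: le_lt_trans En; exact: cle.
(* The near-minimisers generate a filter; an ultrafilter containing it takes the place of a
   minimising sequence. *)
pose F : set_system (gfun G) := [set X | exists2 e : R, 0 < e &
  forall f, H1 f -> Mass f = m -> Ene f <= c + e -> X f].
have FF : ProperFilter F.
  apply: Build_ProperFilter.
    move=> [e e0 HX]; have [_ [f [Hf fm] <-] fe] := inf_adherent e0 infS.
    by apply: (HX f) => //; exact: ltW.
  split.
  - by exists 1.
  - move=> X Y [e e0 HX] [e' e'0 HY]; exists (Num.min e e'); first by rewrite lt_min e0.
    move=> f Hf fm fe; split; [apply: HX|apply: HY] => //; apply: le_trans fe _;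
    by rewrite lerD2l ge_min lexx ?orbT.
  - by move=> X Y XY [e e0 HX]; exists e => // f Hf fm fe; apply: XY; exact: HX.
have [U [UU FU]] := ultraFilterLemma FF.
have c20 : 0 < - c / 2 by rewrite divr_gt0// oppr_gt0.
have [M M0 HM] := negative_energy_bounded m0 ml c20.
have C0 : 0 < M ^+ 4 * m + 1 by rewrite ltr_wpDl// mulr_ge0 ?exprn_ge0// ltW.
have Ubnd : U [set f | [/\ H1 f, Mass f = m, Dn f <= M ^+ 4 * m + 1 &
    forall j x, dom j x -> `|uu f j x| <= M]].
  apply: FU; exists (- c / 2) => // f Hf fm fe.
  have [bnd fD] := HM f Hf fm ltac:(lra).
  by split => //; lra.
have [f0 [H0 f0m E0]] := limit_gfun UU ml C0 M0 Ubnd.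
have Ec : Ene f0 <= c by apply: E0 => e e0; apply: FU; exists e.
(* A limit of zero mass would have nonnegative energy, but the infimum is negative. *)
have Mpos : 0 < Mass f0.
  rewrite lt_neqAle Mass_ge0 andbT eq_sym; apply/eqP => f00.
  have [A A0 bnd] := gfun_bounded H0.
  by have := Ene_ge H0 bnd; rewrite f00 mulr0 oppr0; lra.
pose w := m / Mass f0.
have w1 : 1 <= w by rewrite ler_pdivlMr// mul1r.
have w0 : 0 <= w by lra.
exists (gscale (Num.sqrt w) f0); split.
- exact: H1_gscale.
- by rewrite Mass_gscale// sqr_sqrtr// divfK// gt_eqF.
move=> f' Hf' f'm; apply: le_trans (cle f' Hf' f'm).
rewrite Ene_gscale// (exprM _ 2 3) sqr_sqrtr//.
have E := EneE H0.
(* For w >= 1 the rescaled energy is at most w times the old one, hence at most the old one because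
   that is negative. *)
have w3 : w * P6 f0 <= w ^+ 3 * P6 f0.
  by rewrite ler_wpM2r ?P6_ge0//; apply: ler_eXnr.
have : w * Ene f0 <= 1 * Ene f0 by rewrite ler_wnM2r//; lra.
rewrite mul1r {1}E; lra.
Qed.

End Existence.

(** * The optimal constant and the ground state level *)

Section Conclusion.
Variables (R : realType) (G : metric_graph R).
Hypotheses (conn : connected_graph G) (oneHL : #|HL G| = 1%N).
Hypothesis noterm : forall v : V G, ~ terminal_point v.

Lemma mu_halfline_sqr : mu_halfline R ^+ 2 = 3 * pi ^+ 2 / 16.
Proof.
rewrite /mu_halfline !exprMn sqr_sqrtr// exprVn; by field.
Qed.

(** The bound 16 / pi^2 is 3 / mu_(R^+)^2. Strictness of the inequality also yields a positive
    denominator. *)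
Lemma gn_ratio_le (f : gfun G) : H1 f -> Mass f <> 0 ->
  P6 f / (Mass f ^+ 2 * Dn f) <= 16 / pi ^+ 2.
Proof.
move=> Hf M0; have := gagliardo_nirenberg conn oneHL noterm Hf M0.
rewrite mu_halfline_sqr => GN.
have p20 : 0 < pi ^+ 2 :> R by rewrite exprn_gt0// pi_gt0.
have X0 : 0 < Mass f ^+ 2 * Dn f.
  have : 0 <= P6 f * (3 * pi ^+ 2 / 16).
    by rewrite mulr_ge0 ?P6_ge0// divr_ge0// mulr_ge0// ltW.
  lra.
rewrite ler_pdivrMr// mulrAC ler_pdivlMr//; lra.
Qed.

Lemma ratio_num (p k y : R) : 0 < p -> 0 < k -> 0 < y ->
  (y * p / (2 * k) + p / (4 * k)) / ((y * p / (2 * k) + p / (2 * k)) ^+ 2 * (k * p / 16)) =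
  16 * (1 + 2 * y) / (p ^+ 2 * (1 + y) ^+ 2).
Proof.
move=> p0 k0 y0; have y1 : 0 < 1 + y by rewrite addr_gt0.
have py : 0 < y * p + p by rewrite addr_gt0// mulr_gt0.
by field; rewrite !gt_eqF.
Qed.

Lemma gn_ratio_ge (e : R) : 0 < e -> exists f : gfun G, [/\ H1 f, Mass f <> 0 &
  16 / pi ^+ 2 - e <= P6 f / (Mass f ^+ 2 * Dn f)].
Proof.
move=> e0; have p0 := pi_gt0 R; have L0 := core_len_gt0 oneHL noterm.
set L := core_len G in L0 *.
(* [y] is the ratio of the core's mass to that of the half soliton. The quotient is 16 / pi^2 times
   (1 + 2 y) / (1 + y)^2, and the deficit allowed by [e] is 32 y / pi^2. *)
pose y := e * pi ^+ 2 / 32.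
have y0 : 0 < y by rewrite divr_gt0// mulr_gt0// exprn_gt0.
pose k := y * pi / (2 * L).
have k0 : 0 < k by rewrite divr_gt0// mulr_gt0.
have H1t := @testf_H1 R G 1 k 0 k0.
have kL : k * L = y * pi / 2 by rewrite /k; field; rewrite gt_eqF.
have kn : k != 0 by rewrite gt_eqF.
have pn : (pi : R) != 0 by rewrite gt_eqF.
have d0 : 0 < L + pi / (2 * k) by rewrite addr_gt0// divr_gt0// mulr_gt0.
exists (testf G 1 k 0); split => //; rewrite testf0_Mass// ?testf0_P6// ?testf0_Dn// !expr1n !mul1r -/L.
  by apply/eqP; rewrite gt_eqF.
have -> : (L + pi / (4 * k)) / ((L + pi / (2 * k)) ^+ 2 * (k * pi / 16)) =
   16 * (1 + 2 * y) / (pi ^+ 2 * (1 + y) ^+ 2).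
  have -> : L = y * pi / (2 * k) by apply: (mulfI kn); rewrite kL; move: (y * pi) => z; field.
  exact: ratio_num.
have y1 : 0 < 1 + y by lra.
rewrite ler_pdivlMr; last by rewrite mulr_gt0// exprn_gt0.
have -> : (16 / pi ^+ 2 - e) * (pi ^+ 2 * (1 + y) ^+ 2) = (16 - 32 * y) * (1 + y) ^+ 2.
  by rewrite /y; move: (@pi R) pn => p pn'; field.
have := mulr_ge0 (ltW y0) (sqr_ge0 y); have := sqr_ge0 y; have := mulr_ge0 (ltW y0) (ltW y0).
lra.
Qed.

Lemma muG_halfline : muG G = mu_halfline R.
Proof.
have p0 := pi_gt0 R.
have KE : KG G = (16 / pi ^+ 2)%:E.
  apply/eqP; rewrite eq_le; apply/andP; split.
    apply: ge_ereal_sup => _ [f [Hf Mf] <-].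
    rewrite massE// in Mf *; rewrite p6E// dnormE// lee_fin; apply: gn_ratio_le => // M0.
    by apply: Mf; rewrite M0.
  apply/lee_addgt0Pr => e e0; have [f [Hf Mf fe]] := gn_ratio_ge e0.
  rewrite -leeBlDr//; apply: le_trans (_ : (P6 f / (Mass f ^+ 2 * Dn f))%:E <= _)%E.
    by rewrite -EFinB lee_fin.
  apply: ereal_sup_ubound; exists f; last by rewrite massE// p6E// dnormE.
  by split=> //; rewrite massE// => -[].
rewrite /muG KE /=.
have -> : 3 / (16 / pi ^+ 2) = mu_halfline R ^+ 2.
  by rewrite mu_halfline_sqr; move: (@pi R) p0 => p p0; field; rewrite gt_eqF.
by rewrite sqrtr_sqr ger0_norm// ltW// mu_halfline_gt0.
Qed.

Lemma H1_muP m (f : gfun G) : H1_mu m f <-> H1 f /\ Mass f = m.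
Proof.
split=> [[Hf]|[Hf fm]]; first by rewrite massE// => -[].
by split=> //; rewrite massE// fm.
Qed.

Lemma Elev_minimum (f : gfun G) : H1 f ->
  (forall f' : gfun G, H1 f' -> Mass f' = Mass f -> Ene f <= Ene f') -> Elev G (Mass f) = (Ene f)%:E.
Proof.
move=> Hf fmin; apply/eqP; rewrite eq_le; apply/andP; split.
  by apply: ereal_inf_lbound; exists f; [exact/H1_muP|rewrite energyE].
apply: le_ereal_inf_tmp => _ [f' /H1_muP[Hf' f'm] <-].
by rewrite energyE// lee_fin fmin.
Qed.

Lemma Elev_le (f : gfun G) : H1 f -> (Elev G (Mass f) <= (Ene f)%:E)%E.
Proof. by move=> Hf; apply: ereal_inf_lbound; exists f; [exact/H1_muP|rewrite energyE]. Qed.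

End Conclusion.

Theorem theorem7p3 (R : realType) (G : metric_graph R) :
  connected_graph G ->
  #|HL G| = 1%N ->
  (forall v : V G, ~ terminal_point v) ->
  [/\ muG G = mu_halfline R,
      (forall m : R, mu_halfline R < m <= mu_line R ->
         (-oo < Elev G m)%E /\ (Elev G m < 0)%E) &
      (forall m : R, 0 < m ->
         ((exists f : gfun G, H1_mu m f /\ energy f = Elev G m) <->
          mu_halfline R < m <= mu_line R))].
Proof.
move=> conn oneHL noterm.
have attained m : mu_halfline R < m <= mu_line R -> exists f : gfun G,
    [/\ H1 f, Mass f = m & Elev G m = (Ene f)%:E].
  move=> /andP[hm ml]; have [f [Hf fm fmin]] := minimizer_exists oneHL noterm hm ml.
  by exists f; split=> //; rewrite -fm; apply: Elev_minimum => // f' Hf'; rewrite fm; exact: fmin.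
split.
- exact: muG_halfline.
- move=> m hm; split; first by have [f [_ _ ->]] := attained m hm; exact: ltNyr.
  move/andP: hm => [hm _]; have [f [Hf fm Ef]] := testf_negative oneHL noterm hm.
  by rewrite -fm; apply: le_lt_trans (Elev_le Hf) _; rewrite lte_fin.
- move=> m m0; split; last first.
    move=> /attained[f [Hf fm ->]]; exists f; split; last by rewrite energyE.
    exact/H1_muP.
  move=> [f [/H1_muP[Hf fm]]]; rewrite energyE// => Emin.
  have [hm|hm] := leP m (mu_halfline R).
    (* A minimiser would have positive energy, whereas spread-out competitors bring the infimum down
       to at most 0. *)
    have Ef : 0 < Ene f.
      apply: (energy_gt0 conn oneHL noterm Hf); rewrite fm//.
      by apply/eqP; rewrite gt_eqF.
    have E20 : 0 < Ene f / 2 by rewrite divr_gt0.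
    have [f' [Hf' f'm fe]] := testf_small oneHL noterm m0 E20.
    have := Elev_le Hf'; rewrite f'm -Emin lee_fin; lra.
  rewrite leNgt; apply/negP => ml.
  (* The bound 1 - E(f) asks for a competitor whose energy is below that of [f] by at least 1. *)
  have [f' [Hf' f'm fe]] := testf_unbounded oneHL noterm (1 - Ene f) ml.
  have := Elev_le Hf'; rewrite f'm -Emin lee_fin; lra.
Qed.
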